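(* Let $k$ be a field of characteristic $p\ge 0$. Let $G$ be a linear algebraic $k$-group which is an extension $$1\to T\to G\to F\to 1$$ of a finite $k$-group $F$ of order $n$ prime to $p$ by a $k$-torus $T$ which is split by an extension $L/k$ of degree $d$, also prime to $p$. Then there exist a finite $k$-subgroup $H$ of $G$ and a commutative diagram of $k$-groups with exact rows $$\begin{array}{ccccccccc}1&\to&{}_{nd}T&\to&H&\to&F&\to&1\\ &&\downarrow&&\downarrow&&\parallel&&\\ 1&\to&T&\to&G&\to&F&\to&1,\end{array}$$ in which the vertical maps ${}_{nd}T\to T$ and $H\to G$ are the inclusions.
   Context: ${}_{m}T$ denotes the $m$-torsion subgroup of the torus $T$. The order of a finite $k$-group is the degree of its structural morphism to $\mathrm{Spec}\,k$; in characteristic $p=0$ the condition ''prime to $p$'' is empty. The extension $L/k$ is a finite field extension. *)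

(* Defs.v *)
From HB Require Import structures.
From mathcomp Require Import all_boot all_order all_algebra all_field.

Set Implicit Arguments.
Unset Strict Implicit.
Unset Printing Implicit Defensive.

Import GRing.Theory.
Local Open Scope ring_scope.

Definition alg_comp (k : fieldType) (A R S : comAlgType k)
  (phi : {lrmorphism R -> S}) (x : {lrmorphism A -> R}) :
  {lrmorphism A -> S} := phi \o x.

(* An affine k-group scheme is given by its coordinate algebra [coord]
   together with a group structure, natural in R, on the set
   Hom_k-alg(coord, R) of R-points, for every commutative k-algebra R; by
   Yoneda this is the same as a commutative Hopf algebra.  [comAlgType] only
   contains nonzero algebras: nothing is lost, as the zero algebra admits
   exactly one homomorphism from [coord].  Points are compared by Leibniz
   equality; under functional extensionality and proof irrelevance this is
   equality of the underlying functions. *)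
Record affine_group (k : fieldType) := AffineGroup {
  coord : comAlgType k;
  pt_mul : forall R : comAlgType k, {lrmorphism coord -> R} ->
    {lrmorphism coord -> R} -> {lrmorphism coord -> R};
  pt_one : forall R : comAlgType k, {lrmorphism coord -> R};
  pt_inv : forall R : comAlgType k, {lrmorphism coord -> R} ->
    {lrmorphism coord -> R};
  pt_mulA : forall R : comAlgType k, associative (@pt_mul R);
  pt_mul1 : forall R : comAlgType k, left_id (pt_one R) (@pt_mul R);
  pt_mulV : forall R : comAlgType k,
    left_inverse (pt_one R) (@pt_inv R) (@pt_mul R);
  pt_mul_nat : forall (R S : comAlgType k) (phi : {lrmorphism R -> S})
    (x y : {lrmorphism coord -> R}),
    alg_comp phi (pt_mul x y) = pt_mul (alg_comp phi x) (alg_comp phi y)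
}.

Definition points (k : fieldType) (G : affine_group k) (R : comAlgType k) :=
  {lrmorphism coord G -> R}.

Definition pt_exp (k : fieldType) (G : affine_group k) (R : comAlgType k)
  (x : points G R) (m : nat) : points G R :=
  iter m (pt_mul x) (pt_one G R).

Record group_hom (k : fieldType) (G H : affine_group k) := GroupHom {
  comorphism : {lrmorphism coord H -> coord G};
  comorphismM : forall (R : comAlgType k) (x y : points G R),
    alg_comp (pt_mul x y) comorphism =
    pt_mul (alg_comp x comorphism) (alg_comp y comorphism)
}.

Definition on_points (k : fieldType) (G H : affine_group k)
  (f : group_hom G H) (R : comAlgType k) (x : points G R) : points H R :=
  alg_comp x (comorphism f).

(* Finite type: the only k-subalgebra containing some finite family of
   elements is the whole coordinate algebra. *)
Definition algebraic (k : fieldType) (G : affine_group k) : Prop :=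
  exists s : seq (coord G), forall S : {pred coord G},
    GRing.subalg_closed S -> {subset s <= S} -> forall a, a \in S.

Definition has_order (k : fieldType) (G : affine_group k) (n : nat) : Prop :=
  exists e : 'I_n -> coord G,
    bijective (fun c : 'rV[k]_n => \sum_(i < n) c 0 i *: e i).

Definition finite_group_scheme (k : fieldType) (G : affine_group k) : Prop :=
  exists n, has_order G n.

Definition closed_subgroup (k : fieldType) (H G : affine_group k)
  (j : group_hom H G) : Prop :=
  forall a : coord H, exists b : coord G, comorphism j b = a.

(* [tensor_eq0 phi t] says that the element \sum_(ma <- t) ma.1 (x) ma.2 of
   M (x)_B A vanishes, A being a B-module through phi: by the universal
   property of the tensor product, every B-bilinear map sends it to 0. *)
Definition tensor_eq0 (B A : comNzRingType) (phi : {rmorphism B -> A})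
  (M : lmodType B) (t : seq (M * A)) : Prop :=
  forall (P : lmodType B) (b : M -> A -> P),
    (forall c m m' a, b (c *: m + m') a = c *: b m a + b m' a) ->
    (forall c m a a', b m (phi c * a + a') = c *: b m a + b m a') ->
    \sum_(ma <- t) b ma.1 ma.2 = 0.

(* - (x)_B A preserves injections. *)
Definition flat (B A : comNzRingType) (phi : {rmorphism B -> A}) : Prop :=
  forall (M N : lmodType B) (u : {linear M -> N}), injective u ->
  forall t : seq (M * A),
    tensor_eq0 phi [seq (u ma.1, ma.2) | ma <- t] -> tensor_eq0 phi t.

(* Flat, and M (x)_B A = 0 only if M = 0. *)
Definition faithfully_flat (B A : comNzRingType) (phi : {rmorphism B -> A}) :
  Prop :=
  flat phi /\
  forall M : lmodType B, (forall t : seq (M * A), tensor_eq0 phi t) ->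
    forall m : M, m = 0.

(* 1 -> N -> G -> Q -> 1 is exact: i identifies N with the scheme-theoretic
   kernel of q, and q is faithfully flat (for algebraic groups over a field,
   this is surjectivity of q as a map of fppf sheaves). *)
Definition short_exact (k : fieldType) (N G Q : affine_group k)
  (i : group_hom N G) (q : group_hom G Q) : Prop :=
  [/\ closed_subgroup i,
      forall (R : comAlgType k) (x : points G R),
        on_points q x = pt_one Q R <-> exists y : points N R, on_points i y = x
    & faithfully_flat (comorphism q)].

Definition torsion_subgroup (k : fieldType) (T : affine_group k) (m : nat)
  (N : affine_group k) (a : group_hom N T) : Prop :=
  closed_subgroup a /\
  forall (R : comAlgType k) (x : points T R),
    pt_exp x m = pt_one T R <-> exists y : points N R, on_points a y = x.

Definition invertible (R : comNzRingType) (u : R) : Prop :=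
  exists v, u * v = 1.

(* T_K is isomorphic to G_m^r over K.  A commutative K-algebra is the same as a
   commutative k-algebra R with a k-algebra map [s : K -> R], and
   T_K(R) = T(R); [f] is an isomorphism of group functors on K-algebras from
   T_K onto the one sending R to r-tuples of invertible elements of R. *)
Definition split_over (k : fieldType) (T : affine_group k)
  (K : comAlgType k) : Prop :=
  exists (r : nat)
    (f : forall R : comAlgType k, {lrmorphism K -> R} -> points T R ->
           'I_r -> R),
  [/\ forall (R S : comAlgType k) (s : {lrmorphism K -> R})
        (phi : {lrmorphism R -> S}) (x : points T R) (j : 'I_r),
        f S (alg_comp phi s) (alg_comp phi x) j = phi (f R s x j),
      forall (R : comAlgType k) (s : {lrmorphism K -> R}) (x y : points T R)
        (j : 'I_r), f R s (pt_mul x y) j = f R s x j * f R s y j,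
      forall (R : comAlgType k) (s : {lrmorphism K -> R}) (x : points T R)
        (j : 'I_r), invertible (f R s x j)
    & forall (R : comAlgType k) (s : {lrmorphism K -> R}) (u : 'I_r -> R),
        (forall j, invertible (u j)) ->
        exists! x : points T R, forall j, f R s x j = u j].

(* The field extension K of k need not be finite. *)
Definition is_torus (k : fieldType) (T : affine_group k) : Prop :=
  algebraic T /\
  exists K : comAlgType k,
    (forall a : K, a != 0 -> invertible a) /\ split_over T K.

(* Empty condition in characteristic 0, where [pchar k] is empty. *)
Definition prime_to_char (k : fieldType) (n : nat) : Prop :=
  forall p, p \in [pchar k] -> coprime n p.

(* Main.v *)
Require Import Defs.
From HB Require Import structures.
From mathcomp Require Import all_boot all_order all_algebra all_field.
From mathcomp Require Import fingroup perm boolp ring zify.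

Set Implicit Arguments.
Unset Strict Implicit.
Unset Printing Implicit Defensive.

Import GRing.Theory.
Local Open Scope ring_scope.

(** Write m = n d and B = k[F] ⊗ L, an algebra of rank m over k.  Everything
    comes from a crossed homomorphism phi : G -> T, natural in the test ring,
    with phi(g h) = (g phi(h) g^-1) phi(g) and phi(t) = t^m for t in T.  Its
    zero locus H = {phi = 1} is a closed subgroup which meets T in the
    m-torsion of T.  If g lifts a point of F, then t g lies in H as soon as
    t^m = phi(g)^-1, an equation that is solvable after a finite free extension
    of the test ring, so that H still surjects onto F.

    If s is a section of G -> F defined over L, one would like to take for
    phi(g) the product of the elements g s(h) s(g h)^-1 of T, where h runs
    through the points of F and s through its conjugates.  In scheme-theoretic
    terms, s is a point of G over B, the elements g s(h) s(g h)^-1 form one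
    point u(g) of T over R ⊗ B (lemma [cocycleE]), and the product is a norm
    from R ⊗ B down to R.  The relation
    u(g h) = (g u(h) g^-1) . (h^* u(g)), with h^* the translation automorphism
    of R ⊗ B, becomes the crossed homomorphism identity ([crossedM]) because the
    norm commutes with conjugation by G(R) and is blind to R-automorphisms.

    The norm T(C) -> T(R), for C free of rank m over R, is Deligne's: the
    product of the m conjugates of x is a symmetric point of the m-fold tensor
    power of C, and symmetric tensors map to R by c_1 ⊗ ... ⊗ c_m |->
    det (c_1 e_1, ..., c_m e_m) ([wdeltaM]).  It exists for every commutative
    affine group and is visibly natural, so the splitting of T is not involved.

    The section s is where L enters ([torsor_section]).  Over L the torus is a
    product of multiplicative groups.  For a character chi, the function
    chi(g g'^-1) on G x_F G is a finite sum of products x(g) y(g') with x of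
    weight chi and y of weight chi^-1, the weight components being coefficients
    of Laurent polynomials.  On the diagonal this reads 1 = sum x y, where every
    product x y lies in B; since B is artinian, Fitting idempotents glue the x's
    into one invertible function of weight chi ([unit_of_weight]).  The r units
    so obtained give a T-equivariant map G -> T over L, hence s.

    Finally, over L the group H is {(b, t) : t^m = w(b)} with w = phi(s)^-1.
    So the inclusion of k[H] in k[H] ⊗ L factors through the algebra
    D = B[t_1, ..., t_r] / (t_j^m - w_j), and a linear form on L with 1 |-> 1
    makes k[H] a direct summand of the finite free k[F]-module D
    ([kernel_finite_flat]): k[H] is finite over k and faithfully flat over
    k[F].

    Tensor products, tensor powers, Laurent polynomials, the algebras D and the
    coordinate rings of closed subgroups are all instances of one construction,
    [presented]. *)

(** * Algebra homomorphisms *)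

Section MkLR.
Variables (k : nzRingType) (A R : algType k) (f : A -> R).
Hypotheses (fD : forall x y, f (x + y) = f x + f y).
Hypotheses (fM : forall x y, f (x * y) = f x * f y) (f1 : f 1 = 1).
Hypothesis (fZ : forall c x, f (c *: x) = c *: f x).

Let fB : zmod_morphism f.
Proof.
have f0 : f 0 = 0 by apply: (addrI (f 0)); rewrite -fD !addr0.
move=> x y; rewrite fD; congr (_ + _).
by apply/eqP; rewrite -addr_eq0 -fD addNr f0.
Qed.
Let fMM : monoid_morphism f := (f1, fM).
Let fZZ : scalable f := fZ.

(** Opaque on purpose: a transparent body would let conversion unfold every
    homomorphism built below. *)
Fact mk_lrmorphism_key : {g : {lrmorphism A -> R} | g =1 f}.
Proof.
by exists (HB.pack f (GRing.isZmodMorphism.Build _ _ f fB)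
    (GRing.isMonoidMorphism.Build _ _ f fMM)
    (GRing.isScalable.Build _ _ _ _ f fZZ) : {lrmorphism A -> R}).
Qed.

Definition mk_lrmorphism : {lrmorphism A -> R} := sval mk_lrmorphism_key.

Lemma mk_lrmorphismE x : mk_lrmorphism x = f x.
Proof. exact: (svalP mk_lrmorphism_key). Qed.
End MkLR.

Lemma lr_congr (k : nzRingType) (A R : algType k) (f g : {lrmorphism A -> R}) :
  f = g -> f =1 g.
Proof. by move->. Qed.

Section LRTheory.
Variables (k : nzRingType) (A R : algType k) (f : {lrmorphism A -> R}).
Lemma lrD x y : f (x + y) = f x + f y. Proof. exact: rmorphD. Qed.
Lemma lrM x y : f (x * y) = f x * f y. Proof. exact: rmorphM. Qed.
Lemma lrZ c x : f (c *: x) = c *: f x. Proof. exact: linearZ. Qed.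
Lemma lr0 : f 0 = 0. Proof. exact: rmorph0. Qed.
Lemma lr1 : f 1 = 1. Proof. exact: rmorph1. Qed.
Lemma lrP c x y : f (c *: x + y) = c *: f x + f y.
Proof. by rewrite lrD lrZ. Qed.
Lemma lr_sum (I : Type) (r : seq I) (Q : pred I) (E : I -> A) :
  f (\sum_(i <- r | Q i) E i) = \sum_(i <- r | Q i) f (E i).
Proof. exact: rmorph_sum. Qed.
End LRTheory.

Lemma lrmorphism_ext (k : nzRingType) (A R : algType k)
  (f g : {lrmorphism A -> R}) : f =1 g -> f = g.
Proof.
move=> /funext; case: f => f [[?] [?] [?]]; case: g => g [[?] [?] [?]] /= fg.
subst g; congr (GRing.LRMorphism.Pack (GRing.LRMorphism.Class _ _ _)).
all: by congr (_ _); apply: Prop_irrelevance.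
Qed.

(** * Algebras presented by generators and functionals *)

(** A presentation replaces relations by the functionals that respect them: the
    algebra is that of formal k-combinations of elements of the commutative
    monoid [gen], two of them being equal when all admissible functions,
    extended linearly, take the same value on both.  The universal property
    then holds by definition, and so do the ring axioms, since [admM] makes
    admissibility stable under translation. *)
Record presentation (k : fieldType) := Presentation {
  gen : Type;
  gmul : gen -> gen -> gen;
  gone : gen;
  gmulA : associative gmul;
  gmulC : commutative gmul;
  gmul1 : left_id gone gmul;
  adm : forall P : lmodType k, (gen -> P) -> Prop;
  admM : forall (P : lmodType k) (D : gen -> P) x,
    adm D -> adm (fun y => D (gmul x y));
  adm_nz : exists (P : lmodType k) (D : gen -> P), adm D /\ D gone <> 0
}.

Section PresentedAlgebra.
Local Open Scope quotient_scope.
Local Notation repr := generic_quotient.repr.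
Variables (k : fieldType) (p : presentation k).
Local Notation X := (gen p).
Implicit Types (P : lmodType k).

Definition fsum := seq (k * {classic X}).

Definition fev P (D : X -> P) (t : fsum) : P := \sum_(a <- t) a.1 *: D a.2.

(** Quantifying over all modules P makes every admissible map to a module
    extend to the quotient. *)
Definition feq (t u : fsum) : bool :=
  `[< forall P (D : X -> P), adm D -> fev D t = fev D u >].

Lemma feqP t u :
  reflect (forall P (D : X -> P), adm D -> fev D t = fev D u) (feq t u).
Proof. exact: asboolP. Qed.

Lemma feq_refl : reflexive feq.
Proof. by move=> t; apply/feqP. Qed.
Lemma feq_sym : symmetric feq.
Proof. by move=> t u; apply/feqP/feqP => tu P D aD; rewrite tu. Qed.
Lemma feq_trans : transitive feq.
Proof.
by move=> u t v /feqP tu /feqP uv; apply/feqP => P D aD; rewrite tu // uv.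
Qed.
Canonical feq_equiv := EquivRel feq feq_refl feq_sym feq_trans.

Definition presented := {eq_quot feq_equiv}.
HB.instance Definition _ := Choice.on presented.

Definition pcl (t : fsum) : presented := \pi_presented t.

Lemma pclP t u : (forall P (D : X -> P), adm D -> fev D t = fev D u) ->
  pcl t = pcl u.
Proof. by move=> tu; apply/eqmodP/feqP. Qed.

Lemma pclI P (D : X -> P) t u : adm D -> pcl t = pcl u -> fev D t = fev D u.
Proof. by move=> aD /eqmodP /feqP; apply. Qed.

Lemma pclW (x : presented) : exists t, x = pcl t.
Proof. by exists (repr x); rewrite /pcl reprK. Qed.

Definition pev P (D : X -> P) (x : presented) : P := fev D (repr x).

Lemma pevE P (D : X -> P) t : adm D -> pev D (pcl t) = fev D t.
Proof. by move=> aD; apply: pclI => //; rewrite /pcl reprK. Qed.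

Lemma fev_nil P (D : X -> P) : fev D [::] = 0.
Proof. exact: big_nil. Qed.
Lemma fev_cat P (D : X -> P) t u : fev D (t ++ u) = fev D t + fev D u.
Proof. exact: big_cat. Qed.
Definition fscale c (t : fsum) : fsum := [seq (c * a.1, a.2) | a <- t].
Lemma fev_scale P (D : X -> P) c t : fev D (fscale c t) = c *: fev D t.
Proof.
by rewrite /fev big_map scaler_sumr; apply: eq_bigr => a _; rewrite scalerA.
Qed.
Definition fmul (t u : fsum) : fsum :=
  flatten [seq [seq (a.1 * b.1, gmul a.2 b.2 : {classic X}) | b <- u] | a <- t].
Lemma fev_mul P (D : X -> P) t u :
  fev D (fmul t u) = fev (fun x => fev (fun y => D (gmul x y)) u) t.
Proof.
rewrite /fev big_flatten big_map; apply: eq_bigr => a _.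
by rewrite big_map scaler_sumr; apply: eq_bigr => b _; rewrite scalerA.
Qed.
(** A double evaluation can be carried out in either order, so that the product
    is well defined in each variable separately. *)
Lemma fev_swap P (D : X -> X -> P) t u :
  fev (fun x => fev (D x) u) t = fev (fun y => fev (D^~ y) t) u.
Proof.
rewrite /fev; under eq_bigr do rewrite scaler_sumr.
rewrite exchange_big; apply: eq_bigr => b _; rewrite scaler_sumr.
by apply: eq_bigr => a _; rewrite !scalerA mulrC.
Qed.
Lemma eq_fev P (D E : X -> P) t : D =1 E -> fev D t = fev E t.
Proof. by move=> DE; apply: eq_bigr => a _; rewrite DE. Qed.
Lemma fev_one P (D : X -> P) x : fev D [:: (1, x : {classic X})] = D x.
Proof. by rewrite /fev big_seq1 scale1r. Qed.

Lemma pcl_catE t u t' u' :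
  pcl t = pcl t' -> pcl u = pcl u' -> pcl (t ++ u) = pcl (t' ++ u').
Proof.
move=> tt' uu'; apply: pclP => P D aD.
by rewrite !fev_cat (pclI aD tt') (pclI aD uu').
Qed.
Lemma pcl_scaleE c t t' : pcl t = pcl t' -> pcl (fscale c t) = pcl (fscale c t').
Proof. by move=> tt'; apply: pclP => P D aD; rewrite !fev_scale (pclI aD tt'). Qed.
Lemma pcl_mulE t u t' u' :
  pcl t = pcl t' -> pcl u = pcl u' -> pcl (fmul t u) = pcl (fmul t' u').
Proof.
move=> tt' uu'; apply: pclP => P D aD; rewrite !fev_mul.
transitivity (fev (fun x => fev (fun y => D (gmul x y)) u') t).
  by apply: eq_fev => x; apply: pclI uu'; apply: admM.
rewrite fev_swap [RHS]fev_swap; apply: eq_fev => y; apply: pclI tt'.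
under eq_fun do rewrite gmulC.
exact: admM.
Qed.

Definition padd (x y : presented) := pcl (repr x ++ repr y).
Definition pscale c (x : presented) := pcl (fscale c (repr x)).
Definition pmul (x y : presented) := pcl (fmul (repr x) (repr y)).
Definition pzero := pcl [::].
Definition popp x := pscale (-1) x.
Definition pone := pcl [:: (1, gone p : {classic X})].

Lemma pcl_repr x : pcl (repr x) = x. Proof. by rewrite /pcl reprK. Qed.
Lemma paddE t u : padd (pcl t) (pcl u) = pcl (t ++ u).
Proof. by apply: pcl_catE; rewrite pcl_repr. Qed.
Lemma pscaleE c t : pscale c (pcl t) = pcl (fscale c t).
Proof. by apply: pcl_scaleE; rewrite pcl_repr. Qed.
Lemma pmulE t u : pmul (pcl t) (pcl u) = pcl (fmul t u).
Proof. by apply: pcl_mulE; rewrite pcl_repr. Qed.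

Fact paddA : associative padd.
Proof.
move=> x y z; have [[t ->] [u ->] [v ->]] := And3 (pclW x) (pclW y) (pclW z).
by rewrite !paddE catA.
Qed.
Fact paddC : commutative padd.
Proof.
move=> x y; have [[t ->] [u ->]] := conj (pclW x) (pclW y).
by rewrite !paddE; apply: pclP => P D aD; rewrite !fev_cat addrC.
Qed.
Fact padd0 : left_id pzero padd.
Proof. by move=> x; have [t ->] := pclW x; rewrite paddE. Qed.
Fact paddN : left_inverse pzero popp padd.
Proof.
move=> x; have [t ->] := pclW x; rewrite /popp pscaleE paddE.
by apply: pclP => P D aD; rewrite fev_cat fev_scale fev_nil scaleN1r addNr.
Qed.
HB.instance Definition _ :=
  GRing.isZmodule.Build presented paddA paddC padd0 paddN.

Fact pmulA : associative pmul.
Proof.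
move=> x y z; have [[t ->] [u ->] [v ->]] := And3 (pclW x) (pclW y) (pclW z).
rewrite !pmulE; apply: pclP => P D aD; rewrite !fev_mul.
by apply: eq_fev => a; rewrite fev_mul; do 2!apply: eq_fev => ?; rewrite gmulA.
Qed.
Fact pmulC : commutative pmul.
Proof.
move=> x y; have [[t ->] [u ->]] := conj (pclW x) (pclW y).
rewrite !pmulE; apply: pclP => P D aD; rewrite !fev_mul fev_swap.
by do 2!apply: eq_fev => ?; rewrite gmulC.
Qed.
Fact pmul1 : left_id pone pmul.
Proof.
move=> x; have [t ->] := pclW x; rewrite pmulE; apply: pclP => P D aD.
by rewrite fev_mul fev_one; apply: eq_fev => a; rewrite gmul1.
Qed.
Fact pmulDl : left_distributive pmul padd.
Proof.
move=> x y z; have [[t ->] [u ->] [v ->]] := And3 (pclW x) (pclW y) (pclW z).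
by rewrite (paddE t u) !pmulE paddE /fmul map_cat flatten_cat.
Qed.
Fact pone_neq0 : pone != 0 :> presented.
Proof.
have [P [D [aD nz]]] := adm_nz p; apply/eqP => e; apply: nz.
by rewrite -(fev_one D) (pclI aD (e : pcl _ = pcl _)) fev_nil.
Qed.
HB.instance Definition _ :=
  GRing.Zmodule_isComNzRing.Build presented pmulA pmulC pmul1 pmulDl pone_neq0.

Fact pscaleA a b x : pscale a (pscale b x) = pscale (a * b) x.
Proof.
have [t ->] := pclW x; rewrite !pscaleE; apply: pclP => P D aD.
by rewrite !fev_scale scalerA.
Qed.
Fact pscale1 : left_id 1 pscale.
Proof.
move=> x; have [t ->] := pclW x; rewrite !pscaleE; apply: pclP => P D aD.
by rewrite !fev_scale scale1r.
Qed.
Fact pscaleDr : right_distributive pscale +%R.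
Proof.
move=> a x y; have [[t ->] [u ->]] := conj (pclW x) (pclW y).
rewrite [_ + _]paddE !pscaleE [RHS]paddE; apply: pclP => P D aD.
by rewrite !(fev_scale, fev_cat) scalerDr.
Qed.
Fact pscaleDl x : {morph pscale^~ x : a b / a + b}.
Proof.
move=> a b; have [t ->] := pclW x.
rewrite !pscaleE [RHS]paddE; apply: pclP => P D aD.
by rewrite !(fev_scale, fev_cat) scalerDl.
Qed.
HB.instance Definition _ := GRing.Zmodule_isLmodule.Build k presented
  pscaleA pscale1 pscaleDr pscaleDl.

Fact pscaleAl (a : k) (x y : presented) : a *: (x * y) = (a *: x) * y.
Proof.
have [[t ->] [u ->]] := conj (pclW x) (pclW y).
rewrite [_ * _]pmulE [_ *: _]pscaleE [_ *: _]pscaleE [RHS]pmulE.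
by apply: pclP => P D aD; rewrite !(fev_scale, fev_mul).
Qed.
HB.instance Definition _ := GRing.Lmodule_isLalgebra.Build k presented pscaleAl.
HB.instance Definition _ := GRing.Lalgebra_isComAlgebra.Build k presented.

Definition pgen (x : X) : presented := pcl [:: (1, x : {classic X})].

Lemma pgenM x y : pgen (gmul x y) = pgen x * pgen y.
Proof.
rewrite [RHS]pmulE; apply: pclP => P D aD.
by rewrite fev_mul !fev_one.
Qed.
Lemma pgen1 : pgen (gone p) = 1. Proof. by []. Qed.

Lemma pgen_eq x y : (forall P (D : X -> P), adm D -> D x = D y) ->
  pgen x = pgen y.
Proof. by move=> xy; apply: pclP => P D aD; rewrite !fev_one xy. Qed.

Lemma pgen_lin c x y z :
  (forall P (D : X -> P), adm D -> D z = c *: D x + D y) ->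
  pgen z = c *: pgen x + pgen y.
Proof.
move=> xyz; rewrite [_ *: _]pscaleE [RHS]paddE; apply: pclP => P D aD.
by rewrite fev_cat fev_scale !fev_one xyz.
Qed.

Lemma pevD P (D : X -> P) x y : adm D -> pev D (x + y) = pev D x + pev D y.
Proof.
move=> aD; have [[t ->] [u ->]] := conj (pclW x) (pclW y).
by rewrite [_ + _]paddE !pevE // fev_cat.
Qed.
Lemma pevZ P (D : X -> P) c x : adm D -> pev D (c *: x) = c *: pev D x.
Proof.
move=> aD; have [t ->] := pclW x.
by rewrite [_ *: _]pscaleE !pevE // fev_scale.
Qed.
Lemma pev_gen P (D : X -> P) x : adm D -> pev D (pgen x) = D x.
Proof. by move=> aD; rewrite pevE // fev_one. Qed.

Lemma presented_ind (S : presented -> Prop) :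
  S 0 -> (forall c x z, S z -> S (c *: pgen x + z)) -> forall z, S z.
Proof.
move=> S0 SD z; have [t ->] := pclW z; elim: t => [//|[c x] t IH].
suff -> : pcl ((c, x) :: t) = c *: pgen x + pcl t by exact: SD.
rewrite [_ *: _]pscaleE [RHS]paddE; congr pcl.
by rewrite /= mulr1.
Qed.

Section Lift.
Variables (S : comAlgType k) (D : X -> S) (aD : adm D).
Hypotheses (DM : {morph D : x y / gmul x y >-> x * y}) (D1 : D (gone p) = 1).

Fact pev_mul x y : pev D (x * y) = pev D x * pev D y.
Proof.
have [[t ->] [u ->]] := conj (pclW x) (pclW y).
rewrite [_ * _]pmulE !pevE // fev_mul /fev mulr_suml; apply: eq_bigr => a _.
rewrite -scalerAl; congr (_ *: _); rewrite mulr_sumr; apply: eq_bigr => b _.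
by rewrite DM scalerAr.
Qed.

Definition plift : {lrmorphism presented -> S} :=
  mk_lrmorphism (fun x y => pevD x y aD) pev_mul
    (etrans (pev_gen (gone p) aD) D1) (fun c x => pevZ c x aD).

Lemma plift_gen x : plift (pgen x) = D x.
Proof. by rewrite mk_lrmorphismE; apply: pev_gen. Qed.
End Lift.

End PresentedAlgebra.

Lemma presented_lin_ext (k : fieldType) (p : presentation k) (P : lmodType k)
  (f g : presented p -> P) :
  (forall c x y, f (c *: x + y) = c *: f x + f y) ->
  (forall c x y, g (c *: x + y) = c *: g x + g y) ->
  (forall x, f (pgen x) = g (pgen x)) -> f =1 g.
Proof.
move=> fL gL fg.
have L0 (h : presented p -> P) :
    (forall c x y, h (c *: x + y) = c *: h x + h y) -> h 0 = 0.
  by move=> hL; have := hL (-1) 0 0; rewrite scaler0 addr0 scaleN1r addNr.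
by elim/presented_ind => [|c x z IH]; rewrite ?L0 // fL gL fg IH.
Qed.

(** * Points of affine groups *)

Notation reg := Defs.coord.

Notation "f ∘ x" := (alg_comp f x) (at level 36, right associativity).
Notation "x · y" := (pt_mul x y) (at level 37, left associativity).

Definition lr_id (k : fieldType) (R : comAlgType k) : {lrmorphism R -> R} :=
  idfun.

Section Points.
Variable k : fieldType.
Implicit Types (A R S U : comAlgType k).

Lemma alg_compE A R S (f : {lrmorphism R -> S}) (g : {lrmorphism A -> R}) a :
  (f ∘ g) a = f (g a).
Proof. by []. Qed.

Lemma alg_compA A R S U (f : {lrmorphism S -> U}) (g : {lrmorphism R -> S})
  (h : {lrmorphism A -> R}) : f ∘ g ∘ h = (f ∘ g) ∘ h.
Proof. exact: lrmorphism_ext. Qed.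

Lemma alg_comp1 A R (f : {lrmorphism A -> R}) : f ∘ lr_id A = f.
Proof. exact: lrmorphism_ext. Qed.

Lemma alg_comp_id A R (f : {lrmorphism A -> R}) : lr_id R ∘ f = f.
Proof. exact: lrmorphism_ext. Qed.

Section Group.
Variables (G : affine_group k) (R : comAlgType k).
Implicit Types x y z : points G R.

Lemma ptA x y z : x · (y · z) = x · y · z.
Proof. exact: pt_mulA. Qed.
Lemma pt1l x : pt_one G R · x = x.
Proof. exact: pt_mul1. Qed.
Lemma ptVl x : pt_inv x · x = pt_one G R.
Proof. exact: pt_mulV. Qed.
Lemma ptKl x y : pt_inv x · (x · y) = y.
Proof. by rewrite ptA ptVl pt1l. Qed.
Lemma ptVr x : x · pt_inv x = pt_one G R.
Proof. by rewrite -(ptKl (pt_inv x) (x · pt_inv x)) (ptKl x) ptVl. Qed.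
Lemma pt1r x : x · pt_one G R = x.
Proof. by rewrite -(ptVl x) ptA ptVr pt1l. Qed.
Lemma ptKr x y : x · y · pt_inv y = x.
Proof. by rewrite -ptA ptVr pt1r. Qed.
Lemma ptKVr x y : x · pt_inv y · y = x.
Proof. by rewrite -ptA ptVl pt1r. Qed.
Lemma pt_cancell x y z : x · y = x · z -> y = z.
Proof. by move=> e; rewrite -(ptKl x y) e ptKl. Qed.
Lemma pt_invK x : pt_inv (pt_inv x) = x.
Proof. by apply: (@pt_cancell (pt_inv x)); rewrite ptVr ptVl. Qed.
Lemma pt_invM x y : pt_inv (x · y) = pt_inv y · pt_inv x.
Proof. by apply: (@pt_cancell (x · y)); rewrite ptVr ptA ptKr ptVr. Qed.
Lemma pt_inv1 : pt_inv (pt_one G R) = pt_one G R.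
Proof. by rewrite -[LHS]pt1r ptVl. Qed.
Lemma pt_idem x : x · x = x -> x = pt_one G R.
Proof. by move=> e; apply: (@pt_cancell x); rewrite e pt1r. Qed.
End Group.

Lemma compM (G : affine_group k) R S (f : {lrmorphism R -> S})
  (x y : points G R) : f ∘ (x · y) = (f ∘ x) · (f ∘ y).
Proof. exact: pt_mul_nat. Qed.
Lemma comp1 (G : affine_group k) R S (f : {lrmorphism R -> S}) :
  f ∘ pt_one G R = pt_one G S.
Proof. by apply: pt_idem; rewrite -compM pt1l. Qed.
Lemma compV (G : affine_group k) R S (f : {lrmorphism R -> S})
  (x : points G R) : f ∘ pt_inv x = pt_inv (f ∘ x).
Proof.
by apply: (@pt_cancell _ _ (f ∘ x)); rewrite -compM !ptVr comp1.
Qed.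

Lemma on_pointsM (G H : affine_group k) (f : group_hom G H) R (x y : points G R) :
  on_points f (x · y) = on_points f x · on_points f y.
Proof. exact: comorphismM. Qed.
Lemma on_points1 (G H : affine_group k) (f : group_hom G H) R :
  on_points f (pt_one G R) = pt_one H R.
Proof. by apply: pt_idem; rewrite -on_pointsM pt1l. Qed.
Lemma on_pointsV (G H : affine_group k) (f : group_hom G H) R (x : points G R) :
  on_points f (pt_inv x) = pt_inv (on_points f x).
Proof.
by apply: (@pt_cancell _ _ (on_points f x)); rewrite -on_pointsM !ptVr on_points1.
Qed.
Lemma on_points_comp (G H : affine_group k) (f : group_hom G H) R S
  (h : {lrmorphism R -> S}) (x : points G R) :
  on_points f (h ∘ x : points G S) = h ∘ on_points f x.
Proof. by rewrite /on_points alg_compA. Qed.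

(** A surjective comorphism is an epimorphism of algebras. *)
Lemma closed_subgroup_inj (G H : affine_group k) (f : group_hom H G) R :
  closed_subgroup f -> injective (on_points f (R := R)).
Proof.
move=> cf x y exy; apply: lrmorphism_ext => a; have [b <-] := cf a.
by rewrite -[LHS]/(on_points f x b) exy.
Qed.

Lemma comp_inj A R S (f : {lrmorphism R -> S}) (x y : {lrmorphism A -> R}) :
  injective f -> f ∘ x = f ∘ y -> x = y.
Proof.
move=> fI e; apply: lrmorphism_ext => a; apply: fI.
by rewrite -[LHS]/((f ∘ x) a) e.
Qed.

End Points.

(** * Tensor products *)

(** The tensor product of R and S over the relations alpha z ⊗ 1 = 1 ⊗ beta z.
    With Z a ring mapped to R and S this is the tensor product over Z; with Z
    empty it is the tensor product over k.  That 1 <> 0 must be supplied, as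
    zero algebras are excluded. *)
Section Tensor.
Variables (k : fieldType) (R S : comAlgType k) (Z : Type).
Variables (alpha : Z -> R) (beta : Z -> S).

Definition tens_adm (P : lmodType k) (D : R * S -> P) : Prop :=
  [/\ forall c x x' y, D (c *: x + x', y) = c *: D (x, y) + D (x', y),
      forall c x y y', D (x, c *: y + y') = c *: D (x, y) + D (x, y')
    & forall z x y, D (alpha z * x, y) = D (x, beta z * y)].

Definition tmul (a b : R * S) : R * S := (a.1 * b.1, a.2 * b.2).

Fact tmulA : associative tmul.
Proof. by move=> [a b] [c d] [e f]; rewrite /tmul /= !mulrA. Qed.
Fact tmulC : commutative tmul.
Proof. by move=> [a b] [c d]; rewrite /tmul /= mulrC [b * _]mulrC. Qed.
Fact tmul1 : left_id (1, 1) tmul.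
Proof. by move=> [a b]; rewrite /tmul /= !mul1r. Qed.
Fact tens_admM (P : lmodType k) (D : R * S -> P) x :
  tens_adm D -> tens_adm (fun y => D (tmul x y)).
Proof.
case: x => x y [D1 D2 D3]; split=> [c a a' b | c a b b' | z a b] /=.
- by rewrite /tmul /= mulrDr -scalerAr D1.
- by rewrite /tmul /= mulrDr -scalerAr D2.
- by rewrite /tmul /= mulrCA D3 mulrCA.
Qed.

Hypothesis nz : exists (P : lmodType k) (D : R * S -> P),
  tens_adm D /\ D (1, 1) <> 0.

Definition tens_pres := Presentation tmulA tmulC tmul1 tens_admM nz.
Definition tens : comAlgType k := presented tens_pres.

Definition tpure (x : R) (y : S) : tens := pgen (p := tens_pres) (x, y).

Lemma tpure_adm : tens_adm (fun a => tpure a.1 a.2).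
Proof.
split=> [c x x' y | c x y y' | z x y] /=.
- by apply: pgen_lin => P D [].
- by apply: pgen_lin => P D [].
- by apply: pgen_eq => P D [].
Qed.

Lemma tpureM x y x' y' : tpure x y * tpure x' y' = tpure (x * x') (y * y').
Proof. by rewrite /tpure -pgenM. Qed.

Fact inl_addZ c x x' : tpure (c *: x + x') 1 = c *: tpure x 1 + tpure x' 1.
Proof. by case: tpure_adm => /= H _ _; rewrite H. Qed.
Fact inr_addZ c y y' : tpure 1 (c *: y + y') = c *: tpure 1 y + tpure 1 y'.
Proof. by case: tpure_adm => /= _ H _; rewrite H. Qed.

Fact tpure0l y : tpure 0 y = 0.
Proof.
case: tpure_adm => /= H _ _; have := H (-1) 0 0 y.
by rewrite scaler0 addr0 scaleN1r addNr.
Qed.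
Fact tpure0r x : tpure x 0 = 0.
Proof.
case: tpure_adm => /= _ H _; have := H (-1) x 0 0.
by rewrite scaler0 addr0 scaleN1r addNr.
Qed.

Definition tl : {lrmorphism R -> tens}.
Proof.
apply: (@mk_lrmorphism _ R tens (fun x => tpure x 1)) => [x y|x y||c x].
- by rewrite -[x in LHS]scale1r inl_addZ scale1r.
- by rewrite tpureM mulr1.
- by [].
- by rewrite -[c *: x]addr0 inl_addZ tpure0l addr0.
Defined.

Definition tr : {lrmorphism S -> tens}.
Proof.
apply: (@mk_lrmorphism _ S tens (fun x => tpure 1 x)) => [x y|x y||c x].
- by rewrite -[x in LHS]scale1r inr_addZ scale1r.
- by rewrite tpureM mulr1.
- by [].
- by rewrite -[c *: x]addr0 inr_addZ tpure0r addr0.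
Defined.

Lemma tlE x : tl x = tpure x 1. Proof. exact: mk_lrmorphismE. Qed.
Lemma trE x : tr x = tpure 1 x. Proof. exact: mk_lrmorphismE. Qed.
Lemma tpureE x y : tpure x y = tl x * tr y.
Proof. by rewrite tlE trE tpureM mulr1 mul1r. Qed.

Lemma tlr z : tl (alpha z) = tr (beta z).
Proof.
rewrite tlE trE; case: tpure_adm => _ _ /(_ z 1 1) /=.
by rewrite !mulr1.
Qed.

Lemma tens_ind (Q : tens -> Prop) :
  Q 0 -> (forall x y z, Q z -> Q (tl x * tr y + z)) -> forall z, Q z.
Proof.
move=> Q0 QD; apply: presented_ind => // c [x y] z Qz.
rewrite -[pgen _]/(tpure x y) tpureE scalerAl -linearZ; exact: QD.
Qed.

Section BilinLift.
Variables (P : lmodType k) (D : R * S -> P) (aD : tens_adm D).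

Definition tbilin : tens -> P := pev (p := tens_pres) D.

Lemma tbilinP c x y : tbilin (c *: x + y) = c *: tbilin x + tbilin y.
Proof. by rewrite /tbilin pevD // pevZ. Qed.
Lemma tbilinE x y : tbilin (tl x * tr y) = D (x, y).
Proof. by rewrite -tpureE /tbilin pev_gen. Qed.
End BilinLift.

Section TLift.
Variables (U : comAlgType k) (f : {lrmorphism R -> U}) (g : {lrmorphism S -> U}).
Hypothesis fg : forall z, f (alpha z) = g (beta z).

Let D (a : R * S) : U := f a.1 * g a.2.
Fact tlift_adm : tens_adm D.
Proof.
split=> [c x x' y | c x y y' | z x y] /=; rewrite /D /=.
- by rewrite linearP mulrDl scalerAl.
- by rewrite linearP mulrDr scalerAr.
- by rewrite !rmorphM /= fg -mulrA mulrCA mulrA.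
Qed.
Fact tliftM : {morph D : x y / tmul x y >-> x * y}.
Proof. by move=> [a b] [c d]; rewrite /D /= !rmorphM mulrACA. Qed.
Fact tlift1 : D (1, 1) = 1.
Proof. by rewrite /D /= !rmorph1 mulr1. Qed.

Definition tlift : {lrmorphism tens -> U} :=
  plift (p := tens_pres) tlift_adm tliftM tlift1.

Lemma tliftE x y : tlift (tl x * tr y) = f x * g y.
Proof. by rewrite -tpureE /tlift plift_gen. Qed.
Lemma tlift_l : tlift ∘ tl = f.
Proof.
apply: lrmorphism_ext => x; rewrite alg_compE.
by rewrite -[tl x]mulr1 -[1](rmorph1 tr) tliftE rmorph1 mulr1.
Qed.
Lemma tlift_r : tlift ∘ tr = g.
Proof.
apply: lrmorphism_ext => x; rewrite alg_compE.
by rewrite -[tr x]mul1r -[1](rmorph1 tl) tliftE rmorph1 mul1r.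
Qed.
End TLift.

Lemma tens_ext (U : comAlgType k) (f g : {lrmorphism tens -> U}) :
  f ∘ tl = g ∘ tl -> f ∘ tr = g ∘ tr -> f = g.
Proof.
move=> fgl fgr; apply: lrmorphism_ext; apply: tens_ind => [|x y z IH].
  by rewrite !rmorph0.
rewrite !rmorphD !rmorphM /= IH; congr (_ * _ + _).
  by rewrite -[LHS]/((f ∘ tl) x) fgl.
by rewrite -[LHS]/((f ∘ tr) y) fgr.
Qed.

End Tensor.

(** * Finite-dimensional algebras *)

(** A basis given with its coordinate forms, indexed by ordinals. *)
Record kbasis (k : fieldType) (B : comAlgType k) (m : nat) := KBasis {
  kb : 'I_m -> B;
  kc : 'I_m -> B -> k;
  kcP : forall i c x y, kc i (c *: x + y) = c * kc i x + kc i y;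
  kb_span : forall x, x = \sum_i kc i x *: kb i;
  kb_dual : forall i j, kc i (kb j) = (i == j)%:R
}.

Section KBasis.
Variables (k : fieldType) (B : comAlgType k) (m : nat) (e : kbasis B m).

Lemma kc0 i : kc e i 0 = 0.
Proof. by have := kcP e i (-1) 0 0; rewrite scaler0 addr0 mulN1r addNr. Qed.
Lemma kcD i x y : kc e i (x + y) = kc e i x + kc e i y.
Proof. by rewrite -[x in LHS]scale1r kcP mul1r. Qed.
Lemma kcZ i c x : kc e i (c *: x) = c * kc e i x.
Proof. by rewrite -[_ *: _]addr0 kcP kc0 addr0. Qed.

Lemma kc_sum i (J : Type) (r : seq J) (Q : pred J) (E : J -> B) :
  kc e i (\sum_(j <- r | Q j) E j) = \sum_(j <- r | Q j) kc e i (E j).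
Proof. by apply: (big_morph (kc e i)) => [x y|]; rewrite ?kcD ?kc0. Qed.

Lemma kb_one : exists i, kc e i 1 != 0.
Proof.
apply/existsP; apply: contraT; rewrite negb_exists => /forallP h.
have := oner_neq0 B; rewrite [1](kb_span e) big1 ?eqxx // => i _.
by have /negPn /eqP -> := h i; rewrite scale0r.
Qed.

Lemma kb_dim_gt0 : (0 < m)%N.
Proof. by have [i _] := kb_one; apply: leq_ltn_trans (ltn_ord i). Qed.

(** Since 1 has a nonzero coordinate, some multiple of a coordinate form is a
    k-linear retraction of k -> B. *)
Definition kfun (x : B) : k :=
  let i := sval (cid kb_one) in (kc e i 1)^-1 * kc e i x.

Lemma kfunP c x y : kfun (c *: x + y) = c * kfun x + kfun y.
Proof. by rewrite /kfun kcP mulrDr mulrCA. Qed.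
Lemma kfun1 : kfun 1 = 1.
Proof. by rewrite /kfun mulVf //; case: cid. Qed.

Variable R : comAlgType k.

Fact no_rel_adm (D : R * B -> R) :
  (forall c x x' y, D (c *: x + x', y) = c *: D (x, y) + D (x', y)) ->
  (forall c x y y', D (x, c *: y + y') = c *: D (x, y) + D (x, y')) ->
  tens_adm (of_void R) (of_void B) D.
Proof. by move=> D1 D2; split=> // -[]. Qed.

Fact tcoord_adm (h : B -> k) :
  (forall c x y, h (c *: x + y) = c * h x + h y) ->
  tens_adm (of_void R) (of_void B) (fun a => h a.2 *: a.1 : R).
Proof.
move=> hP; apply: no_rel_adm => [c x x' y | c x y y'] /=.
  by rewrite scalerDr !scalerA mulrC.
by rewrite hP scalerDl scalerA.
Qed.

Fact tensk_nz : exists (P : lmodType k) (D : R * B -> P),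
  tens_adm (of_void R) (of_void B) D /\ D (1, 1) <> 0.
Proof.
exists R, (fun a => kfun a.2 *: a.1); split; first exact: tcoord_adm kfunP.
by rewrite /= kfun1 scale1r; apply/eqP/oner_neq0.
Qed.

Definition tensk : comAlgType k := tens tensk_nz.
Definition tkl : {lrmorphism R -> tensk} := tl tensk_nz.
Definition tkr : {lrmorphism B -> tensk} := tr tensk_nz.

Lemma tensk_ind (Q : tensk -> Prop) :
  Q 0 -> (forall x y z, Q z -> Q (tkl x * tkr y + z)) -> forall z, Q z.
Proof. exact: tens_ind. Qed.

Lemma tensk_ext (U : comAlgType k) (f g : {lrmorphism tensk -> U}) :
  f ∘ tkl = g ∘ tkl -> f ∘ tkr = g ∘ tkr -> f = g.
Proof. exact: tens_ext. Qed.

Section Coord.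
Variables (h : B -> k).
Hypothesis hP : forall c x y, h (c *: x + y) = c * h x + h y.

(** The R-linear extension of a linear form on B; with the coordinate forms it
    shows that R ⊗ B is free over R, with [kfun] that R is a direct summand. *)
Definition tcoord : tensk -> R :=
  tbilin (nz := tensk_nz) (fun a => h a.2 *: a.1).

Lemma tcoordP c x y : tcoord (c *: x + y) = c *: tcoord x + tcoord y.
Proof. exact/tbilinP/tcoord_adm. Qed.
Lemma tcoordE x y : tcoord (tkl x * tkr y) = h y *: x.
Proof. exact/tbilinE/tcoord_adm. Qed.
Lemma tcoordD x y : tcoord (x + y) = tcoord x + tcoord y.
Proof. by rewrite -[x in LHS]scale1r tcoordP scale1r. Qed.
Lemma tcoord0 : tcoord 0 = 0.
Proof. by have := tcoordP (-1) 0 0; rewrite scaler0 addr0 scaleN1r addNr. Qed.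
Lemma tcoord_l x : tcoord (tkl x) = h 1 *: x.
Proof. by rewrite -[tkl x]mulr1 -(rmorph1 tkr) tcoordE. Qed.
Lemma tcoord_r y : tcoord (tkr y) = h y *: 1.
Proof. by rewrite -[tkr y]mul1r -(rmorph1 tkl) tcoordE. Qed.
Lemma tcoordM x z : tcoord (tkl x * z) = x * tcoord z.
Proof.
elim/tensk_ind: z => [|a b z IH]; first by rewrite mulr0 tcoord0 mulr0.
rewrite mulrDr mulrA -rmorphM !tcoordD IH /= !tcoordE mulrDr.
by rewrite -scalerAr.
Qed.
End Coord.

Lemma tkl_inj : injective tkl.
Proof.
move=> x y /(congr1 (tcoord kfun)).
by rewrite !tcoord_l ?kfun1 ?scale1r //; apply: kfunP.
Qed.

Definition tkc i : tensk -> R := tcoord (kc e i).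

Lemma tkc_span z : z = \sum_i tkl (tkc i z) * tkr (kb e i).
Proof.
elim/tensk_ind: z => [|x y z IH].
  by rewrite big1 // => i _; rewrite /tkc tcoord0 ?rmorph0 ?mul0r //; apply: kcP.
under eq_bigr => i _ do
  rewrite /tkc (tcoordD (kcP e i)) rmorphD mulrDl (tcoordE (kcP e i)).
rewrite big_split /= -IH; congr (_ + _).
rewrite {1}(kb_span e y). rewrite lr_sum mulr_sumr; apply: eq_bigr => i _.
by rewrite !lrZ -scalerAl scalerAr.
Qed.

End KBasis.
Arguments tkc {k B m} e {R} i z.
Arguments tkc_span {k B m} e {R} z.
Arguments tkl_inj {k B m} e {R} [x1 x2].
Arguments tcoord {k B m e R} h z.
Arguments tcoordP {k B m e R h} hP c x y.
Arguments tcoordE {k B m e R h} hP x y.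
Arguments tcoordD {k B m e R h} hP x y.
Arguments tcoord0 {k B m e R h} hP.
Arguments tcoord_l {k B m e R h} hP x.
Arguments tcoord_r {k B m e R h} hP y.
Arguments tcoordM {k B m e R h} hP x z.

Section BaseChange.
Variables (k : fieldType) (B : comAlgType k) (m : nat) (e : kbasis B m).
Implicit Types (R S U : comAlgType k).

Definition tklift R U (f : {lrmorphism R -> U}) (g : {lrmorphism B -> U}) :
  {lrmorphism tensk e R -> U} :=
  @tlift _ _ _ _ (of_void R) (of_void B) (tensk_nz e R) U f g
    (fun z => match z with end).

Lemma tklift_l R U (f : {lrmorphism R -> U}) (g : {lrmorphism B -> U}) :
  tklift f g ∘ tkl e R = f.
Proof. exact: tlift_l. Qed.
Lemma tklift_r R U (f : {lrmorphism R -> U}) (g : {lrmorphism B -> U}) :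
  tklift f g ∘ tkr e R = g.
Proof. exact: tlift_r. Qed.
Lemma tklift_lE R U (f : {lrmorphism R -> U}) (g : {lrmorphism B -> U}) x :
  tklift f g (tkl e R x) = f x.
Proof. exact: (lr_congr (tklift_l f g)). Qed.
Lemma tklift_rE R U (f : {lrmorphism R -> U}) (g : {lrmorphism B -> U}) x :
  tklift f g (tkr e R x) = g x.
Proof. exact: (lr_congr (tklift_r f g)). Qed.

Definition tkmap R S (h : {lrmorphism R -> S}) :
  {lrmorphism tensk e R -> tensk e S} := tklift (tkl e S ∘ h) (tkr e S).

Lemma tkmap_l R S (h : {lrmorphism R -> S}) : tkmap h ∘ tkl e R = tkl e S ∘ h.
Proof. exact: tklift_l. Qed.
Lemma tkmap_r R S (h : {lrmorphism R -> S}) : tkmap h ∘ tkr e R = tkr e S.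
Proof. exact: tklift_r. Qed.

Lemma tkc_map R S (h : {lrmorphism R -> S}) i z :
  tkc e i (tkmap h z) = h (tkc e i z).
Proof.
rewrite /tkc; elim/tensk_ind: z => [|x y z IH].
  by rewrite rmorph0 !tcoord0 ?rmorph0 //; apply: kcP.
rewrite rmorphD !(tcoordD (kcP e i)) /= IH rmorphD /=; congr (_ + _).
by rewrite rmorphM /= tklift_lE tklift_rE !(tcoordE (kcP e i)) lrZ.
Qed.
End BaseChange.

Lemma kbasis_fin (k : fieldType) (B : comAlgType k) (J : finType) (m : nat)
  (b : J -> B) (c : J -> B -> k) : #|J| = m ->
  (forall i a x y, c i (a *: x + y) = a * c i x + c i y) ->
  (forall x, x = \sum_i c i x *: b i) ->
  (forall i j, c i (b j) = (i == j)%:R) -> inhabited (kbasis B m).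
Proof.
move=> <- cP bs bd; constructor.
exists (b \o enum_val) (fun i => c (enum_val i)) => [i|x|i j] /=.
- exact: cP.
- by rewrite [LHS]bs (reindex _ (onW_bij _ (@enum_val_bij J))).
- by rewrite bd (inj_eq enum_val_inj).
Qed.

Lemma has_order_kbasis (k : fieldType) (G : affine_group k) n :
  has_order G n -> inhabited (kbasis (reg G) n).
Proof.
move=> [e [g eg ge]]; constructor.
have gP c x y : g (c *: x + y) = c *: g x + g y.
  apply: (can_inj eg); rewrite ge -{1}[x]ge -{1}[y]ge.
  rewrite scaler_sumr -big_split; apply: eq_bigr => i _.
  by rewrite !mxE scalerDl scalerA.
exists e (fun i x => g x 0 i) => [i c x y|x|i j].
- by rewrite gP !mxE.
- by rewrite -{1}[x]ge.
- suff -> : g (e j) = delta_mx 0 j by rewrite mxE.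
  apply: (can_inj eg); rewrite ge (bigD1 j) //= mxE !eqxx scale1r big1 ?addr0 //.
  by move=> l /negPf lj; rewrite mxE lj andbF scale0r.
Qed.

Lemma fieldExt_kbasis (k : fieldType) (L : fieldExtType k) :
  inhabited (kbasis L (\dim {:L})).
Proof.
constructor; have bL := vbasisP {:L}.
exists (fun i => (vbasis {:L})`_i) (fun i x => coord (vbasis {:L}) i x).
- by move=> i c x y; rewrite linearP.
- by move=> x; apply: (coord_basis bL); apply: memvf.
- by move=> i j; rewrite coord_free ?(basis_free bL) // eq_sym.
Qed.

Lemma tensk_kbasis (k : fieldType) (A B : comAlgType k) n d
  (eA : kbasis A n) (eB : kbasis B d) : inhabited (kbasis (tensk eB A) (n * d)).
Proof.
apply: (@kbasis_fin _ _ ('I_n * 'I_d)%type _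
  (fun a => tkl eB A (kb eA a.1) * tkr eB A (kb eB a.2))
  (fun a z => kc eA a.1 (tkc eB a.2 z))).
- by rewrite card_prod !card_ord.
- by move=> i a x y; rewrite /tkc tcoordP ?kcP //; apply: kcP.
- move=> z; rewrite {1}(tkc_span eB z) -(pair_bigA _ (fun i j =>
    kc eA i (tkc eB j z) *: (tkl eB A (kb eA i) * tkr eB A (kb eB j)))) /=.
  rewrite exchange_big; apply: eq_bigr => j _.
  rewrite {1}(kb_span eA (tkc eB j z)) lr_sum mulr_suml.
  by apply: eq_bigr => i _; rewrite lrZ scalerAl.
- move=> [i j] [i' j']; rewrite /= /tkc (tcoordE (kcP eB j)) kcZ !kb_dual.
  by rewrite xpair_eqE; do 2!case: eqP => _; rewrite ?mulr0 ?mulr1.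
Qed.

(** * Faithfully flat descent *)

Definition restr_along (A S : comNzRingType) (psi : {rmorphism A -> S})
  (P : lmodType S) : Type := P.

Section Restriction.
Variables (A S : comNzRingType) (psi : {rmorphism A -> S}) (P : lmodType S).
Local Notation restr := (restr_along psi P).
HB.instance Definition _ := GRing.Zmodule.on restr.
Let rscale (a : A) (x : restr) : restr := psi a *: (x : P).
Fact rscaleA a b x : rscale a (rscale b x) = rscale (a * b) x.
Proof. by rewrite /rscale scalerA rmorphM. Qed.
Fact rscale1 : left_id 1 rscale.
Proof. by move=> x; rewrite /rscale rmorph1 scale1r. Qed.
Fact rscaleDr : right_distributive rscale +%R.
Proof. by move=> a x y; rewrite /rscale; apply: (@scalerDr S P). Qed.
Fact rscaleDl x : {morph rscale^~ x : a b / a + b}.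
Proof. by move=> a b; rewrite /rscale rmorphD; apply: (@scalerDl S P). Qed.
HB.instance Definition _ := GRing.Zmodule_isLmodule.Build A restr
  rscaleA rscale1 rscaleDr rscaleDl.
Lemma restrE (a : A) (x : restr) : a *: x = (psi a *: (x : P) : P).
Proof. by []. Qed.
End Restriction.

(** The quotient of a module by the submodule [U]. *)
Section QuotientModule.
Local Open Scope quotient_scope.
Local Notation repr := generic_quotient.repr.
Variables (A : comNzRingType) (M : lmodType A) (U : M -> Prop).
Hypotheses (U0 : U 0) (UL : forall a x y, U x -> U y -> U (a *: x + y)).

Definition qrel (x y : M) : bool := `[< U (x - y) >].
Fact qrel_refl : reflexive qrel.
Proof. by move=> x; apply/asboolP; rewrite subrr. Qed.
Fact qrel_sym : symmetric qrel.
Proof.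
by move=> x y; apply/asboolP/asboolP => /(UL (-1)) /(_ U0);
  rewrite addr0 scaleN1r opprB.
Qed.
Fact qrel_trans : transitive qrel.
Proof.
move=> y x z /asboolP xy /asboolP yz; apply/asboolP.
by have := UL 1 xy yz; rewrite scale1r addrA subrK.
Qed.
Canonical qrel_equiv := EquivRel qrel qrel_refl qrel_sym qrel_trans.
Definition qmod := {eq_quot qrel_equiv}.
HB.instance Definition _ := Choice.on qmod.
Definition qcl (x : M) : qmod := \pi_qmod x.

Lemma qclP x y : qcl x = qcl y <-> U (x - y).
Proof. by split=> [/eqmodP /asboolP | xy]; last by apply/eqmodP/asboolP. Qed.
Lemma qclW (z : qmod) : exists x, z = qcl x.
Proof. by exists (repr z); rewrite /qcl reprK. Qed.
Lemma qcl_repr z : qcl (repr z) = z. Proof. by rewrite /qcl reprK. Qed.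

Let qadd (x y : qmod) := qcl (repr x + repr y).
Let qscale a (x : qmod) := qcl (a *: repr x).

Fact qaddE x y : qadd (qcl x) (qcl y) = qcl (x + y).
Proof.
apply/qclP; rewrite opprD addrACA -[X in U (X + _)]scale1r.
by apply: UL; apply/qclP; rewrite qcl_repr.
Qed.
Fact qscaleE a x : qscale a (qcl x) = qcl (a *: x).
Proof.
apply/qclP; rewrite -scalerBr -[X in U X]addr0; apply: UL => //.
by apply/qclP; rewrite qcl_repr.
Qed.
Fact qaddA : associative qadd.
Proof.
move=> x y z; have [[t ->] [u ->] [v ->]] := And3 (qclW x) (qclW y) (qclW z).
by rewrite !qaddE addrA.
Qed.
Fact qaddC : commutative qadd.
Proof.
move=> x y; have [[t ->] [u ->]] := conj (qclW x) (qclW y).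
by rewrite !qaddE addrC.
Qed.
Fact qadd0 : left_id (qcl 0) qadd.
Proof. by move=> x; have [t ->] := qclW x; rewrite qaddE add0r. Qed.
Fact qaddN : left_inverse (qcl 0) (qscale (-1)) qadd.
Proof.
by move=> x; have [t ->] := qclW x; rewrite qscaleE qaddE scaleN1r addNr.
Qed.
HB.instance Definition _ := GRing.isZmodule.Build qmod qaddA qaddC qadd0 qaddN.
Fact qscaleA a b x : qscale a (qscale b x) = qscale (a * b) x.
Proof. by have [t ->] := qclW x; rewrite !qscaleE scalerA. Qed.
Fact qscale1 : left_id 1 qscale.
Proof. by move=> x; have [t ->] := qclW x; rewrite qscaleE scale1r. Qed.
Fact qscaleDr : right_distributive qscale +%R.
Proof.
move=> a x y; have [[t ->] [u ->]] := conj (qclW x) (qclW y).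
by rewrite [_ + _]qaddE !qscaleE [RHS]qaddE scalerDr.
Qed.
Fact qscaleDl x : {morph qscale^~ x : a b / a + b}.
Proof.
move=> a b; have [t ->] := qclW x.
by rewrite !qscaleE [RHS]qaddE scalerDl.
Qed.
HB.instance Definition _ := GRing.Zmodule_isLmodule.Build A qmod
  qscaleA qscale1 qscaleDr qscaleDl.

Lemma qcl_lin a x y : qcl (a *: x + y) = a *: qcl x + qcl y.
Proof. by rewrite [_ *: qcl _]qscaleE [RHS]qaddE. Qed.
Lemma qcl0 x : U x -> qcl x = 0.
Proof. by move=> Ux; apply/qclP; rewrite subr0. Qed.
Lemma qcl0E x : qcl x = 0 -> U x.
Proof. by move/qclP; rewrite subr0. Qed.
End QuotientModule.

Section FaithfullyFlat.
Variables (B A : comNzRingType) (phi : {rmorphism B -> A}).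
Hypothesis ff : faithfully_flat phi.

(** The submodule spanned by m is isomorphic to the quotient of B by the
    annihilator of m.  By flatness its tensor product with A embeds in that of
    M, where it vanishes because m ⊗ 1 does; by faithfulness it is zero. *)
Lemma faithfully_flat_detect (M : lmodType B) (m : M) :
  tensor_eq0 phi [:: (m, 1)] -> m = 0.
Proof.
move=> m0; have [fl fa] := ff.
pose U (a : B^o) : Prop := a *: m = 0.
have U0 : U 0 by rewrite /U scale0r.
have UL a x y : U x -> U y -> U (a *: x + y).
  by rewrite /U => Ux Uy; rewrite scalerDl -scalerA Ux Uy scaler0 addr0.
pose Q : lmodType B := qmod U0 UL.
pose u (z : Q) : M := (generic_quotient.repr z : B) *: m.
have uE x : u (qcl U0 UL x) = (x : B) *: m.
  apply/eqP; rewrite -subr_eq0 -scalerBl; apply/eqP.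
  by apply/(qclP U0 UL); rewrite qcl_repr.
have uL : linear u.
  move=> a x y; have [[s ->] [t ->]] := conj (qclW x) (qclW y).
  by rewrite -qcl_lin !uE scalerDl scalerA.
pose uM : {linear Q -> M} := HB.pack u (GRing.isLinear.Build _ _ _ _ u uL).
have uI : injective uM.
  move=> x y; have [[s ->] [t ->]] := conj (qclW x) (qclW y) => /=.
  by rewrite !uE => e; apply/(qclP U0 UL); rewrite /U scalerBl e subrr.
have Q0 : forall z : Q, z = 0.
  apply: fa => t; apply: fl uI _ _ => P b b1 b2.
  rewrite big_map big1 // => -[z y] _ /=; rewrite /u.
  have bm : b m y = 0.
    have := m0 P (fun x w => b x (w * y)); rewrite big_seq1 /= mul1r; apply.
      by move=> *; rewrite b1.
    by move=> *; rewrite mulrDl -mulrA b2.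
  have b0 : b 0 y = 0.
    by have := b1 (-1) 0 0 y; rewrite scaler0 addr0 scaleN1r addNr.
  by rewrite -[X in b X]addr0 b1 bm b0 scaler0 addr0.
by have := uE 1; rewrite scale1r (Q0 (qcl _ _ _)) => <-; apply: (linear0 uM).
Qed.

(** An element a of the kernel satisfies a ⊗ 1 = 1 ⊗ phi(a) = 0. *)
Lemma faithfully_flat_inj : injective phi.
Proof.
move=> x y e; apply/eqP; rewrite -subr_eq0; apply/eqP.
apply: (@faithfully_flat_detect B^o) => P b b1 b2; rewrite big_seq1 /=.
have b0l z : b 0 z = 0.
  by have := b1 (-1) 0 0 z; rewrite scaler0 addr0 scaleN1r addNr.
have b0r z : b z 0 = 0.
  by have := b2 (-1) z 0 0; rewrite mulr0 addr0 scaleN1r addNr.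
have := b2 (x - y) 1 1 0; have := b1 (x - y) 1 0 1.
rewrite b0l b0r !addr0 mulr1 rmorphB e subrr !b0r => <-.
by rewrite [_ *: _]mulr1 => ->.
Qed.
End FaithfullyFlat.

Lemma self_tens_nz (k : fieldType) (R : comAlgType k) (Z : Type) (f : Z -> R) :
  exists (P : lmodType k) (D : R * R -> P), tens_adm f f D /\ D (1, 1) <> 0.
Proof.
exists R, (fun a => a.1 * a.2); split; last by rewrite /= mulr1; apply/eqP/oner_neq0.
split=> [c x x' y | c x y y' | z x y] /=.
- by rewrite mulrDl scalerAl.
- by rewrite mulrDr scalerAr.
- by rewrite -mulrA mulrCA.
Qed.

Section Descent.
Variables (k : fieldType) (A C : comAlgType k) (phi : {lrmorphism A -> C}).
Hypothesis ff : faithfully_flat phi.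

(** Testing on the two maps C -> C ⊗_A C gives f ⊗ 1 = 1 ⊗ f.  In
    (C / A) ⊗_A C the right-hand side vanishes, hence so does the class of f in
    C / A. *)
Lemma faithfully_flat_descent (f : C) :
  (forall (R : comAlgType k) (g g' : {lrmorphism C -> R}),
     g ∘ phi = g' ∘ phi -> g f = g' f) -> exists a, phi a = f.
Proof.
move=> fP.
pose U (x : restr_along phi C^o) : Prop := exists a, phi a = x :> C.
have U0 : U 0 by exists 0; rewrite lr0.
have UL a x y : U x -> U y -> U (a *: x + y).
  by move=> [b <-] [c <-]; exists (a * b + c); rewrite lrD lrM.
suff e : qcl U0 UL f = 0 by exact: (qcl0E e).
apply: (faithfully_flat_detect ff) => P b b1 b2; rewrite big_seq1 /=.
pose ak : {rmorphism k -> A} := (in_alg A : {rmorphism k -> A}).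
pose D (a : C * C) : restr_along ak P := b (qcl U0 UL a.1) a.2.
have aD : tens_adm phi phi D.
  split=> [c x x' y | c x y y' | z x y]; rewrite /D /=.
  - rewrite restrE -b1 -qcl_lin; congr (b (qcl _ _ _) _).
    by rewrite -[RHS]/(phi (c *: 1) * x + x') lrZ lr1 mulr_algl.
  - rewrite restrE -b2; congr (b _ _); congr (_ + _).
    by rewrite -[RHS]/(phi (c *: 1) * y) lrZ lr1 mulr_algl.
  - have b0r w : b w 0 = 0.
      by have := b2 (-1) w 0 0; rewrite mulr0 addr0 scaleN1r addNr.
    have b0l w : b 0 w = 0.
      by have := b1 (-1) 0 0 w; rewrite scaler0 addr0 scaleN1r addNr.
    have -> : qcl U0 UL (phi z * x) = z *: qcl U0 UL x + 0.
      by rewrite -(qcl0 U0 UL U0) -qcl_lin addr0.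
    by rewrite b1 b0l -[in RHS](addr0 (phi z * y)) b2 b0r.
have e : tl (self_tens_nz phi) f = tr (self_tens_nz phi) f.
  by apply: fP; apply: lrmorphism_ext => a; rewrite !alg_compE tlr.
have := congr1 (tbilin (nz := self_tens_nz phi) D) e.
rewrite -[tl _ f]mulr1 -[X in _ * X](rmorph1 (tr (self_tens_nz phi))).
rewrite -[tr _ f]mul1r -[X in X * tr _ _](rmorph1 (tl (self_tens_nz phi))).
rewrite !tbilinE // /D /= => ->.
have -> : qcl U0 UL 1 = 0 by apply: qcl0; exists 1; rewrite lr1.
by have := b1 (-1) 0 0 f; rewrite scaler0 addr0 scaleN1r addNr.
Qed.
End Descent.

(** * Subalgebras *)

Section Subalgebra.
Variables (k : fieldType) (W : comAlgType k) (S : {pred W}).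
Hypothesis SA : GRing.subsemialg_closed S.

Definition subalg_pred := S.
HB.instance Definition _ := GRing.isSubalgClosed.Build k W subalg_pred SA.
Record subalg := Subalg { subalg_val : W; _ : subalg_val \in subalg_pred }.
HB.instance Definition _ := [isSub for subalg_val].
HB.instance Definition _ := [Choice of subalg by <:].
HB.instance Definition _ := [SubChoice_isSubComNzRing of subalg by <:].
HB.instance Definition _ := [SubZmodule_isSubLmodule of subalg by <:].
HB.instance Definition _ := [SubNzRing_SubLmodule_isSubLalgebra of subalg by <:].
HB.instance Definition _ := [SubLalgebra_isSubAlgebra of subalg by <:].
Definition subalgA : comAlgType k := subalg.
Definition sub_incl : {lrmorphism subalgA -> W} :=
  @mk_lrmorphism _ subalgA W (val : subalg -> W)
    (fun x y => erefl) (fun x y => erefl) erefl (fun c x => erefl).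

Lemma sub_incl_inj : injective sub_incl.
Proof. by move=> x y; rewrite !mk_lrmorphismE; apply: val_inj. Qed.
Lemma sub_inclP x : sub_incl x \in S.
Proof. by rewrite mk_lrmorphismE; apply: (valP (x : subalg)). Qed.

Section SubLift.
Variables (A : comAlgType k) (f : {lrmorphism A -> W}).
Hypothesis fS : forall a, f a \in S.
Definition sub_lift : {lrmorphism A -> subalgA}.
Proof.
apply: (@mk_lrmorphism _ A subalgA (fun a => Subalg (fS a))) => [x y|x y||c x].
- by apply: val_inj; rewrite /= lrD.
- by apply: val_inj; rewrite /= lrM.
- by apply: val_inj; rewrite /= lr1.
- by apply: val_inj; rewrite /= lrZ.
Defined.
Lemma sub_liftK : sub_incl ∘ sub_lift = f.
Proof.
by apply: lrmorphism_ext => a; rewrite alg_compE !mk_lrmorphismE.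
Qed.
End SubLift.
End Subalgebra.

(** * The ring of symmetric tensors of a finite free algebra *)

(** A basis of C over R with its coordinate forms, both algebras being over
    k. *)
Record free_basis (k : fieldType) (R C : comAlgType k)
  (rho : {lrmorphism R -> C}) (m : nat) := FreeBasis {
  fb : 'I_m -> C;
  fc : 'I_m -> C -> R;
  fcP : forall i r x y, fc i (rho r * x + y) = r * fc i x + fc i y;
  fb_span : forall x, x = \sum_i rho (fc i x) * fb i;
  fb_dual : forall i j, fc i (fb j) = (i == j)%:R
}.

Section FreeBasis.
Variables (k : fieldType) (R C : comAlgType k) (rho : {lrmorphism R -> C}).
Variables (m : nat) (e : free_basis rho m).

Lemma fc0 i : fc e i 0 = 0.
Proof. by have := fcP e i (-1) 0 0; rewrite mulr0 addr0 mulN1r addNr. Qed.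
Lemma fcD i x y : fc e i (x + y) = fc e i x + fc e i y.
Proof. by rewrite -[x in LHS]mul1r -(lr1 rho) fcP mul1r. Qed.
Lemma fcM i r x : fc e i (rho r * x) = r * fc e i x.
Proof. by rewrite -[_ * x]addr0 fcP fc0 addr0. Qed.
Lemma fc_sum i (J : finType) (E : J -> C) :
  fc e i (\sum_j E j) = \sum_j fc e i (E j).
Proof. by apply: (big_morph (fc e i)) => [x y|]; rewrite ?fcD ?fc0. Qed.

Lemma free_basis_gt0 : (0 < m)%N.
Proof.
case: m e => // e0; have := oner_neq0 C.
by rewrite [1](fb_span e0) big_ord0 eqxx.
Qed.
End FreeBasis.

Section MultiTensor.
Variables (k : fieldType) (R C : comAlgType k) (rho : {lrmorphism R -> C}).
Variable m : nat.
Local Notation X := {ffun 'I_m -> C}.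
Implicit Types (c v : X).

Definition upd c i x : X := [ffun l => if l == i then x else c l].
Definition vmul c v : X := [ffun l => c l * v l].
Definition vone : X := [ffun => 1].

Lemma upd_id c i : upd c i (c i) = c.
Proof. by apply/ffunP => l; rewrite ffunE; case: eqP => // ->. Qed.
Lemma updE c i x : upd c i x i = x. Proof. by rewrite ffunE eqxx. Qed.
Lemma upd_ne c i x l : l != i -> upd c i x l = c l.
Proof. by rewrite ffunE => /negPf ->. Qed.

Fact vmulA : associative vmul.
Proof. by move=> a b c; apply/ffunP => l; rewrite !ffunE mulrA. Qed.
Fact vmulC : commutative vmul.
Proof. by move=> a b; apply/ffunP => l; rewrite !ffunE mulrC. Qed.
Fact vmul1 : left_id vone vmul.
Proof. by move=> a; apply/ffunP => l; rewrite !ffunE mul1r. Qed.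
Lemma vmul_upd c v i x : vmul c (upd v i x) = upd (vmul c v) i (c i * x).
Proof. by apply/ffunP => l; rewrite !ffunE; case: eqP => // ->. Qed.

(** Multilinearity over R for maps to a k-module: k-multilinear, and a scalar
    of R may be moved from one slot to another.  Stated in this way it can be
    pulled back along a change of R, with no R-module structure on P. *)
Definition wadm (P : lmodType k) (D : X -> P) : Prop :=
  (forall c i a x y,
     D (upd c i (a *: x + y)) = a *: D (upd c i x) + D (upd c i y)) /\
  (forall c i j r, D (upd c i (rho r * c i)) = D (upd c j (rho r * c j))).

Fact wadmM (P : lmodType k) (D : X -> P) c :
  wadm D -> wadm (fun v => D (vmul c v)).
Proof.
case=> D1 D2; split=> [v i a x y | v i j r].
  by rewrite !vmul_upd mulrDr -scalerAr D1.
have aux l : c l * (rho r * v l) = rho r * vmul c v l.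
  by rewrite ffunE mulrCA.
by rewrite !vmul_upd !aux; apply: D2.
Qed.

Definition rmultilinear (D : X -> R) : Prop := forall c i r x y,
  D (upd c i (rho r * x + y)) = r * D (upd c i x) + D (upd c i y).

Lemma rmultilinear_adm D : rmultilinear D -> wadm D.
Proof.
move=> Dl; split=> [c i a x y | c i j r].
  by rewrite -[a *: x]mulr_algl -(lr1 rho) -lrZ Dl mulr_algl.
have D0 l : D (upd c l 0) = 0.
  by have := Dl c l (-1) 0 0; rewrite mulr0 addr0 mulN1r addNr.
have aux l : D (upd c l (rho r * c l)) = r * D c.
  by rewrite -[_ * c l]addr0 Dl D0 upd_id addr0.
by rewrite !aux.
Qed.

Lemma rmultilinear_prod (h : 'I_m -> C -> R) :
  (forall i r x y, h i (rho r * x + y) = r * h i x + h i y) ->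
  rmultilinear (fun c => \prod_l h l (c l)).
Proof.
move=> hP c i r x y; rewrite (bigD1 i) //= [in X in r * X](bigD1 i) //=.
rewrite [X in _ = _ + X](bigD1 i) //= !updE hP mulrDl -mulrA.
by congr (_ * (_ * _) + _ * _); apply: eq_bigr => l li; rewrite !upd_ne.
Qed.

Lemma rmultilinear_sum (J : finType) (Q : pred J) (a : J -> R) (D : J -> X -> R) :
  (forall j, rmultilinear (D j)) ->
  rmultilinear (fun c => \sum_(j | Q j) a j * D j c).
Proof.
move=> Dl c i r x y; rewrite mulr_sumr -big_split; apply: eq_bigr => j _ /=.
by rewrite Dl mulrDr mulrCA.
Qed.

Hypothesis wnz : exists (P : lmodType k) (D : X -> P), wadm D /\ D vone <> 0.

Definition wpres := Presentation vmulA vmulC vmul1 wadmM wnz.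
Definition mtens : comAlgType k := presented wpres.
Definition wgen c : mtens := pgen (p := wpres) c.
Definition wev (P : lmodType k) (D : X -> P) (w : mtens) : P :=
  pev (p := wpres) D w.

Lemma wev_gen (P : lmodType k) (D : X -> P) c : wadm D -> wev D (wgen c) = D c.
Proof. exact: (pev_gen (p := wpres)). Qed.
Lemma wevP (P : lmodType k) (D : X -> P) a x y :
  wadm D -> wev D (a *: x + y) = a *: wev D x + wev D y.
Proof. by move=> aD; rewrite /wev (pevD (p := wpres)) // pevZ. Qed.

(** The permutation s acts on the tensor power by c |-> c o s. *)
Definition wpermf (s : 'S_m) c : X := [ffun l => c (s l)].
Lemma wpermf_upd s c i x : wpermf s (upd c i x) = upd (wpermf s c) (s^-1%g i) x.
Proof.
apply/ffunP => l; rewrite !ffunE.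
by rewrite -(inj_eq (@perm_inj _ s) l) permKV.
Qed.

Fact wperm_adm s : wadm (fun c => wgen (wpermf s c)).
Proof.
split=> [c i a x y | c i j r].
  by rewrite !wpermf_upd; apply: pgen_lin => P D [D1 _]; apply: D1.
rewrite !wpermf_upd.
have aux l : rho r * c l = rho r * wpermf s c (s^-1%g l).
  by rewrite ffunE permKV.
by rewrite !aux; apply: pgen_eq => P D [_ D2]; apply: D2.
Qed.
Fact wpermM s : {morph (fun c => wgen (wpermf s c)) : x y / vmul x y >-> x * y}.
Proof.
move=> x y; rewrite /wgen -(pgenM (p := wpres)); congr pgen.
by apply/ffunP => l; rewrite !ffunE.
Qed.
Fact wperm1 s : wgen (wpermf s vone) = 1.
Proof.
rewrite /wgen -[RHS](pgen1 wpres); congr pgen.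
by apply/ffunP => l; rewrite !ffunE.
Qed.
Definition wperm s : {lrmorphism mtens -> mtens} :=
  plift (p := wpres) (wperm_adm s) (@wpermM s) (wperm1 s).

Lemma wperm_gen s c : wperm s (wgen c) = wgen (wpermf s c).
Proof. exact: plift_gen. Qed.

Lemma mtens_ext (P : lmodType k) (f g : mtens -> P) :
  (forall a x y, f (a *: x + y) = a *: f x + f y) ->
  (forall a x y, g (a *: x + y) = a *: g x + g y) ->
  (forall c, f (wgen c) = g (wgen c)) -> f =1 g.
Proof. exact: presented_lin_ext. Qed.

Lemma wev_perm s (D : X -> R) w : wadm D ->
  wev (fun c => D (wpermf s c)) w = wev D (wperm s w).
Proof.
move=> aD; have aDs : wadm (fun c => D (wpermf s c)).
  case: (aD) => D1 D2; split=> [c i a x y | c i j r]; rewrite !wpermf_upd //.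
  have aux l : rho r * c l = rho r * wpermf s c (s^-1%g l).
    by rewrite ffunE permKV.
  by rewrite !aux; apply: D2.
apply: (mtens_ext (P := R) (f := wev _)
  (g := fun w => wev D (wperm s w))) w => [a x y|a x y|c].
- exact: wevP.
- by rewrite lrP wevP.
- by rewrite wperm_gen !wev_gen.
Qed.

Lemma wev_mul_gen (D : X -> R) w c : wadm D ->
  wev D (w * wgen c) = wev (fun v => D (vmul v c)) w.
Proof.
move=> aD; have aDc : wadm (fun v => D (vmul v c)).
  by under eq_fun do rewrite vmulC; apply: wadmM.
apply: (mtens_ext (P := R) (f := fun w => wev D (w * _))
  (g := wev _)) w => [a x y|a x y|v].
- by rewrite mulrDl -scalerAl wevP.
- exact: wevP.
- by rewrite /wgen -(pgenM (p := wpres)) (wev_gen _ aDc) -[pgen _]/(wgen _) wev_gen.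
Qed.

Lemma wev_sum (J : finType) (Q : pred J) (a : J -> R) (D : J -> X -> R) w :
  (forall j, rmultilinear (D j)) ->
  wev (fun c => \sum_(j | Q j) a j * D j c) w =
  \sum_(j | Q j) a j * wev (D j) w.
Proof.
move=> Dl; have aS := rmultilinear_adm (rmultilinear_sum Q a Dl).
have aD j := rmultilinear_adm (Dl j).
apply: (mtens_ext (P := R) (f := wev _)
  (g := fun w => \sum_(j | Q j) a j * wev (D j) w)) w => [b x y|b x y|c].
- exact: wevP.
- rewrite scaler_sumr -big_split; apply: eq_bigr => j _ /=.
  by rewrite wevP // mulrDr scalerAr.
- by rewrite wev_gen //; apply: eq_bigr => j _; rewrite wev_gen.
Qed.

(** x in the i-th slot, 1 in the others. *)
Definition wslot (i : 'I_m) (x : C) : mtens := wgen (upd vone i x).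

Fact wslot_lin (i : 'I_m) a x y : wslot i (a *: x + y) = a *: wslot i x + wslot i y.
Proof. by apply: pgen_lin => P D [D1 _]; apply: D1. Qed.
Definition slot (i : 'I_m) : {lrmorphism C -> mtens}.
Proof.
apply: (@mk_lrmorphism _ C mtens (wslot i)) => [x y|x y||c x].
- by rewrite -[x in LHS]scale1r wslot_lin scale1r.
- rewrite /wslot /wgen -(pgenM (p := wpres)); congr pgen.
  by apply/ffunP => l; rewrite !ffunE; case: eqP => // _; rewrite mulr1.
- rewrite /wslot /wgen -[RHS](pgen1 wpres); congr pgen.
  by apply/ffunP => l; rewrite !ffunE; case: eqP.
- have w0 : wslot i 0 = 0.
    by have := wslot_lin i (-1) 0 0; rewrite scaler0 addr0 scaleN1r addNr.
  by rewrite -[c *: x]addr0 wslot_lin w0 addr0.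
Defined.

Lemma slotE i x : slot i x = wgen (upd vone i x).
Proof. exact: mk_lrmorphismE. Qed.

Lemma wperm_slot s i : wperm s ∘ slot i = slot (s^-1%g i).
Proof.
apply: lrmorphism_ext => x; rewrite alg_compE !slotE wperm_gen wpermf_upd.
by congr (wgen (upd _ _ _)); apply/ffunP => l; rewrite !ffunE.
Qed.

Lemma slot_in i j : slot i ∘ rho = slot j ∘ rho.
Proof.
apply: lrmorphism_ext => r; rewrite !alg_compE !slotE.
have aux l : upd vone l (rho r) = upd vone l (rho r * vone l).
  by rewrite ffunE mulr1.
by rewrite !aux; apply: pgen_eq => P D [_ D2]; apply: D2.
Qed.

Definition symmetric_tensor : {pred mtens} :=
  fun w => `[< forall s, wperm s w = w >].
Lemma symP w : reflect (forall s, wperm s w = w) (w \in symmetric_tensor).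
Proof. exact: asboolP. Qed.

Lemma symI w : (forall s, wperm s w = w) -> w \in symmetric_tensor.
Proof. by move/symP. Qed.
Lemma symE s w : w \in symmetric_tensor -> wperm s w = w.
Proof. by move/symP. Qed.

Fact sym_closed : GRing.subsemialg_closed symmetric_tensor.
Proof.
split=> [||a x sx|x y sx sy].
- by apply: symI => s; rewrite lr1.
- split=> [|x y sx sy]; apply: symI => s; first by rewrite lr0.
  by rewrite lrD !symE.
- by apply: symI => s; rewrite lrZ symE.
- by apply: symI => s; rewrite lrM !symE.
Qed.

Definition symtens : comAlgType k := subalgA sym_closed.
Definition sym_incl : {lrmorphism symtens -> mtens} := sub_incl sym_closed.

Section Det.
Variable e : free_basis rho m.

(** For basis vectors v this is the form through which symmetric tensors act on
    the top exterior power of C, which is free of rank one. *)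
Definition wdet v c : R := \det (\matrix_(i, j) fc e j (c i * v i)).
Definition vdet v : R := \det (\matrix_(i, j) fc e j (v i)).
Definition ebase : X := [ffun i => fb e i].

Lemma wdetE v c :
  wdet v c = \sum_(s : 'S_m) (-1) ^+ s * \prod_i fc e (s i) (c i * v i).
Proof.
by apply: eq_bigr => s _; congr (_ * _); apply: eq_bigr => i _; rewrite mxE.
Qed.

Lemma wdet_term s v :
  rmultilinear (fun c => \prod_i fc e (s i) (c i * v i)).
Proof.
apply: (@rmultilinear_prod (fun i x => fc e (s i) (x * v i))) => i r x y.
by rewrite mulrDl -mulrA fcP.
Qed.

Lemma wdet_rml v : rmultilinear (wdet v).
Proof.
move=> c i r x y; rewrite !wdetE.
exact: (rmultilinear_sum predT (fun s : 'S_m => (-1) ^+ s)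
  (fun s => wdet_term s v)).
Qed.
Lemma wdet_adm v : wadm (wdet v).
Proof. exact: rmultilinear_adm (wdet_rml v). Qed.

(** For v_i1 = v_i2, exchanging the slots i1 and i2 turns the even part of the
    Leibniz sum into its odd part.  Both therefore agree on symmetric tensors.
    Antisymmetry of the determinant would only show that twice the value is
    zero, which is not enough in characteristic 2. *)
Lemma wdet_alternate v w i1 i2 : w \in symmetric_tensor ->
  i1 != i2 -> v i1 = v i2 -> wev (wdet v) w = 0.
Proof.
move=> /symP sw ne ev; pose t := tperm i1 i2.
pose E (s : 'S_m) c := \prod_i fc e (s i) (c i * v i).
pose D c := \sum_(s : 'S_m | ~~ odd_perm s) 1 * E s c.
have Dl : rmultilinear D by apply: rmultilinear_sum => s; apply: wdet_term.
have vt l : v (t l) = v l by rewrite /t; case: tpermP => [->|->|].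
have Et s c : E (t * s)%g c = E s (wpermf t c).
  rewrite /E (reindex_inj (@perm_inj _ t)) /=; apply: eq_bigr => i _.
  by rewrite permM /t tpermK -/t vt ffunE.
have DE c : wdet v c = 1 * D c + (-1) * D (wpermf t c).
  rewrite wdetE (bigID (fun s : 'S_m => ~~ odd_perm s)) /= mul1r mulN1r.
  congr (_ + _).
    by apply: eq_bigr => s /negPf ->; rewrite expr0.
  rewrite (reindex_inj (mulgI t)) -sumrN.
  apply: eq_big => [s|s]; rewrite odd_permM odd_tperm ne /= ?negbK //.
  by move=> ->; rewrite expr1 mulN1r mul1r -/(E _ _) Et.
rewrite (_ : wdet v = fun c => \sum_(b : bool)
  (if b then 1 else -1) * (if b then D c else D (wpermf t c))); last first.
  by apply/funext => c; rewrite DE big_bool.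
rewrite (@wev_sum bool predT (fun b => if b then 1 else -1)
  (fun b c => if b then D c else D (wpermf t c))); last first.
  case=> //; move=> c i r x y; rewrite !wpermf_upd; exact: Dl.
rewrite big_bool /= wev_perm ?sw ?mul1r ?mulN1r ?subrr //.
exact: rmultilinear_adm.
Qed.

(** A symmetric tensor acts on the top exterior power by a scalar: by
    [wdet_alternate] the value at v is an alternating form in v, hence a
    multiple of the determinant. *)
Lemma wev_wdet v w : w \in symmetric_tensor ->
  wev (wdet v) w = wev (wdet ebase) w * vdet v.
Proof.
move=> sw; pose V i j := fc e j (v i).
pose vf (f : {ffun 'I_m -> 'I_m}) : X := [ffun i => fb e (f i)].
have vE c : wdet v c =
    \sum_(f : {ffun 'I_m -> 'I_m}) (\prod_i V i (f i)) * wdet (vf f) c.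
  rewrite wdetE; under [RHS]eq_bigr do rewrite wdetE mulr_sumr.
  rewrite exchange_big; apply: eq_bigr => s _ /=.
  transitivity ((-1) ^+ s * \prod_i \sum_j V i j * fc e (s i) (c i * fb e j)).
    congr (_ * _); apply: eq_bigr => i _.
    rewrite {1}(fb_span e (v i)) mulr_sumr fc_sum; apply: eq_bigr => j _.
    by rewrite mulrCA fcM.
  rewrite bigA_distr_bigA mulr_sumr; apply: eq_bigr => f _.
  rewrite big_split /= mulrCA; congr (_ * (_ * _)).
  by apply: eq_bigr => i _; rewrite ffunE.
rewrite (_ : wdet v = fun c =>
    \sum_(f : {ffun 'I_m -> 'I_m}) (\prod_i V i (f i)) * wdet (vf f) c);
  last exact/funext.
rewrite (wev_sum predT); last by move=> f; apply: wdet_rml.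
rewrite (bigID (fun f : {ffun 'I_m -> 'I_m} => injectiveb f)) /= addrC big1 ?add0r.
  rewrite (reindex (@pval _)) /=; last first.
    pose in_Sn := insubd (1%g : 'S_m).
    by exists in_Sn => /= f Uf; first apply: val_inj; apply: insubdK.
  rewrite mulr_sumr; apply: eq_big => /= [s | s _]; rewrite ?(valP s) //.
  have vs c : wdet (vf (pval s)) c = (-1) ^+ s * wdet ebase (wpermf s^-1%g c).
    rewrite /wdet -det_perm -det_mulmx -row_permE; congr (\det _).
    by apply/matrixP => i j; rewrite !mxE !ffunE pvalE permK.
  rewrite (_ : wdet _ = fun c => \sum_(j : 'I_1) (-1) ^+ s *
    (fun _ c => wdet ebase (wpermf s^-1%g c)) j c); last first.
    by apply/funext => c; rewrite vs big_ord_recl big_ord0 addr0.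
  rewrite (wev_sum predT); last first.
    by move=> _ c i r x y; rewrite !wpermf_upd; apply: wdet_rml.
  rewrite big_ord_recl big_ord0 addr0 wev_perm; last exact: wdet_adm.
  have /symP -> := sw; rewrite mulrA mulrC; congr (_ * _).
  rewrite mulrC; congr (_ * _); apply: eq_bigr => i _.
  by rewrite mxE pvalE.
move=> f /injectivePn [i1 [i2 ne ef]].
by rewrite (@wdet_alternate _ _ i1 i2) ?mulr0 // !ffunE ef.
Qed.

Definition wdelta (w : mtens) : R := wev (wdet ebase) w.

Lemma vdet_base : vdet ebase = 1.
Proof.
rewrite /vdet -[RHS](det1 R m); congr (\det _).
by apply/matrixP => i j; rewrite !mxE ffunE fb_dual eq_sym.
Qed.

(** Multiplicativity is [wev_wdet] applied to the vectors v = c e, where c runs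
    through the pure tensors occurring in w'. *)
Lemma wdeltaM w w' : w \in symmetric_tensor ->
  wdelta (w * w') = wdelta w * wdelta w'.
Proof.
move=> sw; apply: (mtens_ext (P := R) (f := fun x => wdelta (w * x))
  (g := fun x => wdelta w * wdelta x)) w' => [a x y|a x y|c].
- by rewrite mulrDr -scalerAr /wdelta wevP //; apply: wdet_adm.
- by rewrite /wdelta wevP ?mulrDr ?scalerAr //; apply: wdet_adm.
- rewrite /wdelta wev_mul_gen; last exact: wdet_adm.
  rewrite (wev_gen c (wdet_adm _)).
  have -> : (fun v => wdet ebase (vmul v c)) = wdet (vmul c ebase).
    apply/funext => v; congr (\det _); apply/matrixP => i j.
    by rewrite !mxE !ffunE mulrA.
  rewrite wev_wdet //; congr (_ * \det _); apply/matrixP => i j.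
  by rewrite !mxE !ffunE.
Qed.

Lemma wdelta1 : wdelta 1 = 1.
Proof.
rewrite /wdelta -(pgen1 wpres) -[pgen _]/(wgen vone) (wev_gen _ (wdet_adm _)).
rewrite -vdet_base; congr (\det _); apply/matrixP => i j.
by rewrite !mxE !ffunE mul1r.
Qed.

Lemma wdelta_lin a x y : wdelta (a *: x + y) = a *: wdelta x + wdelta y.
Proof. exact/wevP/wdet_adm. Qed.

Lemma wdelta_in i r : wdelta (slot i (rho r)) = r.
Proof.
have rl := wdet_rml ebase vone i.
have d1 : wdet ebase vone = 1.
  by rewrite -wdelta1 /wdelta -(pgen1 wpres) -[pgen _]/(wgen vone)
    (wev_gen _ (wdet_adm _)).
rewrite slotE /wdelta (wev_gen _ (wdet_adm _)).
have r0 : wdet ebase (upd vone i 0) = 0.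
  by have := rl (-1) 0 0; rewrite mulr0 addr0 mulN1r addNr.
have := rl r 1 0; rewrite mulr1 addr0 r0 addr0.
have -> : upd vone i 1 = vone.
  by rewrite -[RHS](upd_id vone i); congr upd; rewrite ffunE.
by rewrite d1 mulr1.
Qed.

Definition sym_delta : {lrmorphism symtens -> R}.
Proof.
apply: (@mk_lrmorphism _ symtens R (fun w => wdelta (sym_incl w))) => [x y|x y||c x].
- by rewrite lrD -[sym_incl x in LHS]scale1r wdelta_lin scale1r.
- by rewrite lrM wdeltaM // sub_inclP.
- by rewrite lr1 wdelta1.
- rewrite lrZ; have w0 : wdelta 0 = 0.
    by have := wdelta_lin (-1) 0 0; rewrite scaler0 addr0 scaleN1r addNr.
  by rewrite -[c *: _]addr0 wdelta_lin w0 addr0.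
Defined.
Lemma sym_deltaE w : sym_delta w = wdelta (sym_incl w).
Proof. exact: mk_lrmorphismE. Qed.
End Det.

(** A change of basis multiplies the determinants by det M and the value on the
    basis vectors by its inverse. *)
Lemma wdelta_basis (e e' : free_basis rho m) w : w \in symmetric_tensor ->
  wdelta e w = wdelta e' w.
Proof.
move=> sw; pose M := \matrix_(i, j) fc e' j (fb e i).
have detE c : wdet e (ebase e) c * \det M = wdet e' (ebase e) c.
  rewrite /wdet -det_mulmx; congr (\det _); apply/matrixP => i j.
  rewrite !mxE {1}(fb_span e (c i * _)) fc_sum; apply: eq_bigr => l _.
  by rewrite !mxE fcM.
have Mdet : \det M = vdet e' (ebase e).
  by congr (\det _); apply/matrixP => i j; rewrite !mxE ffunE.
have Mu : vdet e (ebase e') * \det M = 1.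
  rewrite -(vdet_base e') /vdet -det_mulmx; congr (\det _).
  apply/matrixP => i j; rewrite !mxE {1}(fb_span e (ebase e' i)) fc_sum.
  by apply: eq_bigr => l _; rewrite !mxE fcM.
have aux : wev (wdet e' (ebase e)) w = \det M * wdelta e w.
  rewrite (_ : wdet e' _ = fun c => \sum_(j : 'I_1) \det M *
    (fun _ => wdet e (ebase e)) j c); last first.
    by apply/funext => c; rewrite big_ord_recl big_ord0 addr0 mulrC detE.
  rewrite (wev_sum predT); last by move=> _; apply: wdet_rml.
  by rewrite big_ord_recl big_ord0 addr0.
have := wev_wdet e' (ebase e) sw; rewrite aux -Mdet -/(wdelta e' w).
rewrite mulrC => /(congr1 (fun z => z * vdet e (ebase e'))).
by rewrite -!mulrA [\det M * _]mulrC Mu !mulr1.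
Qed.

End MultiTensor.
Arguments symmetric_tensor {k R C rho m} wnz _.

(** * The norm of a commutative affine group *)

Lemma pt_exp_comp (k : fieldType) (T : affine_group k) (R S : comAlgType k)
  (f : {lrmorphism R -> S}) (x : points T R) m :
  f ∘ pt_exp x m = pt_exp (f ∘ x : points T S) m.
Proof. by elim: m => [|m IH] /=; rewrite ?comp1 // -[RHS]/(_ · _) -IH -compM. Qed.

Section BigPoints.
Variables (k : fieldType) (T : affine_group k) (R : comAlgType k).
Hypothesis Tcomm : forall x y : points T R, x · y = y · x.
HB.instance Definition _ := Monoid.isComLaw.Build (points T R) (pt_one T R)
  (@pt_mul k T R) (@ptA k T R) Tcomm (@pt1l k T R).

Definition pt_prod m (x : 'I_m -> points T R) : points T R :=
  \big[@pt_mul k T R/pt_one T R]_(i < m) x i.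

Lemma pt_prodM m (x y : 'I_m -> points T R) :
  pt_prod (fun i => x i · y i) = pt_prod x · pt_prod y.
Proof. exact: big_split. Qed.

Lemma pt_prod_perm m (x : 'I_m -> points T R) (s : 'S_m) :
  pt_prod (fun i => x (s i)) = pt_prod x.
Proof. by rewrite /pt_prod [RHS](reindex_inj (@perm_inj _ s)). Qed.
End BigPoints.

Section Norm.
Variables (k : fieldType) (T : affine_group k).
Hypothesis Tcomm : forall (R : comAlgType k) (x y : points T R), x · y = y · x.
Implicit Types (R S : comAlgType k).

Lemma pt_prod_comp R S (f : {lrmorphism R -> S}) m (x : 'I_m -> points T R) :
  f ∘ pt_prod x = pt_prod (fun i => f ∘ x i : points T S).
Proof.
by apply: (big_morph (fun x => alg_comp f x)) => [y z|]; rewrite ?compM ?comp1.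
Qed.

Lemma pt_prod_const R m (x : points T R) : pt_prod (fun _ : 'I_m => x) = pt_exp x m.
Proof. exact: big_const_ord. Qed.

(** The norm of x : T(C) is obtained from the product of the conjugates of x, a
    point of T over the m-fold tensor power of C.  It is lifted to the ring of
    symmetric tensors before [sym_delta] is applied, because functoriality of T
    is available for ring homomorphisms only and [wdelta] is multiplicative on
    symmetric tensors only. *)
Section NormDef.
Variables (R C : comAlgType k) (rho : {lrmorphism R -> C}) (m : nat).
Local Notation X := {ffun 'I_m -> C}.
Hypothesis wnz : exists (P : lmodType k) (D : X -> P),
  wadm rho D /\ D (vone C m) <> 0.

Definition wprod (x : points T C) : points T (mtens wnz) :=
  pt_prod (fun i => slot wnz i ∘ x : points T (mtens wnz)).

Lemma wprod_sym x a : wprod x a \in symmetric_tensor wnz.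
Proof.
apply: symI => s; rewrite -[LHS]/((wperm wnz s ∘ wprod x) a).
rewrite pt_prod_comp; apply: lr_congr.
rewrite -[RHS](pt_prod_perm (@Tcomm _) _ s^-1%g); congr pt_prod.
by apply/funext => i; rewrite alg_compA wperm_slot.
Qed.

Definition sprod x : points T (symtens wnz) :=
  sub_lift (sym_closed wnz) (wprod_sym x).

Lemma sprodK x : sym_incl wnz ∘ sprod x = wprod x.
Proof. exact: sub_liftK. Qed.

Lemma sprod_eq (x y : points T (symtens wnz)) :
  sym_incl wnz ∘ x = sym_incl wnz ∘ y -> x = y.
Proof. by apply: comp_inj; apply: sub_incl_inj. Qed.

Variable e : free_basis rho m.

Definition norm_aux x : points T R := sym_delta wnz e ∘ sprod x.

Lemma norm_auxM x y : norm_aux (x · y) = norm_aux x · norm_aux y.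
Proof.
rewrite /norm_aux -compM; congr alg_comp; apply: sprod_eq.
rewrite compM !sprodK /wprod -pt_prodM //; congr pt_prod.
by apply/funext => i; rewrite compM.
Qed.

Lemma base_in_sym r i : slot wnz i (rho r) \in symmetric_tensor wnz.
Proof.
apply: symI => s; rewrite -[LHS]/((wperm wnz s ∘ slot wnz i) (rho r)).
by rewrite wperm_slot -[LHS]/((slot wnz _ ∘ rho) r) (slot_in _ _ i).
Qed.

Definition sbase (i : 'I_m) : {lrmorphism R -> symtens wnz} :=
  sub_lift (sym_closed wnz) (fun r => (base_in_sym r i : (slot wnz i ∘ rho) r \in _)).

Lemma sbaseK i : sym_incl wnz ∘ sbase i = slot wnz i ∘ rho.
Proof. exact: sub_liftK. Qed.

Lemma delta_sbase i : sym_delta wnz e ∘ sbase i = lr_id R.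
Proof.
apply: lrmorphism_ext => r; rewrite alg_compE sym_deltaE.
by rewrite -[sym_incl _ _]/((sym_incl wnz ∘ sbase i) r) sbaseK wdelta_in.
Qed.

Lemma norm_aux_in (t : points T R) : norm_aux (rho ∘ t) = pt_exp t m.
Proof.
pose i0 := Ordinal (free_basis_gt0 e).
rewrite -[RHS]alg_comp_id -(delta_sbase i0) -alg_compA; congr alg_comp.
apply: sprod_eq; rewrite sprodK alg_compA sbaseK -alg_compA !pt_exp_comp.
rewrite -pt_prod_const; congr pt_prod; apply/funext => i.
by rewrite !alg_compA (slot_in _ i i0).
Qed.

(** Conjugation by g is an automorphism of T over R, and every step of the
    construction is functorial over R. *)
Lemma norm_aux_conj (G : affine_group k) (f : group_hom T G)
  (f_inj : forall S, injective (on_points f (R := S)))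
  (g : points G R) (x x' : points T C) :
  on_points f x' = (rho ∘ g) · on_points f x · pt_inv (rho ∘ g) ->
  on_points f (norm_aux x') = g · on_points f (norm_aux x) · pt_inv g.
Proof.
move=> xx'; pose i0 := Ordinal (free_basis_gt0 e).
have gE : g = sym_delta wnz e ∘ (sbase i0 ∘ g).
  by rewrite alg_compA delta_sbase alg_comp_id.
rewrite /norm_aux !on_points_comp [in RHS]gE -compV -!compM; congr alg_comp.
apply: (comp_inj (sub_incl_inj (S := symmetric_tensor wnz) (SA := sym_closed wnz))).
rewrite -/(sym_incl wnz) !compM compV -!on_points_comp !sprodK alg_compA sbaseK.
rewrite /wprod; apply: (big_ind2 (fun y y' : points T _ => on_points f y =
  (_ · on_points f y' · _))) => [|y y' z z' ey ez|i _].
- by rewrite on_points1 pt1r ptVr.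
- by rewrite !on_pointsM ey ez !ptA ptKVr.
- by rewrite !on_points_comp xx' !compM compV !alg_compA (slot_in _ i i0).
Qed.

End NormDef.

Lemma norm_aux_basis (R C : comAlgType k) (rho : {lrmorphism R -> C}) m wnz
  (e e' : free_basis rho m) (x : points T C) :
  norm_aux wnz e x = norm_aux wnz e' x.
Proof.
apply: lrmorphism_ext => a; rewrite !alg_compE !sym_deltaE.
exact/wdelta_basis/sub_inclP.
Qed.

Section BaseChange.
Variables (R C R' C' : comAlgType k) (rho : {lrmorphism R -> C}).
Variables (rho' : {lrmorphism R' -> C'}).
Variables (h : {lrmorphism R -> R'}) (g : {lrmorphism C -> C'}) (m : nat).
Variables (e : free_basis rho m) (e' : free_basis rho' m).
Hypotheses (gh : g ∘ rho = rho' ∘ h) (ee' : forall i, g (fb e i) = fb e' i).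
Variables (wnz : exists (P : lmodType k) (D : {ffun 'I_m -> C} -> P),
  wadm rho D /\ D (vone C m) <> 0).
Variables (wnz' : exists (P : lmodType k) (D : {ffun 'I_m -> C'} -> P),
  wadm rho' D /\ D (vone C' m) <> 0).

Let gv (c : {ffun 'I_m -> C}) : {ffun 'I_m -> C'} := [ffun i => g (c i)].
Let gv_upd c i x : gv (upd c i x) = upd (gv c) i (g x).
Proof. by apply/ffunP => l; rewrite !ffunE; case: eqP. Qed.
Let ghE r : g (rho r) = rho' (h r).
Proof. by rewrite -[LHS]/((g ∘ rho) r) gh. Qed.

Fact mtens_map_adm : wadm rho (fun c => wgen wnz' (gv c)).
Proof.
split=> [c i a x y|c i j r].
  rewrite !gv_upd lrD lrZ; apply: pgen_lin => P D [D1 _]; exact: D1.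
rewrite !gv_upd !lrM !ghE.
have gc l : g (c l) = gv c l by rewrite ffunE.
by rewrite !gc; apply: pgen_eq => P D [_ D2]; apply: D2.
Qed.
Fact mtens_mapM :
  {morph (fun c => wgen wnz' (gv c)) : x y / vmul x y >-> x * y}.
Proof.
move=> x y; rewrite /wgen -(pgenM (p := wpres wnz')); congr pgen.
by apply/ffunP => l; rewrite !ffunE lrM.
Qed.
Fact mtens_map1 : wgen wnz' (gv (vone C m)) = 1.
Proof.
rewrite /wgen -[RHS](pgen1 (wpres wnz')); congr pgen.
by apply/ffunP => l; rewrite !ffunE lr1.
Qed.
Definition mtens_map : {lrmorphism mtens wnz -> mtens wnz'} :=
  plift (p := wpres wnz) mtens_map_adm mtens_mapM mtens_map1.

Lemma mtens_map_gen c : mtens_map (wgen wnz c) = wgen wnz' (gv c).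
Proof. exact: plift_gen. Qed.

Lemma mtens_map_slot i : mtens_map ∘ slot wnz i = slot wnz' i ∘ g.
Proof.
apply: lrmorphism_ext => x; rewrite !alg_compE !slotE mtens_map_gen gv_upd.
by congr (wgen _ (upd _ _ _)); apply/ffunP => l; rewrite !ffunE lr1.
Qed.

Lemma fc_map i z : fc e' i (g z) = h (fc e i z).
Proof.
rewrite {1}(fb_span e z) lr_sum fc_sum (bigD1 i) //= big1 => [|j ji].
  by rewrite lrM ee' ghE fcM fb_dual eqxx mulr1 addr0.
by rewrite lrM ee' ghE fcM fb_dual eq_sym (negPf ji) mulr0.
Qed.

Lemma wdelta_map w : wdelta e' (mtens_map w) = h (wdelta e w).
Proof.
apply: (mtens_ext (P := R') (f := fun w => wdelta e' (mtens_map w))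
  (g := fun w => h (wdelta e w))) w => [a x y|a x y|c].
- by rewrite lrP wdelta_lin.
- by rewrite wdelta_lin lrP.
- rewrite mtens_map_gen /wdelta !(wev_gen _ _ (wdet_adm _ _)).
  rewrite /wdet -det_map_mx; congr (\det _); apply/matrixP => i j.
  by rewrite !mxE !ffunE -ee' -lrM fc_map.
Qed.

Lemma norm_aux_map (x : points T C) :
  norm_aux wnz' e' (g ∘ x) = h ∘ norm_aux wnz e x.
Proof.
apply: lrmorphism_ext => a; rewrite !alg_compE !sym_deltaE -wdelta_map.
congr wdelta.
rewrite -[LHS]/((sym_incl wnz' ∘ sprod wnz' (g ∘ x)) a) sprodK.
rewrite -[X in mtens_map X]/((sym_incl wnz ∘ sprod wnz x) a) sprodK.
rewrite -[RHS]/((mtens_map ∘ wprod wnz x) a) pt_prod_comp.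
apply: lr_congr; congr pt_prod; apply/funext => i.
by rewrite !alg_compA mtens_map_slot.
Qed.
End BaseChange.

Lemma mtens_nz (R C : comAlgType k) (rho : {lrmorphism R -> C}) m
  (e : free_basis rho m) :
  exists (P : lmodType k) (D : {ffun 'I_m -> C} -> P),
    wadm rho D /\ D (vone C m) <> 0.
Proof.
exists R, (wdet e (ebase e)); split; first exact: wdet_adm.
suff -> : wdet e (ebase e) (vone C m) = 1 by apply/eqP/oner_neq0.
rewrite -(vdet_base e); congr (\det _); apply/matrixP => i j.
by rewrite !mxE !ffunE mul1r.
Qed.

Definition norm (R C : comAlgType k) (rho : {lrmorphism R -> C}) m
  (e : free_basis rho m) (x : points T C) : points T R :=
  norm_aux (mtens_nz e) e x.

Lemma normM (R C : comAlgType k) (rho : {lrmorphism R -> C}) m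
  (e : free_basis rho m) (x y : points T C) : norm e (x · y) = norm e x · norm e y.
Proof. exact: norm_auxM. Qed.

Lemma norm_in (R C : comAlgType k) (rho : {lrmorphism R -> C}) m
  (e : free_basis rho m) (t : points T R) : norm e (rho ∘ t) = pt_exp t m.
Proof. exact: norm_aux_in. Qed.

Lemma norm_conj (R C : comAlgType k) (rho : {lrmorphism R -> C}) m
  (e : free_basis rho m) (G : affine_group k) (f : group_hom T G)
  (f_inj : forall S, injective (on_points f (R := S)))
  (g : points G R) (x x' : points T C) :
  on_points f x' = (rho ∘ g) · on_points f x · pt_inv (rho ∘ g) ->
  on_points f (norm e x') = g · on_points f (norm e x) · pt_inv g.
Proof. exact: norm_aux_conj. Qed.

Lemma norm_basis (R C : comAlgType k) (rho : {lrmorphism R -> C}) m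
  (e e' : free_basis rho m) (x : points T C) : norm e x = norm e' x.
Proof.
rewrite /norm (norm_aux_basis _ e e'); congr norm_aux.
exact: Prop_irrelevance.
Qed.

Lemma norm_map (R C R' C' : comAlgType k) (rho : {lrmorphism R -> C})
  (rho' : {lrmorphism R' -> C'}) (h : {lrmorphism R -> R'})
  (g : {lrmorphism C -> C'}) m (e : free_basis rho m) (e' : free_basis rho' m)
  (x : points T C) : g ∘ rho = rho' ∘ h -> (forall i, g (fb e i) = fb e' i) ->
  norm e' (g ∘ x) = h ∘ norm e x.
Proof. by move=> gh ee'; apply: (norm_aux_map gh ee'). Qed.

(** Transporting a basis by the automorphism g changes nothing, by [norm_map],
    and the norm does not depend on the basis. *)
Lemma norm_aut (R C : comAlgType k) (rho : {lrmorphism R -> C}) m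
  (e : free_basis rho m) (g g' : {lrmorphism C -> C}) (x : points T C) :
  g ∘ rho = rho -> cancel g g' -> cancel g' g -> norm e (g ∘ x) = norm e x.
Proof.
move=> gr gg' g'g.
have g'r r : g' (rho r) = rho r.
  by rewrite -[RHS]gg' -[g (rho _)]/((g ∘ rho) _) gr.
have cP i r (y z : C) :
    fc e i (g' (rho r * y + z)) = r * fc e i (g' y) + fc e i (g' z).
  by rewrite lrD lrM g'r fcP.
have sp (z : C) : z = \sum_i rho (fc e i (g' z)) * g (fb e i).
  rewrite -{1}(g'g z) {1}(fb_span e (g' z)) lr_sum; apply: eq_bigr => i _.
  by rewrite lrM -[g (rho _)]/((g ∘ rho) _) gr.
have du i j : fc e i (g' (g (fb e j))) = (i == j)%:R by rewrite gg' fb_dual.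
pose e' := FreeBasis cP sp du.
rewrite (norm_basis e e') -[RHS]alg_comp_id; apply: norm_map => //.
by rewrite alg_comp1.
Qed.

End Norm.

(** * Monoid algebras *)

(** The monoid algebra R[K] modulo the relations
    X^(src z) = wt z X^(tgt z). *)
Section MonoidAlgebra.
Variables (k : fieldType) (R : comAlgType k) (K : nmodType).
Variables (I : Type) (src tgt : I -> K) (wt : I -> R).

Definition madm (P : lmodType k) (D : R * K -> P) : Prop :=
  (forall c x x' l, D (c *: x + x', l) = c *: D (x, l) + D (x', l)) /\
  (forall z x l, D (x, src z + l) = D (wt z * x, tgt z + l)).

Definition mmul (a b : R * K) : R * K := (a.1 * b.1, a.2 + b.2).
Fact mmulA : associative mmul.
Proof. by move=> [a l] [b n] [c o]; rewrite /mmul /= mulrA addrA. Qed.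
Fact mmulC : commutative mmul.
Proof. by move=> [a l] [b n]; rewrite /mmul /= mulrC addrC. Qed.
Fact mmul1 : left_id (1, 0) mmul.
Proof. by move=> [a l]; rewrite /mmul /= mul1r add0r. Qed.
Fact madmM (P : lmodType k) (D : R * K -> P) x :
  madm D -> madm (fun y => D (mmul x y)).
Proof.
case: x => x n [D1 D2]; split=> [c a a' l|z a l]; rewrite /mmul /=.
  by rewrite mulrDr -scalerAr D1.
by rewrite addrCA D2 addrCA mulrCA.
Qed.

Hypothesis nz : exists (P : lmodType k) (D : R * K -> P), madm D /\ D (1, 0) <> 0.

Definition mon_pres := Presentation mmulA mmulC mmul1 madmM nz.
Definition monalg : comAlgType k := presented mon_pres.
Definition mgen x l : monalg := pgen (p := mon_pres) (x, l).

Lemma mgenM x l y n : mgen x l * mgen y n = mgen (x * y) (l + n).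
Proof. by rewrite /mgen -(pgenM (p := mon_pres)). Qed.
Lemma mgen_lin c x x' l : mgen (c *: x + x') l = c *: mgen x l + mgen x' l.
Proof. by apply: pgen_lin => P D [D1 _]; apply: D1. Qed.
Fact mgen0 l : mgen 0 l = 0.
Proof. by have := mgen_lin (-1) 0 0 l; rewrite scaler0 addr0 scaleN1r addNr. Qed.

Definition mbase : {lrmorphism R -> monalg}.
Proof.
apply: (@mk_lrmorphism _ R monalg (fun x => mgen x 0)) => [x y|x y||c x].
- by rewrite -[x in LHS]scale1r mgen_lin scale1r.
- by rewrite mgenM addr0.
- by [].
- by rewrite -[c *: x]addr0 mgen_lin mgen0 addr0.
Defined.
Definition mvar l : monalg := mgen 1 l.

Lemma mbaseE x : mbase x = mgen x 0. Proof. exact: mk_lrmorphismE. Qed.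
Lemma mgenE x l : mgen x l = mbase x * mvar l.
Proof. by rewrite mbaseE mgenM mulr1 add0r. Qed.
Lemma mvarD l n : mvar (l + n) = mvar l * mvar n.
Proof. by rewrite mgenM mulr1. Qed.
Lemma mvar0 : mvar 0 = 1. Proof. by []. Qed.
Lemma mvarMn l n : mvar (l *+ n) = mvar l ^+ n.
Proof. by elim: n => [|n IH]; rewrite ?expr0 ?mulr0n // exprS mulrS mvarD IH. Qed.
Lemma mvar_rel z : mvar (src z) = mbase (wt z) * mvar (tgt z).
Proof.
rewrite -mgenE /mvar -[src z]addr0 -[tgt z]addr0 -[wt z]mulr1.
by apply: pgen_eq => P D [_ D2]; apply: D2.
Qed.

Lemma monalg_ind (Q : monalg -> Prop) :
  Q 0 -> (forall x l z, Q z -> Q (mbase x * mvar l + z)) -> forall z, Q z.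
Proof.
move=> Q0 QD; apply: presented_ind => // c [x l] z Qz.
by rewrite -[pgen _]/(mgen x l) mgenE scalerAl -lrZ; apply: QD.
Qed.

Definition mev (P : lmodType k) (D : R * K -> P) : monalg -> P :=
  pev (p := mon_pres) D.
Lemma mevP (P : lmodType k) (D : R * K -> P) c x y :
  madm D -> mev D (c *: x + y) = c *: mev D x + mev D y.
Proof. by move=> aD; rewrite /mev (pevD (p := mon_pres)) // pevZ. Qed.
Lemma mevD (P : lmodType k) (D : R * K -> P) x y :
  madm D -> mev D (x + y) = mev D x + mev D y.
Proof. by move=> aD; rewrite -[x in LHS]scale1r mevP // scale1r. Qed.
Lemma mev0 (P : lmodType k) (D : R * K -> P) : madm D -> mev D 0 = 0.
Proof.
by move=> aD; have := mevP (-1) 0 0 aD; rewrite scaler0 addr0 scaleN1r addNr.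
Qed.
Lemma mevE (P : lmodType k) (D : R * K -> P) x l :
  madm D -> mev D (mbase x * mvar l) = D (x, l).
Proof. by move=> aD; rewrite -mgenE; apply: (pev_gen (p := mon_pres)). Qed.

Section MLift.
Variables (U : comAlgType k) (f : {lrmorphism R -> U}) (chi : K -> U).
Hypotheses (chiD : forall l n, chi (l + n) = chi l * chi n) (chi0 : chi 0 = 1).
Hypothesis chi_rel : forall z, chi (src z) = f (wt z) * chi (tgt z).

Let D (a : R * K) : U := f a.1 * chi a.2.
Fact mlift_adm : madm D.
Proof.
split=> [c x x' l|z x l]; rewrite /D /=.
  by rewrite lrP mulrDl scalerAl.
by rewrite !chiD chi_rel lrM; ring.
Qed.
Fact mliftM : {morph D : x y / mmul x y >-> x * y}.
Proof. by move=> [a l] [b n]; rewrite /D /= lrM chiD mulrACA. Qed.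
Fact mlift1 : D (1, 0) = 1.
Proof. by rewrite /D /= lr1 chi0 mulr1. Qed.

Definition mlift : {lrmorphism monalg -> U} :=
  plift (p := mon_pres) mlift_adm mliftM mlift1.
Lemma mlift_gen x l : mlift (mgen x l) = f x * chi l.
Proof. exact: plift_gen. Qed.
Lemma mlift_base : mlift ∘ mbase = f.
Proof.
by apply: lrmorphism_ext => x; rewrite alg_compE mbaseE mlift_gen chi0 mulr1.
Qed.
Lemma mlift_var l : mlift (mvar l) = chi l.
Proof. by rewrite mlift_gen lr1 mul1r. Qed.
End MLift.

End MonoidAlgebra.

(** ** Laurent polynomials *)

Section Laurent.
Variables (k : fieldType) (r : nat).
Implicit Types (R S : comAlgType k).
Local Notation K := {ffun 'I_r -> int}.

Definition lau_rel (V : Type) (z : void) : V := match z with end.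
Notation lau_adm := (@madm k _ K void (@lau_rel K) (@lau_rel K) (@lau_rel _)).

Definition lau_coef_fun R (l : K) (a : R * K) : R := if a.2 == l then a.1 else 0.
Fact lau_coef_adm R l : lau_adm (@lau_coef_fun R l).
Proof.
split=> [c x x' n|[]]; rewrite /lau_coef_fun /=.
by case: eqP => // _; rewrite scaler0 addr0.
Qed.
Fact lau_nz R : exists (P : lmodType k) (D : R * K -> P), lau_adm D /\ D (1, 0) <> 0.
Proof.
exists R, (lau_coef_fun 0); split; first exact: lau_coef_adm.
by rewrite /lau_coef_fun /= eqxx; apply/eqP/oner_neq0.
Qed.

Definition lau R : comAlgType k := monalg (lau_nz R).
Definition lau_base R : {lrmorphism R -> lau R} := mbase (lau_nz R).
Definition lau_var R (l : K) : lau R := mvar (lau_nz R) l.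
Definition lau_coef R l : lau R -> R := mev (lau_coef_fun l).

Lemma lau_ind R (Q : lau R -> Prop) : Q 0 ->
  (forall x l z, Q z -> Q (lau_base R x * lau_var R l + z)) -> forall z, Q z.
Proof. exact: monalg_ind. Qed.
Lemma lau_coefD R l x y :
  @lau_coef R l (x + y) = lau_coef l x + lau_coef l y.
Proof. exact/mevD/lau_coef_adm. Qed.
Lemma lau_coef0 R l : @lau_coef R l 0 = 0.
Proof. exact/mev0/lau_coef_adm. Qed.
Lemma lau_coefE R l x n :
  @lau_coef R l (lau_base R x * lau_var R n) = if n == l then x else 0.
Proof. exact/mevE/lau_coef_adm. Qed.
Lemma lau_coefM R l x z :
  @lau_coef R l (lau_base R x * z) = x * lau_coef l z.
Proof.
elim/lau_ind: z => [|a n z IH]; first by rewrite mulr0 lau_coef0 mulr0.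
rewrite mulrDr mulrA -lrM !lau_coefD IH !lau_coefE mulrDr.
by case: eqP => // _; rewrite mulr0.
Qed.

Definition lau_map R S (h : {lrmorphism R -> S}) (chi : K -> lau S)
  (chiD : forall l n, chi (l + n) = chi l * chi n) (chi0 : chi 0 = 1) :
  {lrmorphism lau R -> lau S} :=
  mlift (lau_nz R) (f := lau_base S ∘ h) chiD chi0 (fun z => match z with end).

Lemma lau_varD R l n : lau_var R (l + n) = lau_var R l * lau_var R n.
Proof. exact: mvarD. Qed.
Lemma lau_var0 R : lau_var R 0 = 1. Proof. by []. Qed.

Definition lau_ext R S (h : {lrmorphism R -> S}) : {lrmorphism lau R -> lau S} :=
  lau_map h (@lau_varD S) (lau_var0 S).
Lemma lau_ext_base R S (h : {lrmorphism R -> S}) :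
  lau_ext h ∘ lau_base R = lau_base S ∘ h.
Proof. exact: mlift_base. Qed.
Lemma lau_ext_var R S (h : {lrmorphism R -> S}) l :
  lau_ext h (lau_var R l) = lau_var S l.
Proof. exact: mlift_var. Qed.
Lemma lau_coef_ext R S (h : {lrmorphism R -> S}) l z :
  lau_coef l (lau_ext h z) = h (lau_coef l z).
Proof.
elim/lau_ind: z => [|a n z IH]; first by rewrite lr0 !lau_coef0 lr0.
rewrite lrD lrM !lau_coefD lrD IH; congr (_ + _).
rewrite lau_ext_var -[lau_ext h _]/((lau_ext h ∘ lau_base R) a) lau_ext_base.
by rewrite !lau_coefE; case: eqP => // _; rewrite lr0.
Qed.

Section Twist.
Variables (R : comAlgType k) (u : 'I_r -> R).
Hypothesis u_inv : forall j, invertible (u j).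
Let v j : R := sval (cid (u_inv j)).
Let uv j : u j * v j = 1. Proof. exact: svalP (cid (u_inv j)). Qed.

(** R has no inverse function, so that negative powers are those of a chosen
    inverse of u_j. *)
Definition upow (j : 'I_r) (n : int) : R :=
  match n with Posz n => u j ^+ n | Negz n => v j ^+ n.+1 end.
Lemma upowD j : {morph upow j : m n / m + n >-> m * n}.
Proof.
have S1 n : upow j (n + 1) = upow j n * u j.
  case: n => n; first by rewrite addrC -intS /= exprSr.
  case: n => [|n]; first by rewrite (_ : Negz 0 + 1 = 0) //= expr1 mulrC uv.
  rewrite (_ : Negz n.+1 + 1 = Negz n) /=; last first.
    by rewrite !NegzE intS opprD addrC addrA subrr add0r.
  by rewrite [RHS]mulrC [v j ^+ n.+2]exprS mulrA uv mul1r.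
have SN n : upow j (n - 1) = upow j n * v j.
  by rewrite -{2}[n](subrK 1) S1 -mulrA uv mulr1.
move=> m; elim/int_ind => [|n IH|n IH].
- by rewrite addr0 mulr1.
- by rewrite intS [1 + _]addrC addrA !S1 IH mulrA.
- by rewrite intS opprD [- 1 + _]addrC addrA !SN IH mulrA.
Qed.

Definition umon (l : K) : R := \prod_j upow j (l j).
Lemma umonD l n : umon (l + n) = umon l * umon n.
Proof.
by rewrite /umon -big_split; apply: eq_bigr => j _; rewrite ffunE upowD.
Qed.
Lemma umon0 : umon 0 = 1.
Proof. by rewrite /umon big1 // => j _; rewrite ffunE. Qed.

Let chi l := lau_base R (umon l) * lau_var R l.
Fact chiD l n : chi (l + n) = chi l * chi n.
Proof. by rewrite /chi umonD lrM lau_varD mulrACA. Qed.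
Fact chi0 : chi 0 = 1.
Proof. by rewrite /chi umon0 lr1 lau_var0 mulr1. Qed.

(** The translation t_j |-> u_j t_j of the coordinates. *)
Definition lau_twist : {lrmorphism lau R -> lau R} := lau_map (lr_id R) chiD chi0.
Lemma lau_twist_base : lau_twist ∘ lau_base R = lau_base R.
Proof. by rewrite [LHS]mlift_base alg_comp1. Qed.
Lemma lau_twist_var l : lau_twist (lau_var R l) = lau_base R (umon l) * lau_var R l.
Proof. exact: mlift_var. Qed.
Lemma lau_coef_twist l z : lau_coef l (lau_twist z) = umon l * lau_coef l z.
Proof.
elim/lau_ind: z => [|a n z IH]; first by rewrite lr0 !lau_coef0 mulr0.
rewrite lrD lrM !lau_coefD mulrDr IH; congr (_ + _).
rewrite lau_twist_var -[lau_twist _]/((lau_twist ∘ lau_base R) a) lau_twist_base.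
rewrite mulrA -lrM !lau_coefE; case: eqP => [->|_]; last by rewrite mulr0.
exact: mulrC.
Qed.
End Twist.

Definition unit_exp (j : 'I_r) : K := [ffun l => (l == j)%:R].
Lemma umon_unit R (u : 'I_r -> R) (ui : forall j, invertible (u j)) j :
  umon ui (unit_exp j) = u j.
Proof.
rewrite /umon (bigD1 j) //= big1 => [|l lj]; rewrite ffunE.
  by rewrite eqxx /= expr1 mulr1.
by rewrite (negPf lj).
Qed.
Lemma lau_var_inv R j : invertible (lau_var R (unit_exp j)).
Proof.
by exists (lau_var R (- unit_exp j)); rewrite -lau_varD subrr lau_var0.
Qed.
End Laurent.

(** ** Kummer algebras *)

(** B[t_1, ..., t_r] / (t_j^m - w_j).  The relations are imposed for all
    monomials t^(m z) at once, so that the coefficients with respect to the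
    basis of monomials with exponents less than m are visibly well defined. *)
Section Kummer.
Variables (k : fieldType) (r m : nat) (B : comAlgType k) (w : 'I_r -> B).
Hypothesis m_gt0 : (0 < m)%N.
Hypothesis w_inv : forall j, invertible (w j).
Local Notation K := {ffun 'I_r -> nat}.

Definition wmon (n : K) : B := \prod_j w j ^+ n j.
Lemma wmonD l n : wmon (l + n) = wmon l * wmon n.
Proof. by rewrite /wmon -big_split; apply: eq_bigr => j _; rewrite ffunE exprD. Qed.
Lemma wmon0 : wmon 0 = 1.
Proof. by rewrite /wmon big1 // => j _; rewrite ffunE. Qed.

Definition kum_src (n : K) : K := [ffun j => (m * n j)%N].
Definition kum_tgt (n : K) : K := 0.
Notation kum_adm := (madm kum_src kum_tgt wmon).

Definition kmod (n : K) : {ffun 'I_r -> 'I_m} :=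
  [ffun j => Ordinal (ltn_pmod (n j) m_gt0)].
Definition kdiv (n : K) : K := [ffun j => (n j %/ m)%N].
Definition kval (l : {ffun 'I_r -> 'I_m}) : K := [ffun j => val (l j)].

Lemma kmodE n : n = kum_src (kdiv n) + kval (kmod n).
Proof. by apply/ffunP => j; rewrite !ffunE /= mulnC; apply: divn_eq. Qed.

Definition kum_coef_fun l (a : B * K) : B :=
  if kmod a.2 == l then a.1 * wmon (kdiv a.2) else 0.

Fact kum_coef_adm l : kum_adm (kum_coef_fun l).
Proof.
split=> [c x x' n|z x n]; rewrite /kum_coef_fun /=.
  by case: eqP => _; rewrite ?scaler0 ?addr0 // mulrDl scalerAl.
rewrite add0r (_ : kmod (kum_src z + n) = kmod n).
  case: eqP => // _; rewrite [wmon z * x]mulrC -mulrA -wmonD.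
  congr (_ * wmon _); apply/ffunP => j.
  by rewrite !ffunE mulnC; apply: divnMDl.
apply/ffunP => j; apply/val_inj; rewrite !ffunE /=.
by rewrite mulnC; apply: modnMDl.
Qed.

Fact kum_nz : exists (P : lmodType k) (D : B * K -> P), kum_adm D /\ D (1, 0) <> 0.
Proof.
exists B, (kum_coef_fun (kmod 0)); split; first exact: kum_coef_adm.
rewrite /kum_coef_fun /= eqxx (_ : kdiv 0 = 0) ?wmon0 ?mulr1.
  exact/eqP/oner_neq0.
by apply/ffunP => j; rewrite !ffunE; apply: div0n.
Qed.

Definition kum : comAlgType k := monalg kum_nz.
Definition kum_base : {lrmorphism B -> kum} := mbase kum_nz.
Definition kum_mon (l : K) : kum := mvar kum_nz l.
Definition kum_coef l : kum -> B := mev (kum_coef_fun l).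

Lemma kum_coefD l x y : kum_coef l (x + y) = kum_coef l x + kum_coef l y.
Proof. exact/mevD/kum_coef_adm. Qed.
Lemma kum_coef0 l : kum_coef l 0 = 0.
Proof. exact/mev0/kum_coef_adm. Qed.
Lemma kum_ind (Q : kum -> Prop) : Q 0 ->
  (forall x l z, Q z -> Q (kum_base x * kum_mon l + z)) -> forall z, Q z.
Proof. exact: monalg_ind. Qed.
Lemma kum_coefE l x n :
  kum_coef l (kum_base x * kum_mon n) = if kmod n == l then x * wmon (kdiv n) else 0.
Proof. exact/mevE/kum_coef_adm. Qed.
Lemma kum_coefM l x z : kum_coef l (kum_base x * z) = x * kum_coef l z.
Proof.
elim/kum_ind: z => [|a n z IH]; first by rewrite mulr0 kum_coef0 mulr0.
rewrite mulrDr mulrA -lrM !kum_coefD IH !kum_coefE mulrDr.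
by case: eqP => // _; rewrite ?mulr0 // mulrA.
Qed.

Lemma kum_span z :
  z = \sum_(l : {ffun 'I_r -> 'I_m}) kum_base (kum_coef l z) * kum_mon (kval l).
Proof.
elim/kum_ind: z => [|x n z IH].
  by rewrite big1 // => l _; rewrite kum_coef0 lr0 mul0r.
under eq_bigr do rewrite kum_coefD lrD mulrDl.
rewrite big_split /= -IH; congr (_ + _).
rewrite (bigD1 (kmod n)) //= big1 => [|l /negPf ln]; last first.
  by rewrite kum_coefE eq_sym ln lr0 mul0r.
rewrite addr0 kum_coefE eqxx lrM -mulrA; congr (_ * _).
rewrite {1}(kmodE n) [LHS]mvarD; congr (_ * _).
by rewrite mvar_rel mvar0 mulr1.
Qed.

Lemma kum_coef1 : kum_coef (kmod 0) 1 = 1.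
Proof.
rewrite -[X in kum_coef _ X]mulr1 -{1}(lr1 kum_base) -[X in _ * X](mvar0 kum_nz).
rewrite kum_coefE eqxx (_ : kdiv 0 = 0) ?wmon0 ?mulr1 //.
by apply/ffunP => j; rewrite !ffunE; apply: div0n.
Qed.

Definition kum_unit (j : 'I_r) : K := [ffun l => (l == j)%N : nat].
Definition kum_root j : kum := kum_mon (kum_unit j).

Lemma kum_rootX j : kum_root j ^+ m = kum_base (w j).
Proof.
have -> : kum_root j ^+ m = kum_mon (kum_src (kum_unit j)).
  have -> : kum_src (kum_unit j) = kum_unit j *+ m.
    apply/ffunP => l; rewrite ffunMnE !ffunE.
    by rewrite -[RHS]mulr_natr mulrC natn.
  by rewrite [RHS]mvarMn.
rewrite /kum_mon mvar_rel mvar0 mulr1; congr (mbase _ _).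
rewrite /wmon (bigD1 j) //= big1 => [|l /negPf lj]; rewrite ffunE.
  by rewrite eqxx expr1 mulr1.
by rewrite lj expr0.
Qed.

Lemma kum_root_inv j : invertible (kum_root j).
Proof.
have [v wv] := w_inv j; exists (kum_root j ^+ m.-1 * kum_base v).
by rewrite mulrA -exprS prednK // kum_rootX -lrM wv lr1.
Qed.

Section KumLift.
Variables (U : comAlgType k) (f : {lrmorphism B -> U}) (u : 'I_r -> U).
Hypothesis uX : forall j, u j ^+ m = f (w j).

Let chi (l : K) : U := \prod_j u j ^+ l j.
Fact kum_chiD l n : chi (l + n) = chi l * chi n.
Proof. by rewrite /chi -big_split; apply: eq_bigr => j _; rewrite ffunE exprD. Qed.
Fact kum_chi0 : chi 0 = 1.
Proof. by rewrite /chi big1 // => j _; rewrite ffunE. Qed.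
Fact kum_chi_rel z : chi (kum_src z) = f (wmon z) * chi (kum_tgt z).
Proof.
rewrite kum_chi0 mulr1 (rmorph_prod f) /=; apply: eq_bigr => j _.
by rewrite ffunE exprM uX rmorphXn.
Qed.

Definition kum_lift : {lrmorphism kum -> U} :=
  mlift kum_nz kum_chiD kum_chi0 kum_chi_rel.
Lemma kum_lift_base : kum_lift ∘ kum_base = f.
Proof. exact: mlift_base. Qed.
Lemma kum_lift_root j : kum_lift (kum_root j) = u j.
Proof.
rewrite [LHS]mlift_var /chi (bigD1 j) //= big1 => [|l /negPf lj]; rewrite ffunE.
  by rewrite eqxx expr1 mulr1.
by rewrite lj expr0.
Qed.
End KumLift.
End Kummer.

(** * Finding a unit *)

(** A linear relation between the powers of b, divided by its lowest nonzero
    coefficient, gives b^N = b^(N+1) c for some c; then b^N c^N is the idempotent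
    of the Fitting decomposition, and b is nilpotent on its complement. *)
Lemma fitting (k : fieldType) (B : comAlgType k) n (eB : kbasis B n) (b : B) :
  exists c N, b * c * (b * c) = b * c /\ (1 - b * c) * b ^+ N = 0.
Proof.
pose A : 'M[k]_(n.+1, n) := \matrix_(i, j) kc eB j (b ^+ i).
have /rowV0Pn [v /sub_kermxP vA v0] : kermx A != 0.
  rewrite kermx_eq0 /row_free neq_ltn (leq_ltn_trans (rank_leq_col A)) //.
have vb : \sum_(i < n.+1) v 0 i *: b ^+ i = 0.
  rewrite (kb_span eB (\sum_i _)) big1 // => j _.
  have -> : kc eB j (\sum_i v 0 i *: b ^+ i) = 0.
    transitivity ((v *m A) 0 j); last by rewrite vA mxE.
    by rewrite kc_sum mxE; apply: eq_bigr => i _; rewrite mxE kcZ.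
  by rewrite scale0r.
have [i0 vi0] : exists i, v 0 i != 0.
  apply/existsP; apply: contraNT v0; rewrite negb_exists => /forallP h.
  by apply/eqP/rowP => j; rewrite mxE; apply/eqP; have := h j; rewrite negbK.
have [N vN minN] : exists2 N : 'I_n.+1, v 0 N != 0 &
    forall i : 'I_n.+1, (i < N)%N -> v 0 i = 0.
  case: (@arg_minnP _ i0 (fun i => v 0 i != 0) (fun i : 'I_n.+1 => val i) vi0)
    => N vN minN.
  exists N => // i; apply: contraTeq => vi; rewrite -leqNgt; exact: minN.
pose c := - \sum_(i < n.+1 | (N < i)%N) ((v 0 N)^-1 * v 0 i) *: b ^+ (i - N.+1).
have bN : b ^+ N = b ^+ N.+1 * c.
  have : (v 0 N)^-1 *: (\sum_(i < n.+1) v 0 i *: b ^+ i) = 0 by rewrite vb scaler0.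
  rewrite (bigD1 N) //= scalerDr scalerA mulVf // scale1r => /eqP.
  rewrite addr_eq0 => /eqP ->; rewrite mulrN mulr_sumr scaler_sumr; congr (- _).
  rewrite (bigID (fun i : 'I_n.+1 => (N < i)%N)) /= [X in _ + X]big1 => [|i].
    rewrite addr0; apply: eq_big => [i|i /andP [_ Ni]].
      by rewrite -(inj_eq val_inj) /=; case: ltngtP.
    by rewrite scalerA -scalerAr -exprD subnKC.
  rewrite -leqNgt => /andP [iN iN'].
  have ltiN : (i < N)%N by rewrite ltn_neqAle iN' andbT.
  by rewrite (minN _ ltiN) scale0r scaler0.
have bM : b ^+ N.+1 = b ^+ N.+2 * c by rewrite exprS {1}bN mulrA -exprS.
have step l : b ^+ N.+1 = b ^+ (N.+1 + l) * c ^+ l.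
  elim: l => [|l IH]; first by rewrite addn0 expr0 mulr1.
  by rewrite {1}IH exprD {1}bM addnS -addSn exprD [c ^+ l.+1]exprS; ring.
pose e := b ^+ N.+1 * c ^+ N.+1.
have eE : b * (b ^+ N * c ^+ N.+1) = e by rewrite mulrA -exprS.
exists (b ^+ N * c ^+ N.+1), N.+1; rewrite eE.
have eb : e * b ^+ N.+1 = b ^+ N.+1.
  by rewrite /e mulrAC -exprD -(step N.+1).
split; last by rewrite mulrBl mul1r eb subrr.
by rewrite {2}/e mulrA eb.
Qed.

Lemma nil_sum (P : comNzRingType) (u : P) (I : Type) (s : seq I) (b : I -> P) :
  (forall i, List.In i s -> exists N, u * b i ^+ N = 0) ->
  exists N, u * (\sum_(i <- s) b i) ^+ N.+1 = 0.
Proof.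
elim: s => [|i s IHs] ub; first by exists 0%N; rewrite big_nil expr1 mulr0.
have [|N IH] := IHs; first by move=> j js; apply: ub; right.
have [M uM] := ub i (or_introl erefl); exists (M + N.+1)%N; rewrite big_cons.
rewrite exprDn mulr_sumr big1 // => -[l /= _] _.
rewrite mulrnAr; suff -> : u * (b i ^+ ((M + N.+1).+1 - l) *
    (\sum_(j <- s) b j) ^+ l) = 0 by rewrite mul0rn.
have [lN|lN] := leqP l N.+1.
  have Ml : (M <= (M + N.+1).+1 - l)%N by lia.
  by rewrite -(subnKC Ml) exprD !mulrA uM !mul0r.
have swap x y z : u * (x * (y * z)) = u * y * (x * z) by ring.
by rewrite -(subnKC (ltnW lN)) exprD swap IH mul0r.
Qed.

Section UnitOfWeight.
Variables (k : fieldType) (B P : comAlgType k) (h : {lrmorphism B -> P}).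
Variables (n : nat) (eB : kbasis B n) (Wp Wn : P -> Prop).
Hypotheses (Wp0 : Wp 0) (Wn0 : Wn 0).
Hypotheses (WpD : forall x y, Wp x -> Wp y -> Wp (x + y)).
Hypotheses (WnD : forall x y, Wn x -> Wn y -> Wn (x + y)).
Hypotheses (WpM : forall b x, Wp x -> Wp (h b * x)).
Hypotheses (WnM : forall b x, Wn x -> Wn (h b * x)).
Hypothesis W0 : forall x y, Wp x -> Wn y -> exists b, h b = x * y.

Definition split_idem (e : P) :=
  e * e = e /\ exists x y, [/\ Wp x, Wn y & x * y = e].

Lemma split_idem_join e f : split_idem e -> split_idem f ->
  split_idem (e + f - e * f).
Proof.
move=> [ee [x [y [wx wy xy]]]] [ff [x' [y' [wx' wy' xy']]]].
split; first by ring: ee ff.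
have [b hb] := W0 wx wy.
exists (h b * x + h (1 - b) * x'), (h b * y + h (1 - b) * y'); split.
- by apply: WpD; apply: WpM.
- by apply: WnD; apply: WnM.
rewrite lrD rmorphN /= lr1 hb xy; ring: ee ff xy xy'.
Qed.

(** For each of the products x y take the Fitting idempotent e, a multiple of
    x y and hence itself of the form x y'.  Such idempotents are closed under
    joins by [split_idem_join].  On the complement of the join of all of them
    every x y is nilpotent, hence so is their sum 1: the join is 1. *)
Lemma unit_of_weight (s : seq (P * P)) :
  (forall a, List.In a s -> Wp a.1 /\ Wn a.2) ->
  \sum_(a <- s) a.1 * a.2 = 1 -> exists x y, [/\ Wp x, Wn y & x * y = 1].
Proof.
move=> sW s1.
have [e [se es]] : exists e, split_idem e /\
    forall a, List.In a s -> exists N, (1 - e) * (a.1 * a.2) ^+ N = 0.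
  elim: s sW {s1} => [|a s IH] sW.
    exists 0; split=> //; split; first by rewrite mulr0.
    by exists 0, 0; rewrite mulr0.
  have [|e [se es]] := IH; first by move=> b bs; apply: sW; right.
  have [wx wy] := sW a (or_introl erefl).
  have [b hb] := W0 wx wy; have [c [N [cc cN]]] := fitting eB b.
  have hbc : h (b * c) = a.1 * (h c * a.2) by rewrite lrM hb; ring.
  have sc : split_idem (h (b * c)).
    split; first by rewrite -lrM cc.
    by exists a.1, (h c * a.2); split=> //; apply: WnM.
  exists (e + h (b * c) - e * h (b * c)); split; first exact: split_idem_join.
  have -> : 1 - (e + h (b * c) - e * h (b * c)) = (1 - e) * (1 - h (b * c)) by ring.
  move=> a' [<-|/es [M eM]].
    exists N; rewrite -mulrA -hb (_ : 1 - h _ = h (1 - b * c)).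
      by rewrite -(rmorphXn h) -lrM cN lr0 mulr0.
    by rewrite rmorphB /= lr1.
  by exists M; rewrite mulrAC eM mul0r.
have [K uK] := nil_sum es.
have e1 : e = 1 by move: uK; rewrite s1 expr1n mulr1 => /eqP; rewrite subr_eq0 => /eqP.
by case: se => _ [x [y]]; rewrite e1; exists x, y.
Qed.
End UnitOfWeight.

(** * Split tori *)

Section SplitTorus.
Variables (k : fieldType) (T : affine_group k) (L : comAlgType k).
Implicit Types (R S : comAlgType k).
Variable r : nat.

(** The data of [split_over], for a fixed rank r. *)
Record splitting := Splitting {
  chr : forall R : comAlgType k, {lrmorphism L -> R} -> points T R -> 'I_r -> R;
  chr_nat : forall (R S : comAlgType k) (s : {lrmorphism L -> R})
    (phi : {lrmorphism R -> S}) (x : points T R) (j : 'I_r),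
    chr (phi ∘ s) (phi ∘ x) j = phi (chr s x j);
  chrM : forall (R : comAlgType k) (s : {lrmorphism L -> R}) (x y : points T R)
    (j : 'I_r), chr s (x · y) j = chr s x j * chr s y j;
  chr_inv : forall (R : comAlgType k) (s : {lrmorphism L -> R}) (x : points T R)
    (j : 'I_r), invertible (chr s x j);
  chr_ex : forall (R : comAlgType k) (s : {lrmorphism L -> R}) (u : 'I_r -> R),
    (forall j, invertible (u j)) ->
    exists! x : points T R, forall j, chr s x j = u j
}.

Variable X : splitting.

Lemma chr_inj R (s : {lrmorphism L -> R}) (x y : points T R) :
  (forall j, chr X s x j = chr X s y j) -> x = y.
Proof.
move=> xy; have [z [_ uz]] := chr_ex X s (chr_inv X s y).
by rewrite -(uz x xy) -(uz y).
Qed.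

Lemma chr_pt R (s : {lrmorphism L -> R}) (u : 'I_r -> R) :
  (forall j, invertible (u j)) -> exists x : points T R, forall j, chr X s x j = u j.
Proof. by move=> /(chr_ex X s) [x [xu _]]; exists x. Qed.

Lemma chr1 R (s : {lrmorphism L -> R}) j : chr X s (pt_one T R) j = 1.
Proof.
have [v uv] := chr_inv X s (pt_one T R) j.
have := chrM X s (pt_one T R) (pt_one T R) j; rewrite pt1l => /(congr1 ( *%R v)).
by rewrite mulrA [v * _]mulrC uv mul1r.
Qed.

Lemma chrV R (s : {lrmorphism L -> R}) x j :
  chr X s (pt_inv x) j * chr X s x j = 1.
Proof. by rewrite -chrM ptVl chr1. Qed.

Lemma chr_exp R (s : {lrmorphism L -> R}) (x : points T R) m j :
  chr X s (pt_exp x m) j = chr X s x j ^+ m.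
Proof.
elim: m => [|m IH]; first by rewrite expr0; apply: chr1.
by rewrite exprS -IH -chrM.
Qed.

Lemma split_comm d (eL : kbasis L d) R (x y : points T R) : x · y = y · x.
Proof.
apply: (comp_inj (tkl_inj eL)); apply: (chr_inj (s := tkr eL R)) => j.
by rewrite !compM !chrM mulrC.
Qed.

End SplitTorus.

Lemma split_over_splitting (k : fieldType) (T : affine_group k)
  (L : comAlgType k) : split_over T L -> exists r, inhabited (splitting T L r).
Proof. by move=> [r [f [f1 f2 f3 f4]]]; exists r; constructor; exists f. Qed.

Lemma factor_inj (k : fieldType) (A B P : comAlgType k) (f : {lrmorphism A -> P})
  (h : {lrmorphism B -> P}) : injective h -> (forall a, exists b, h b = f a) ->
  exists g : {lrmorphism A -> B}, h ∘ g = f.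
Proof.
move=> hI hf; pose g a := sval (cid (hf a)).
have gE a : h (g a) = f a by exact: svalP (cid (hf a)).
have gD x y : g (x + y) = g x + g y by apply: hI; rewrite lrD !gE lrD.
have gM x y : g (x * y) = g x * g y by apply: hI; rewrite lrM !gE lrM.
have g1 : g 1 = 1 by apply: hI; rewrite gE !lr1.
have gZ c x : g (c *: x) = c *: g x by apply: hI; rewrite lrZ !gE lrZ.
exists (mk_lrmorphism gD gM g1 gZ).
by apply: lrmorphism_ext => a; rewrite alg_compE mk_lrmorphismE gE.
Qed.

(** * Torsors under a split torus over a finite scheme *)

Section TorsorSection.
Variables (k : fieldType) (T G F : affine_group k).
Variables (i : group_hom T G) (q : group_hom G F).
Hypothesis hiq : short_exact i q.
Variables (n d : nat) (L : comAlgType k).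
Variables (eF : kbasis (reg F) n) (eL : kbasis L d).
Variables (r : nat) (X : splitting T L r).
Implicit Types (R S : comAlgType k).

Lemma i_inj R : injective (on_points i (R := R)).
Proof. by case: hiq => ci _ _; apply: closed_subgroup_inj. Qed.

Lemma q_i R (t : points T R) : on_points q (on_points i t) = pt_one F R.
Proof. by case: hiq => _ ker _; apply/ker; exists t. Qed.

Lemma q_ker R (g h : points G R) : on_points q g = on_points q h ->
  exists t : points T R, on_points i t = g · pt_inv h.
Proof.
by case: hiq => _ ker _ e; apply/ker; rewrite on_pointsM on_pointsV e ptVr.
Qed.

Let Tcomm R (x y : points T R) : x · y = y · x.
Proof. exact: (split_comm X eL). Qed.

Let P := tensk eL (reg G).
Let B := tensk eL (reg F).
Let gam : points G P := tkl eL (reg G).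
Let sP : {lrmorphism L -> P} := tkr eL (reg G).
Let phi : {lrmorphism B -> P} := tkmap eL (comorphism q).
Let ev R (g : points G R) (s : {lrmorphism L -> R}) : {lrmorphism P -> R} :=
  tklift eL g s.

Let ev_gam R (g : points G R) s : ev g s ∘ gam = g.
Proof. exact: tklift_l. Qed.
Let ev_sP R (g : points G R) s : ev g s ∘ sP = s.
Proof. exact: tklift_r. Qed.
Let ev_comp R S (h : {lrmorphism R -> S}) (g : points G R) s :
  h ∘ ev g s = ev (h ∘ g) (h ∘ s).
Proof.
by apply: tensk_ext; rewrite -!alg_compA ?tklift_l ?tklift_r.
Qed.
Let ev_compE R S (h : {lrmorphism R -> S}) (g : points G R) s a :
  h (ev g s a) = ev (h ∘ g) (h ∘ s) a.
Proof. by rewrite -ev_comp. Qed.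
Let ev_id : ev gam sP = lr_id P.
Proof. by apply: tensk_ext; rewrite ?tklift_l ?tklift_r alg_comp_id. Qed.

Let phi_inj : injective phi.
Proof.
case: hiq => _ _ ff x y e; rewrite [x](tkc_span eL) [y](tkc_span eL).
apply: eq_bigr => j _; congr (tkl _ _ _ * _).
by apply: (faithfully_flat_inj ff); have := congr1 (tkc eL j) e; rewrite !tkc_map.
Qed.

Local Notation mon s x := (umon (chr_inv X s x)).

(** Functions a on G over L with a(t g) = t^l a(g). *)
Definition weight (l : {ffun 'I_r -> int}) (a : P) : Prop :=
  forall R (s : {lrmorphism L -> R}) (x : points T R) (g : points G R),
    ev (on_points i x · g) s a = mon s x l * ev g s a.

Let weight_eq R (g g' : points G R) s a : weight 0 a ->
  on_points q g = on_points q g' -> ev g s a = ev g' s a.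
Proof.
move=> wa /q_ker [t it]; have := wa R s t g'.
by rewrite it ptKVr umon0 mul1r.
Qed.

(** T-invariant functions descend to F, coordinate by coordinate in a basis of
    L over k. *)
Lemma weight0_base a : weight 0 a -> exists b, phi b = a.
Proof.
move=> wa; have cb j : exists b, comorphism q b = tkc eL j a.
  case: hiq => _ _ ff; apply: (faithfully_flat_descent ff) => R g g' qgg'.
  have e : ev (tkl eL R ∘ g) (tkr eL R) a = ev (tkl eL R ∘ g') (tkr eL R) a.
    apply: weight_eq => //; rewrite !on_points_comp; congr alg_comp.
    by rewrite /on_points qgg'.
  by have := congr1 (tkc eL j) e; rewrite !tkc_map.
exists (\sum_j tkl eL (reg F) (sval (cid (cb j))) * tkr eL (reg F) (kb eL j)).
rewrite lr_sum [RHS](tkc_span eL); apply: eq_bigr => j _.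
by rewrite lrM tklift_lE tklift_rE /= (svalP (cid (cb j))).
Qed.

Lemma weight0_phi b : weight 0 (phi b).
Proof.
move=> R s x g; rewrite umon0 mul1r.
apply: (lr_congr (f := _ ∘ phi) (g := _ ∘ phi)).
apply: tensk_ext; rewrite -!alg_compA ?tkmap_r ?tklift_r //.
rewrite tkmap_l !alg_compA !ev_gam.
by rewrite -![_ ∘ comorphism q]/(on_points q _) on_pointsM q_i pt1l.
Qed.

Lemma weightD l a b : weight l a -> weight l b -> weight l (a + b).
Proof. by move=> wa wb R s x g; rewrite !lrD wa wb mulrDr. Qed.
Lemma weight_0 l : weight l 0.
Proof. by move=> R s x g; rewrite !lr0 mulr0. Qed.
Lemma weightM l l' a b : weight l a -> weight l' b -> weight (l + l') (a * b).
Proof. by move=> wa wb R s x g; rewrite !lrM wa wb umonD mulrACA. Qed.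

Let bs R (s : {lrmorphism L -> R}) : {lrmorphism L -> lau r R} :=
  lau_base r R ∘ s.

(** The generic point of the torus, with coordinates the variables of the
    Laurent ring. *)
Definition tau R (s : {lrmorphism L -> R}) : points T (lau r R) :=
  sval (cid (chr_pt X (bs s) (fun j => lau_var_inv R j))).
Lemma tauE R (s : {lrmorphism L -> R}) j :
  chr X (bs s) (tau s) j = lau_var R (unit_exp j).
Proof. exact: (svalP (cid (chr_pt X (bs s) (fun j => lau_var_inv R j)))). Qed.

Lemma tau_ext R S (h : {lrmorphism R -> S}) (s : {lrmorphism L -> R}) :
  lau_ext r h ∘ tau s = tau (h ∘ s).
Proof.
apply: (chr_inj (X := X) (s := bs (h ∘ s))) => j; rewrite tauE.
have -> : bs (h ∘ s) = lau_ext r h ∘ bs s.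
  by rewrite /bs !alg_compA lau_ext_base.
by rewrite chr_nat tauE lau_ext_var.
Qed.

Lemma tau_twist R (s : {lrmorphism L -> R}) (x : points T R) :
  lau_twist (chr_inv X s x) ∘ tau s = tau s · (lau_base r R ∘ x).
Proof.
apply: (chr_inj (X := X) (s := bs s)) => j; rewrite chrM tauE.
have {1}-> : bs s = lau_twist (chr_inv X s x) ∘ bs s.
  by rewrite /bs !alg_compA lau_twist_base.
rewrite chr_nat tauE lau_twist_var umon_unit -[X in _ = _ * X]/(chr X (_ ∘ _) _ _).
by rewrite chr_nat mulrC.
Qed.

(** The component of weight l of a: the coefficient of t^l in a(t g). *)
Definition proj (l : {ffun 'I_r -> int}) (a : P) : P :=
  lau_coef l (ev (on_points i (tau sP) · (lau_base r P ∘ gam)) (bs sP) a).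

Lemma proj_ev R (g : points G R) (s : {lrmorphism L -> R}) l a :
  ev g s (proj l a) =
  lau_coef l (ev (on_points i (tau s) · (lau_base r R ∘ g)) (bs s) a).
Proof.
rewrite /proj -lau_coef_ext ev_compE; congr (lau_coef _ (ev _ _ _)).
  rewrite compM -on_points_comp tau_ext alg_compA lau_ext_base -alg_compA.
  by rewrite ev_gam ev_sP.
by rewrite /bs !alg_compA lau_ext_base -alg_compA ev_sP.
Qed.

Lemma proj_weight l a : weight l (proj l a).
Proof.
move=> R s x g; rewrite !proj_ev -lau_coef_twist ev_compE.
congr (lau_coef _ (ev _ _ _)); last by rewrite /bs !alg_compA lau_twist_base.
rewrite !compM -!on_points_comp tau_twist on_pointsM !ptA alg_compA.
by rewrite lau_twist_base.
Qed.

(* P2 is the ring of functions on G x_F G over L, with its two projections to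
   G. *)
Let P2 := tens (self_tens_nz phi).
Let p1 : {lrmorphism P -> P2} := tl (self_tens_nz phi).
Let p2 : {lrmorphism P -> P2} := tr (self_tens_nz phi).
Let p12 : p1 ∘ phi = p2 ∘ phi.
Proof. by apply: lrmorphism_ext => b; rewrite !alg_compE /p1 tlr. Qed.
Let g1 : points G P2 := p1 ∘ gam.
Let g2 : points G P2 := p2 ∘ gam.
Let s2 : {lrmorphism L -> P2} := p1 ∘ sP.
Let s2E : s2 = p2 ∘ sP.
Proof.
have e : sP = phi ∘ tkr eL (reg F) by rewrite tkmap_r.
by rewrite /s2 {1}e alg_compA p12 -alg_compA -e.
Qed.
Let ev_p1 : ev g1 s2 = p1.
Proof. by rewrite -ev_comp ev_id alg_comp1. Qed.
Let ev_p2 : ev g2 s2 = p2.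
Proof. by rewrite s2E -ev_comp ev_id alg_comp1. Qed.

Let gam_phi : gam ∘ comorphism q = phi ∘ tkl eL (reg F).
Proof. by rewrite tkmap_l. Qed.

Let q12 : on_points q g1 = on_points q g2.
Proof.
by rewrite !on_points_comp /on_points gam_phi !alg_compA p12.
Qed.

Let t12 : points T P2 := sval (cid (q_ker q12)).
Let t12E : on_points i t12 = g1 · pt_inv g2.
Proof. exact: svalP (cid (q_ker q12)). Qed.

Let ev2 R (g g' : points G R) (s : {lrmorphism L -> R})
  (e : on_points q g = on_points q g') : {lrmorphism P2 -> R}.
Proof.
refine (@tlift _ _ _ _ _ _ (self_tens_nz phi) R (ev g s) (ev g' s) _) => b.
apply: (lr_congr (f := _ ∘ phi) (g := _ ∘ phi)).
apply: tensk_ext; rewrite -!alg_compA ?tkmap_r ?tklift_r //.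
by rewrite tkmap_l !alg_compA !ev_gam.
Defined.

Let ev2_1 R (g g' : points G R) s (e : on_points q g = on_points q g') :
  ev2 s e ∘ p1 = ev g s.
Proof. exact: tlift_l. Qed.
Let ev2_2 R (g g' : points G R) s (e : on_points q g = on_points q g') :
  ev2 s e ∘ p2 = ev g' s.
Proof. exact: tlift_r. Qed.

Let ev2_chr R (g g' : points G R) s (e : on_points q g = on_points q g') t j :
  on_points i t = g · pt_inv g' ->
  ev2 s e (chr X s2 t12 j) = chr X s t j.
Proof.
move=> it; rewrite -chr_nat /s2 alg_compA ev2_1 ev_sP; congr chr.
apply: i_inj; rewrite on_points_comp t12E it compM compV !alg_compA.
by rewrite ev2_1 ev2_2 !ev_gam.
Qed.

Section Character.
Variable j : 'I_r.
Let ej : {ffun 'I_r -> int} := unit_exp j.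
Let v := chr X s2 t12 j.

Let tauG := on_points i (tau s2).
Let b1 := lau_base r P2 ∘ g1.
Let b2 := lau_base r P2 ∘ g2.

Let q_left : on_points q (tauG · b1) = on_points q b2.
Proof. by rewrite on_pointsM q_i pt1l (on_points_comp q _ g1) q12 -on_points_comp. Qed.
Let q_right : on_points q b1 = on_points q (tauG · b2).
Proof. by rewrite on_pointsM q_i pt1l (on_points_comp q _ g1) q12 -on_points_comp. Qed.

(** Since chi(t g g'^-1) = t_j chi(g g'^-1), the component of weight ej in the
    variable g is the whole function; it can be computed term by term. *)
Let split1 : exists s : seq (P * P),
  (forall a, List.In a s -> weight ej a.1) /\ v = \sum_(a <- s) p1 a.1 * p2 a.2.
Proof.
have -> : v = lau_coef ej (ev2 (bs s2) q_left v).
  rewrite (@ev2_chr _ _ _ _ _ (tau s2 · (lau_base r P2 ∘ t12))).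
    rewrite chrM tauE chr_nat mulrC lau_coefE eqxx //.
  rewrite on_pointsM on_points_comp t12E compM compV -/b1 -/b2 ptA.
  by rewrite -/tauG.
elim/tens_ind: v => [|x y z [s [sw zE]]].
  by exists [::]; split=> //; rewrite lr0 lau_coef0 big_nil.
exists ((proj ej x, y) :: s); split=> [a [<-|/sw]|] //; first exact: proj_weight.
rewrite big_cons lrD lau_coefD zE; congr (_ + _).
rewrite lrM -[tl _ x]/(p1 x) -[tr _ y]/(p2 y).
rewrite -[ev2 _ _ (p1 x)]/((ev2 _ _ ∘ p1) x) ev2_1.
rewrite -[ev2 _ _ (p2 y)]/((ev2 _ _ ∘ p2) y) ev2_2.
have -> : ev b2 (bs s2) = lau_base r P2 ∘ p2 by rewrite -ev_p2 ev_comp.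
rewrite mulrC lau_coefM mulrC; congr (_ * _).
by rewrite -ev_p1 proj_ev.
Qed.

Let split2 : exists s : seq (P * P),
  (forall a, List.In a s -> weight ej a.1 /\ weight (- ej) a.2) /\
  v = \sum_(a <- s) p1 a.1 * p2 a.2.
Proof.
have [s [sw vE]] := split1.
have vE' : v = lau_coef (- ej) (ev2 (bs s2) q_right v).
  rewrite (@ev2_chr _ _ _ _ _ ((lau_base r P2 ∘ t12) · pt_inv (tau s2))).
    rewrite chrM chr_nat.
    have -> : chr X (bs s2) (pt_inv (tau s2)) j = lau_var P2 (- ej).
      have := chrV X (bs s2) (tau s2) j; rewrite tauE.
      move=> /(congr1 ( *%R^~ (lau_var P2 (- ej)))).
      by rewrite -mulrA -lau_varD subrr lau_var0 mulr1 mul1r.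
    by rewrite lau_coefE eqxx.
  rewrite on_pointsM on_pointsV on_points_comp t12E compM compV -/b1 -/b2.
  by rewrite pt_invM ptA.
exists [seq (a.1, proj (- ej) a.2) | a <- s]; split.
  move=> a /List.in_map_iff [b [<- /sw wb]]; split=> //; exact: proj_weight.
rewrite vE' {1}vE big_map lr_sum.
elim: (s) => [|a s' IH]; first by rewrite !big_nil lau_coef0.
rewrite !big_cons lau_coefD IH; congr (_ + _).
rewrite lrM -[ev2 _ _ (p1 _)]/((ev2 _ _ ∘ p1) _) ev2_1.
rewrite -[ev2 _ _ (p2 _)]/((ev2 _ _ ∘ p2) _) ev2_2.
have -> : ev b1 (bs s2) = lau_base r P2 ∘ p1 by rewrite -ev_p1 ev_comp.
rewrite lau_coefM; congr (_ * _).
by rewrite -ev_p2 proj_ev.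
Qed.

(** On the diagonal g = g' the decomposition [split2] of chi(g g'^-1) becomes
    1 = sum x y. *)
Lemma unit_weight : exists x y : P, weight ej x /\ x * y = 1.
Proof.
have [s [sw vE]] := split2.
have [eB] := tensk_kbasis eF eL.
suff [x [y [wx _ xy]]] : exists x y,
    [/\ weight ej x, weight (- ej) y & x * y = 1] by exists x, y.
apply: (unit_of_weight (h := phi) eB _ _ _ _ _ _ _ (s := s)) => //.
- exact: weight_0.
- exact: weight_0.
- exact: weightD.
- exact: weightD.
- by move=> b x wx; rewrite -[ej]add0r; apply: weightM wx; apply: weight0_phi.
- by move=> b x wx; rewrite -[- ej]add0r; apply: weightM wx; apply: weight0_phi.
- by move=> x y wx wy; apply: weight0_base; rewrite -(subrr ej); apply: weightM.
- have := congr1 (ev2 sP (erefl (on_points q gam))) vE.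
  rewrite (@ev2_chr _ _ _ _ _ (pt_one T P)) ?chr1 ?on_points1 ?ptVr // => ->.
  rewrite lr_sum; apply: eq_bigr => a _; rewrite lrM.
  rewrite -[ev2 _ _ (p1 _)]/((ev2 _ _ ∘ p1) _) ev2_1.
  by rewrite -[ev2 _ _ (p2 _)]/((ev2 _ _ ∘ p2) _) ev2_2 ev_id.
Qed.
End Character.

(** The units of weight chi_1, ..., chi_r are the coordinates of an equivariant
    map t : G -> T over L.  Then t(g)^-1 g only depends on the image of g in F. *)
Theorem torsor_section :
  exists s : points G B, on_points q s = tkl eL (reg F).
Proof.
pose u j := sval (cid (unit_weight j)).
have uw j : weight (unit_exp j) (u j) /\ invertible (u j).
  by have [y [wu uy]] := svalP (cid (unit_weight j)); split=> //; exists y.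
have [t tE] := chr_pt X sP (fun j => (uw j).2).
pose sig : points G P := pt_inv (on_points i t) · gam.
have sigw a : weight 0 (sig a).
  move=> R s x g; rewrite umon0 mul1r.
  apply: (lr_congr (f := _ ∘ sig) (g := _ ∘ sig)).
  rewrite /sig !compM !compV -!on_points_comp !ev_gam.
  have -> : ev (on_points i x · g) s ∘ t = x · (ev g s ∘ t).
    apply: (chr_inj (X := X) (s := s)) => j; rewrite chrM.
    have cn g0 : chr X s (ev g0 s ∘ t) j = ev g0 s (u j).
      by have := chr_nat X sP (ev g0 s) t j; rewrite ev_sP tE.
    by rewrite !cn (uw j).1 umon_unit.
  by rewrite on_pointsM pt_invM -!ptA ptKl.
have [s sE] := factor_inj phi_inj (fun a => weight0_base (sigw a)).
exists s; apply: (comp_inj phi_inj).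
rewrite -on_points_comp sE /sig on_pointsM on_pointsV q_i pt_inv1 pt1l.
by rewrite /on_points gam_phi.
Qed.
End TorsorSection.

(** * Closed subgroups cut out by a natural map *)

(** The locus Phi = 1 is represented by the quotient of k[G] by the ideal
    generated by the functions Phi^*(t) - t(1).  Admissible functionals on k[G]
    are the linear ones that vanish on this ideal, and the group structure is
    restricted from G on points. *)
Section ClosedSubgroup.
Variables (k : fieldType) (G Y : affine_group k).
Variable Phi : forall R : comAlgType k, points G R -> points Y R.
Hypothesis Phi_nat : forall (R S : comAlgType k) (h : {lrmorphism R -> S})
  (g : points G R), Phi (h ∘ g : points G S) = h ∘ Phi g.
Hypothesis Phi1 : forall R, Phi (pt_one G R) = pt_one Y R.
Hypothesis PhiM : forall R (g h : points G R),
  Phi g = pt_one Y R -> Phi h = pt_one Y R -> Phi (g · h) = pt_one Y R.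
Hypothesis PhiV : forall R (g : points G R),
  Phi g = pt_one Y R -> Phi (pt_inv g) = pt_one Y R.
Local Notation A := (reg G).
Implicit Types (R S : comAlgType k).

Let defect (t : reg Y) : A := Phi (lr_id A) t - pt_one Y A t.

Definition cadm (P : lmodType k) (D : A -> P) : Prop :=
  (forall c x y, D (c *: x + y) = c *: D x + D y) /\
  (forall x t, D (x * defect t) = 0).

Fact cadmM (P : lmodType k) (D : A -> P) x :
  cadm D -> cadm (fun y => D (x * y)).
Proof.
by case=> D1 D2; split=> [c y z|y t]; rewrite ?mulrA // mulrDr -scalerAr D1.
Qed.

Let kill R (x : points G R) : Phi x = pt_one Y R -> forall t, x (defect t) = 0.
Proof.
move=> x1 t; rewrite rmorphB /= -[x (Phi _ t)]/((x ∘ Phi (lr_id A)) t).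
rewrite -Phi_nat alg_comp1 x1 -[x (pt_one _ _ t)]/((x ∘ pt_one Y A) t) comp1.
exact: subrr.
Qed.

Fact cadm_lr R (x : points G R) : Phi x = pt_one Y R -> cadm x.
Proof.
move=> x1; split=> [c y z|y t]; first by rewrite lrP.
by rewrite lrM kill // mulr0.
Qed.

Fact cadm_nz : exists (P : lmodType k) (D : A -> P), cadm D /\ D 1 <> 0.
Proof.
exists (k^o : comAlgType k), (pt_one G k^o); split; first exact/cadm_lr/Phi1.
by rewrite lr1; apply/eqP/oner_neq0.
Qed.

Definition cpres := Presentation (@mulrA A) (@mulrC A) (@mul1r A) cadmM cadm_nz.
Definition cquo : comAlgType k := presented cpres.

Fact cgen_lin c x y : pgen (p := cpres) (c *: x + y) =
  c *: pgen (p := cpres) x + pgen (p := cpres) y.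
Proof. by apply: pgen_lin => P D [D1 _]; apply: D1. Qed.

Fact cgen0 : pgen (p := cpres) 0 = 0.
Proof.
by have := cgen_lin (-1) 0 0; rewrite scaler0 addr0 scaleN1r addNr.
Qed.

Definition cproj : {lrmorphism A -> cquo}.
Proof.
apply: (@mk_lrmorphism _ A cquo (fun x => pgen (p := cpres) x)) => [x y|x y||c x].
- by rewrite -[x in LHS]scale1r cgen_lin scale1r.
- exact: (pgenM (p := cpres)).
- by [].
- by rewrite -[c *: x]addr0 cgen_lin cgen0 addr0.
Defined.
Lemma cprojE x : cproj x = pgen (p := cpres) x.
Proof. exact: mk_lrmorphismE. Qed.

Lemma cproj_surj a : exists b, cproj b = a.
Proof.
elim/presented_ind: a => [|c x z [b bz]]; first by exists 0; rewrite lr0.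
by exists (c *: (x : A) + b); rewrite lrP bz cprojE.
Qed.

Lemma cproj_epi R (y z : {lrmorphism cquo -> R}) : y ∘ cproj = z ∘ cproj -> y = z.
Proof.
move=> e; apply: lrmorphism_ext => a; have [b <-] := cproj_surj a.
exact: (lr_congr e).
Qed.

Definition clift R (x : points G R) (x1 : Phi x = pt_one Y R) :
  {lrmorphism cquo -> R} :=
  plift (p := cpres) (cadm_lr x1) (lrM x) (lr1 x).

Lemma cliftK R (x : points G R) (x1 : Phi x = pt_one Y R) :
  clift x1 ∘ cproj = x.
Proof. by apply: lrmorphism_ext => a; rewrite alg_compE cprojE plift_gen. Qed.

Lemma cproj_Phi R (y : {lrmorphism cquo -> R}) :
  Phi (y ∘ cproj : points G R) = pt_one Y R.
Proof.
rewrite -[y ∘ cproj]alg_comp1 Phi_nat -(comp1 Y (y ∘ cproj)).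
apply: lrmorphism_ext => t; rewrite !alg_compE; congr (y _).
apply/eqP; rewrite -subr_eq0 -rmorphB /=; apply/eqP.
rewrite -/(defect t) cprojE -(lr0 cproj) cprojE; apply: pgen_eq => P D [D1 D2].
have -> : D 0 = 0.
  by have := D1 (-1) 0 0; rewrite scaler0 addr0 scaleN1r addNr.
by rewrite -[defect t]mul1r D2.
Qed.

Definition cmul R (y z : {lrmorphism cquo -> R}) : {lrmorphism cquo -> R} :=
  clift (PhiM (cproj_Phi y) (cproj_Phi z)).
Definition cone R : {lrmorphism cquo -> R} := clift (Phi1 R).
Definition cinv R (y : {lrmorphism cquo -> R}) : {lrmorphism cquo -> R} :=
  clift (PhiV (cproj_Phi y)).

Fact cmulA R : associative (@cmul R).
Proof. by move=> x y z; apply: cproj_epi; rewrite !cliftK ptA. Qed.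
Fact cmul1 R : left_id (cone R) (@cmul R).
Proof. by move=> x; apply: cproj_epi; rewrite !cliftK pt1l. Qed.
Fact cmulV R : left_inverse (cone R) (@cinv R) (@cmul R).
Proof. by move=> x; apply: cproj_epi; rewrite !cliftK ptVl. Qed.
Fact cmul_nat R S (h : {lrmorphism R -> S}) (x y : {lrmorphism cquo -> R}) :
  h ∘ cmul x y = cmul (h ∘ x) (h ∘ y).
Proof. by apply: cproj_epi; rewrite -alg_compA !cliftK compM !alg_compA. Qed.

Definition cgroup := AffineGroup cmulA cmul1 cmulV cmul_nat.
Definition cincl : group_hom cgroup G :=
  @GroupHom _ cgroup G cproj (fun R x y => cliftK _).

Lemma closed_subgroup_of_natural :
  exists (H : affine_group k) (j : group_hom H G), closed_subgroup j /\
    forall R (x : points G R),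
      Phi x = pt_one Y R <-> exists y : points H R, on_points j y = x.
Proof.
exists cgroup, cincl; split; first exact: cproj_surj.
move=> R x; split=> [x1|[y <-]]; last exact: cproj_Phi.
by exists (clift x1); apply: cliftK.
Qed.
End ClosedSubgroup.

Lemma pt_expS (k : fieldType) (T : affine_group k) (R : comAlgType k)
  (x : points T R) m : pt_exp x m.+1 = x · pt_exp x m.
Proof. by []. Qed.

Lemma torsion_subgroup_exists (k : fieldType) (T : affine_group k) (m : nat) :
  (forall (R : comAlgType k) (x y : points T R), x · y = y · x) ->
  exists (N : affine_group k) (a : group_hom N T), torsion_subgroup m a.
Proof.
move=> Tc; have expM R (x y : points T R) :
    pt_exp (x · y) m = pt_exp x m · pt_exp y m.
  elim: m => [|m IH]; first by rewrite [RHS]pt1l.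
  by rewrite !pt_expS IH -!ptA; congr (_ · _); rewrite !ptA (Tc _ y).
have exp1 R : pt_exp (pt_one T R) m = pt_one T R.
  by elim: m {expM} => [//|m IH]; rewrite pt_expS IH pt1l.
have [||||N [a [ca aP]]] := @closed_subgroup_of_natural k T T
    (fun R x => pt_exp x m).
- by move=> R S h g; rewrite -pt_exp_comp.
- exact: exp1.
- by move=> R g h g1 h1; rewrite expM g1 h1 pt1l.
- move=> R g g1; rewrite -[LHS]pt1l -{1}g1 -expM ptVr; exact: exp1.
by exists N, a.
Qed.

(** * The crossed homomorphism *)

Section FreeTensor.
Variables (k : fieldType) (B : comAlgType k) (m : nat) (e : kbasis B m).
Variable R : comAlgType k.

Fact tkc_lin i r x y :
  tkc e i (tkl e R r * x + y) = r * tkc e i x + tkc e i y.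
Proof. by rewrite /tkc (tcoordD (kcP e i)) (tcoordM (kcP e i)). Qed.
Fact tkc_dual i j : tkc e i (tkr e R (kb e j)) = (i == j)%:R.
Proof. by rewrite /tkc (tcoord_r (kcP e i)) kb_dual scaler_nat. Qed.

Definition tensk_free : free_basis (tkl e R) m :=
  FreeBasis tkc_lin (tkc_span e) tkc_dual.
End FreeTensor.

(** [transl f] is the automorphism of R ⊗ B over R ⊗ L induced by left
    translation by f in F(R). *)
Section CrossedHom.
Variables (k : fieldType) (T G F : affine_group k).
Variables (i : group_hom T G) (q : group_hom G F).
Hypothesis hiq : short_exact i q.
Variables (d : nat) (L : comAlgType k) (eL : kbasis L d) (m : nat).
Local Notation B := (tensk eL (reg F)).
Variable eB : kbasis B m.
Hypothesis Tcomm : forall (R : comAlgType k) (x y : points T R), x · y = y · x.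
Let b : points F B := tkl eL (reg F).
Variable s : points G B.
Hypothesis qs : on_points q s = b.
Implicit Types (R S : comAlgType k).

Let C R := tensk eB R.
Let rho R : {lrmorphism R -> C R} := tkl eB R.
Let bC R : points F (C R) := tkr eB R ∘ b.
Let sC R : points G (C R) := tkr eB R ∘ s.
Let qsC R : on_points q (sC R) = bC R.
Proof. by rewrite on_points_comp qs. Qed.

Fact transl_key R (f : points F R) : {h : {lrmorphism C R -> C R} |
  [/\ h ∘ rho R = rho R,
      h ∘ bC R = (rho R ∘ f : points F (C R)) · bC R
    & h ∘ tkr eB R ∘ tkr eL (reg F) = tkr eB R ∘ tkr eL (reg F)]}.
Proof.
exists (tklift eB (rho R)
  (tklift eL ((rho R ∘ f : points F (C R)) · bC R) (tkr eB R ∘ tkr eL (reg F)))).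
split; first exact: tklift_l.
  by rewrite /bC alg_compA tklift_r tklift_l.
by rewrite alg_compA tklift_r tklift_r.
Qed.

Definition transl R (f : points F R) : {lrmorphism C R -> C R} :=
  sval (transl_key f).

Lemma transl_rho R (f : points F R) : transl f ∘ rho R = rho R.
Proof. by case: (svalP (transl_key f)). Qed.
Lemma transl_b R (f : points F R) :
  transl f ∘ bC R = (rho R ∘ f : points F (C R)) · bC R.
Proof. by case: (svalP (transl_key f)). Qed.
Lemma transl_L R (f : points F R) :
  transl f ∘ tkr eB R ∘ tkr eL (reg F) = tkr eB R ∘ tkr eL (reg F).
Proof. by case: (svalP (transl_key f)). Qed.

Lemma C_ext R (U : comAlgType k) (f g : {lrmorphism C R -> U}) : f ∘ rho R = g ∘ rho R ->
  f ∘ bC R = g ∘ bC R ->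
  f ∘ tkr eB R ∘ tkr eL (reg F) = g ∘ tkr eB R ∘ tkr eL (reg F) -> f = g.
Proof.
move=> fg1 fg2 fg3; apply: tensk_ext => //; apply: tensk_ext.
  by rewrite -!alg_compA.
by rewrite -!alg_compA.
Qed.

Lemma translM R (f g : points F R) : transl g ∘ transl f = transl (f · g).
Proof.
apply: C_ext; first by rewrite -alg_compA !transl_rho.
  by rewrite -alg_compA !transl_b !compM transl_b !alg_compA transl_rho ptA.
by rewrite -alg_compA !transl_L.
Qed.
Lemma transl1 R : transl (pt_one F R) = lr_id (C R).
Proof.
apply: C_ext; rewrite ?alg_comp_id; first exact: transl_rho.
  by rewrite transl_b comp1 pt1l.
exact: transl_L.
Qed.
Lemma transl_nat R S (h : {lrmorphism R -> S}) (f : points F R) :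
  tkmap eB h ∘ transl f = transl (h ∘ f) ∘ tkmap eB h.
Proof.
have hb : tkmap eB h ∘ bC R = bC S by rewrite /bC alg_compA tkmap_r.
apply: C_ext; rewrite -!alg_compA.
- by rewrite transl_rho !tkmap_l !alg_compA transl_rho.
- by rewrite transl_b compM hb transl_b (alg_compA (tkmap eB h)) tkmap_l -alg_compA.
- by rewrite transl_L alg_compA tkmap_r transl_L.
Qed.

(** Both g s and the translate of s by q(g) lie over the same point of F, namely
    the translate of the tautological point. *)
Lemma cocycle_ex R (g : points G R) : exists u : points T (C R),
  on_points i u =
    (rho R ∘ g : points G (C R)) · sC R · pt_inv (transl (on_points q g) ∘ sC R).
Proof.
apply: (q_ker hiq); rewrite on_pointsM (on_points_comp q (rho R)).
by rewrite (on_points_comp q (transl _)) !qsC transl_b.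
Qed.

Definition cocycle R (g : points G R) : points T (C R) := sval (cid (cocycle_ex g)).
Lemma cocycleE R (g : points G R) : on_points i (cocycle g) =
  (rho R ∘ g : points G (C R)) · sC R · pt_inv (transl (on_points q g) ∘ sC R).
Proof. exact: svalP (cid (cocycle_ex g)). Qed.

Definition crossed R (g : points G R) : points T R :=
  norm Tcomm (tensk_free eB R) (cocycle g).

Lemma crossed_nat R S (h : {lrmorphism R -> S}) (g : points G R) :
  crossed (h ∘ g) = h ∘ crossed g.
Proof.
have -> : crossed (h ∘ g) = norm Tcomm (tensk_free eB S) (tkmap eB h ∘ cocycle g).
  congr norm; apply: (i_inj hiq); rewrite on_points_comp !cocycleE.
  have hs : tkmap eB h ∘ sC R = sC S by rewrite /sC alg_compA tkmap_r.
  rewrite !compM compV hs (alg_compA (tkmap eB h) (rho R)) tkmap_l.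
  rewrite (alg_compA (tkmap eB h) (transl _)) transl_nat.
  by rewrite -(alg_compA (transl _) (tkmap eB h)) hs -alg_compA on_points_comp.
apply: norm_map; first exact: tkmap_l.
by move=> l; rewrite /= tklift_rE.
Qed.

(** The cocycle of g h is the product of the conjugate by g of the cocycle of h
    and of the translate by h of the cocycle of g. *)
Lemma crossedM R (g h : points G R) : on_points i (crossed (g · h)) =
  g · on_points i (crossed h) · pt_inv g · on_points i (crossed g).
Proof.
pose gC : points G (C R) := rho R ∘ g.
have [x ix] : exists x : points T (C R),
    on_points i x = gC · on_points i (cocycle h) · pt_inv gC.
  have e : on_points q (gC · on_points i (cocycle h) · pt_inv gC) =
      on_points q (pt_one G (C R)).
    by rewrite !on_pointsM on_pointsV (q_i hiq) pt1r ptVr on_points1.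
  have [x ix] := q_ker hiq e.
  by exists x; rewrite ix pt_inv1 pt1r.
rewrite /crossed.
have -> : cocycle (g · h) = x · (transl (on_points q h) ∘ cocycle g).
  apply: (i_inj hiq); rewrite on_pointsM on_points_comp ix !cocycleE.
  rewrite !compM compV !(alg_compA (transl _)) transl_rho on_pointsM -translM.
  by rewrite -/gC !ptA !ptKVr -!alg_compA.
rewrite normM on_pointsM.
have tK : cancel (transl (on_points q h)) (transl (pt_inv (on_points q h))).
  by move=> z; have := lr_congr (translM (on_points q h) (pt_inv (on_points q h))) z;
    rewrite ptVr transl1.
have tK' : cancel (transl (pt_inv (on_points q h))) (transl (on_points q h)).
  by move=> z; have := lr_congr (translM (pt_inv (on_points q h)) (on_points q h)) z;
    rewrite ptVl transl1.
rewrite (norm_aut Tcomm _ _ (transl_rho _) tK tK'); congr (_ · _).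
by apply: norm_conj ix => S; apply: (i_inj hiq).
Qed.

Lemma crossed_i R (t : points T R) : crossed (on_points i t) = pt_exp t m.
Proof.
rewrite -[RHS](norm_in Tcomm (tensk_free eB R)).
congr norm; apply: (i_inj hiq); rewrite cocycleE (q_i hiq) transl1.
by rewrite alg_comp_id ptKr on_points_comp.
Qed.
End CrossedHom.

(** * Finite projective algebras *)

(** A finite dual basis makes A a direct summand of a free module, hence flat; a
    linear form with value 1 at 1 makes B a direct summand of A, hence the flat
    module A is faithful. *)
Lemma dual_basis_faithfully_flat (B A : comNzRingType) (phi : {rmorphism B -> A})
  (J : finType) (E : J -> A) (al : J -> A -> B) (l : A -> B) :
  (forall j c x y, al j (phi c * x + y) = c * al j x + al j y) ->
  (forall x, x = \sum_j phi (al j x) * E j) ->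
  (forall c x y, l (phi c * x + y) = c * l x + l y) -> l 1 = 1 ->
  faithfully_flat phi.
Proof.
move=> alP sp lP l1; split=> [M N u uI t t0 P b b1 b2|M M0 m].
  have ut j : \sum_(ma <- t) al j ma.2 *: ma.1 = 0.
    apply: uI; rewrite linear0 linear_sum.
    transitivity (\sum_(ma <- t) al j ma.2 *: u ma.1).
      by apply: eq_bigr => ma _; rewrite linearZ.
    have := t0 N (fun n a => al j a *: n); rewrite big_map /=; apply.
    - by move=> c x y a; rewrite scalerDr !scalerA mulrC.
    - by move=> c x a a'; rewrite alP scalerDl scalerA.
  have b0l a : b 0 a = 0.
    by have := b1 (-1) 0 0 a; rewrite scaler0 addr0 scaleN1r addNr.
  have b0r x : b x 0 = 0.
    by have := b2 (-1) x 0 0; rewrite mulr0 addr0 scaleN1r addNr.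
  have bD x y a : b (x + y) a = b x a + b y a.
    by rewrite -[x in LHS]scale1r b1 scale1r.
  have bDr x a a' : b x (a + a') = b x a + b x a'.
    by rewrite -[a in LHS]mul1r -(rmorph1 phi) b2 scale1r.
  have bZ c x a : b (c *: x) a = c *: b x a by rewrite -[c *: x]addr0 b1 b0l addr0.
  have bZr c x a : b x (phi c * a) = c *: b x a.
    by rewrite -[_ * a]addr0 b2 b0r addr0.
  transitivity (\sum_j b (\sum_(ma <- t) al j ma.2 *: ma.1) (E j)).
    transitivity (\sum_j \sum_(ma <- t) b (al j ma.2 *: ma.1) (E j)).
      rewrite exchange_big; apply: eq_bigr => ma _.
      rewrite {1}(sp ma.2) (big_morph (b ma.1) (bDr _) (b0r _)).
      by apply: eq_bigr => j _; rewrite bZ bZr.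
    apply: eq_bigr => j _.
    by rewrite (big_morph (b^~ (E j)) (fun x y => bD x y _) (b0l _)).
  by rewrite big1 // => j _; rewrite ut b0l.
have := M0 [:: (m, 1)] M (fun x a => l a *: x); rewrite big_seq1 /= l1 scale1r.
apply=> [c x y a|c x a a']; first by rewrite scalerDr !scalerA mulrC.
by rewrite lP scalerDl scalerA.
Qed.

(** The family E together with the forms c presents k[G] as a direct summand of
    a space of row vectors, the image of the idempotent matrix Q. *)
Lemma has_order_of_spanning (k : fieldType) (G : affine_group k) (J : finType)
  (E : J -> reg G) (c : J -> reg G -> k) :
  (forall j a x y, c j (a *: x + y) = a * c j x + c j y) ->
  (forall x, x = \sum_j c j x *: E j) -> finite_group_scheme G.
Proof.
move=> cP sp; pose M := #|J|.
pose ev (v : 'rV[k]_M) : reg G := \sum_i v 0 i *: E (enum_val i).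
pose co (x : reg G) : 'rV[k]_M := \row_i c (enum_val i) x.
have evP a v w : ev (a *: v + w) = a *: ev v + ev w.
  rewrite scaler_sumr -big_split; apply: eq_bigr => i _.
  by rewrite !mxE scalerDl scalerA.
have coP a x y : co (a *: x + y) = a *: co x + co y.
  by apply/rowP => i; rewrite !mxE cP.
have coK x : ev (co x) = x.
  rewrite [RHS]sp (reindex _ (onW_bij _ (@enum_val_bij J))).
  by apply: eq_bigr => i _; rewrite mxE.
pose Q : 'M[k]_M := lin1_mx (co \o ev).
pose f (v : 'rV[k]_M) := co (ev v).
have fL : linear f by move=> a v w; rewrite /f evP coP.
pose fl : {linear 'rV[k]_M -> 'rV[k]_M} :=
  HB.pack f (GRing.isLinear.Build _ _ _ _ f fL).
have QE v : v *m Q = co (ev v) by rewrite -[RHS]/(fl v) -mul_rV_lin1.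
have QQ : Q *m Q = Q.
  by apply/row_matrixP => i; rewrite !rowE mulmxA !QE coK.
pose b := row_base Q; exists (\rank Q), (fun i => ev (row i b)).
have bQ : b *m Q = b.
  have /submxP [D ->] : (b <= Q)%MS by rewrite eq_row_base.
  by rewrite -mulmxA QQ.
have evb (v : 'rV[k]_(\rank Q)) : \sum_i v 0 i *: ev (row i b) = ev (v *m b).
  have ev0 : ev 0 = 0.
    by have := evP (-1) 0 0; rewrite scaler0 addr0 scaleN1r addNr.
  have evD x y : ev (x + y) = ev x + ev y by rewrite -[x in LHS]scale1r evP scale1r.
  rewrite (mulmx_sum_row v b) (big_morph ev evD ev0); apply: eq_bigr => i _.
  by rewrite -[_ *: row i b]addr0 evP ev0 addr0.
have bf : row_free b by exact: row_base_free.
exists (fun x => co x *m pinvmx b) => [v|x].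
  rewrite evb -QE -(mulmxA v b Q) bQ.
  by apply: (row_free_inj bf); rewrite mulmxKpV // submxMl.
rewrite evb mulmxKpV ?coK // eq_row_base.
by rewrite -[x in co x]coK -QE submxMl.
Qed.

(** * Homomorphisms *)

Section Homs.
Variable k : fieldType.
Implicit Types (G H K : affine_group k) (R : comAlgType k).

Definition hom_comp G H K (f : group_hom H K) (g : group_hom G H) : group_hom G K.
Proof.
apply: (@GroupHom _ G K (comorphism g ∘ comorphism f)) => R x y.
by rewrite !alg_compA !comorphismM.
Defined.

Lemma hom_compE G H K (f : group_hom H K) (g : group_hom G H) R (x : points G R) :
  on_points (hom_comp f g) x = on_points f (on_points g x).
Proof. by rewrite /on_points alg_compA. Qed.

(** Apply the hypothesis to the generic point of G. *)
Lemma hom_lift G H K (j : group_hom H K) (f : group_hom G K) : closed_subgroup j ->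
  (forall R (x : points G R), exists y : points H R, on_points j y = on_points f x) ->
  exists f' : group_hom G H, forall R (x : points G R),
    on_points j (on_points f' x) = on_points f x.
Proof.
move=> cj jf; have [h jh] := jf (reg G) (lr_id (reg G)).
have hE R (x : points G R) : on_points j (x ∘ h : points H R) = on_points f x.
  by rewrite on_points_comp jh /on_points alg_comp_id.
unshelve eexists (@GroupHom _ G H h _) => //.
move=> R x y; apply: (closed_subgroup_inj cj).
by rewrite hE on_pointsM !on_pointsM !hE.
Qed.
End Homs.

(** * The finite subgroup *)

Section Main.
Variables (k : fieldType) (T G F : affine_group k).
Variables (i : group_hom T G) (q : group_hom G F).
Hypothesis hiq : short_exact i q.
Variables (d : nat) (L : comAlgType k) (eL : kbasis L d) (n : nat).
Variable eF : kbasis (reg F) n.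
Local Notation B := (tensk eL (reg F)).
Variables (m : nat) (eB : kbasis B m) (r : nat) (X : splitting T L r).
Variable s : points G B.
Hypothesis qs : on_points q s = tkl eL (reg F).
Implicit Types R S : comAlgType k.

Hypothesis Tcomm : forall R (x y : points T R), x · y = y · x.
Let Phi R (g : points G R) : points T R := crossed hiq eB Tcomm qs g.
Let PhiM R (g h : points G R) : on_points i (Phi (g · h)) =
  g · on_points i (Phi h) · pt_inv g · on_points i (Phi g).
Proof. exact: crossedM. Qed.
Let Phi_nat R S (f : {lrmorphism R -> S}) (g : points G R) :
  Phi (f ∘ g : points G S) = f ∘ Phi g.
Proof. exact: crossed_nat. Qed.
Let Phi_i R (t : points T R) : Phi (on_points i t) = pt_exp t m.
Proof. exact: crossed_i. Qed.

Let Phi_it R (t : points T R) (g : points G R) :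
  Phi (on_points i t · g) = Phi g · pt_exp t m.
Proof.
apply: (i_inj hiq); rewrite PhiM Phi_i -on_pointsV -!on_pointsM; congr on_points.
by rewrite (Tcomm t) ptKr.
Qed.

Let Phi1 R : Phi (pt_one G R) = pt_one T R.
Proof.
rewrite -(on_points1 i) Phi_i; elim: m => [//|l IH].
by rewrite pt_expS IH pt1l.
Qed.

Lemma crossed_kernel : exists (H : affine_group k) (j : group_hom H G),
  closed_subgroup j /\ forall R (x : points G R),
    Phi x = pt_one T R <-> exists y : points H R, on_points j y = x.
Proof.
apply: closed_subgroup_of_natural => // R g.
  move=> h g1 h1; apply: (i_inj hiq).
  by rewrite PhiM g1 h1 !on_points1 !pt1r ptVr.
move=> g1; apply: (i_inj hiq).
have := PhiM (pt_inv g) g; rewrite ptVl Phi1 g1 !on_points1 pt1r pt_invK ptVl.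
by rewrite pt1l => <-.
Qed.

Variables (H : affine_group k) (j : group_hom H G).
Hypothesis cj : closed_subgroup j.
Hypothesis jP : forall R (x : points G R),
  Phi x = pt_one T R <-> exists y : points H R, on_points j y = x.
Let q' := hom_comp q j.

Let Phi_j R (y : points H R) : Phi (on_points j y) = pt_one T R.
Proof. by apply/jP; exists y. Qed.

Let sB : {lrmorphism L -> B} := tkr eL (reg F).
Let wT : points T B := pt_inv (Phi s).
Let w l := chr X sB wT l.
Let m_gt0 : (0 < m)%N := kb_dim_gt0 eB.
Let D := kum w m_gt0.
Let base : {lrmorphism B -> D} := kum_base w m_gt0.

(** A point t s over B lies in H exactly when t is an m-th root of
    w = phi(s)^-1. *)
Let wE R (h : {lrmorphism B -> R}) (t : points T R) :
  (forall l, chr X (h ∘ sB) t l ^+ m = h (w l)) <->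
  Phi (on_points i t · (h ∘ s)) = pt_one T R.
Proof.
rewrite Phi_it Phi_nat; split=> [tw|e l].
  suff -> : pt_exp t m = h ∘ wT by rewrite -compM ptVr comp1.
  by apply: (chr_inj (X := X) (s := h ∘ sB)) => l; rewrite chr_exp tw chr_nat.
rewrite -chr_exp /w -chr_nat; congr chr.
by rewrite compV -[RHS]pt1r -e ptKl.
Qed.

Let w_inv l : invertible (w l). Proof. exact: chr_inv. Qed.

(** The point t s of H over D, where t has the roots t_j as coordinates. *)
Lemma kummer_point : exists h : points H D,
  on_points q' h = base ∘ tkl eL (reg F) /\
  exists t : points T D, (forall l, chr X (base ∘ sB) t l = kum_root w m_gt0 l) /\
    on_points j h = on_points i t · (base ∘ s).
Proof.
have [t tE] := chr_pt X (base ∘ sB) (kum_root_inv m_gt0 w_inv).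
have /jP [h jh] : Phi (on_points i t · (base ∘ s)) = pt_one T D.
  by apply/wE => l; rewrite tE kum_rootX.
exists h; split; last by exists t.
by rewrite hom_compE jh on_pointsM (q_i hiq) pt1l on_points_comp qs.
Qed.

Let K := tensk eL (reg H).
Let psi : {lrmorphism B -> K} := tkmap eL (comorphism q').

(** Over k[H] ⊗ L the generic point of H is t' s with t'^m = w.  The coordinates
    of t' define D -> k[H] ⊗ L, and composing with k[H] -> D gives back the
    inclusion. *)
Lemma kummer_retract (h : points H D) (t : points T D) :
  (forall l, chr X (base ∘ sB) t l = kum_root w m_gt0 l) ->
  on_points j h = on_points i t · (base ∘ s) ->
  exists kap : {lrmorphism D -> K}, kap ∘ base = psi /\ kap ∘ h = tkl eL (reg H).
Proof.
move=> tE jh; pose gK : points H K := tkl eL (reg H).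
have qK : on_points q (on_points j gK) = on_points q (psi ∘ s : points G K).
  by rewrite -hom_compE on_points_comp qs [RHS]tkmap_l.
have [t' it'] := q_ker hiq qK.
have jK : on_points j gK = on_points i t' · (psi ∘ s) by rewrite it' ptKVr.
have /wE uX : Phi (on_points i t' · (psi ∘ s)) = pt_one T K by rewrite -jK Phi_j.
pose kap := kum_lift m_gt0 uX; exists kap.
have kb : kap ∘ base = psi by exact: kum_lift_base.
split=> //; apply: (closed_subgroup_inj cj); rewrite on_points_comp jh -/gK jK.
rewrite compM alg_compA kb -on_points_comp; congr (on_points i _ · _).
apply: (chr_inj (X := X) (s := psi ∘ sB)) => l.
by rewrite -{1}kb -alg_compA chr_nat tE kum_lift_root.
Qed.

Lemma kernel_finite_flat :
  finite_group_scheme H /\ faithfully_flat (comorphism q').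
Proof.
have [h [qh [t [tE jh]]]] := kummer_point.
have [kap [kapb kh]] := kummer_retract tE jh.
pose ret : K -> reg H := tcoord (kfun eL).
have retM x (z : K) : ret (tkl eL (reg H) x * z) = x * ret z.
  exact: (tcoordM (kfunP eL)).
have retD x y : ret (x + y) = ret x + ret y by exact: (tcoordD (kfunP eL)).
have ret0 : ret 0 = 0 by exact: (tcoord0 (kfunP eL)).
have retl x : ret (kap (h x)) = x.
  rewrite -[kap (h x)]/((kap ∘ h) x) kh /ret (tcoord_l (kfunP eL)) kfun1.
  exact: scale1r.
have hq c : h (comorphism q' c) = base (tkl eL (reg F) c) by exact: (lr_congr qh).
pose J := ({ffun 'I_r -> 'I_m} * 'I_d)%type.
pose al (l : J) (x : reg H) : reg F := tkc eL l.2 (kum_coef l.1 (h x)).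
pose E (l : J) : reg H :=
  ret (psi (tkr eL (reg F) (kb eL l.2)) * kap (kum_mon w m_gt0 (kval l.1))).
have alP l c x y : al l (comorphism q' c * x + y) = c * al l x + al l y.
  rewrite /al lrD lrM hq kum_coefD kum_coefM /tkc (tcoordD (kcP eL _)).
  by rewrite (tcoordM (kcP eL _)).
have sp x : x = \sum_l comorphism q' (al l x) * E l.
  rewrite -{1}(retl x) {1}(kum_span (h x)) lr_sum (big_morph ret retD ret0).
  rewrite -(pair_bigA _ (fun a b => comorphism q' (al (a, b) x) * E (a, b))) /=.
  apply: eq_bigr => a _; rewrite lrM -[kap (kum_base _ _ _)]/((kap ∘ base) _) kapb.
  rewrite {1}(tkc_span eL (kum_coef a (h x))) lr_sum mulr_suml.
  rewrite (big_morph ret retD ret0); apply: eq_bigr => b _.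
  rewrite lrM -mulrA -[psi (tkl _ _ _)]/((psi ∘ tkl eL (reg F)) _) tkmap_l.
  exact: retM.
split.
  pose c (a : J * 'I_n) x := kc eF a.2 (al a.1 x).
  apply: (@has_order_of_spanning _ H _
    (fun a : J * 'I_n => comorphism q' (kb eF a.2) * E a.1) c) => [a z x y|x].
    rewrite /c -mulr_algl -(lr1 (comorphism q')) -lrZ alP mulr_algl.
    exact: kcP.
  rewrite -(pair_bigA _ (fun a b => c (a, b) x *: (comorphism q' (kb eF b) * E a))).
  rewrite {1}(sp x); apply: eq_bigr => a _.
  rewrite {1}(kb_span eF (al a x)) lr_sum mulr_suml; apply: eq_bigr => b _.
  by rewrite lrZ scalerAl.
pose l (x : reg H) : reg F := tcoord (kfun eL) (kum_coef (kmod m_gt0 0) (h x)).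
apply: (dual_basis_faithfully_flat (l := l) alP sp) => [c x y|].
  rewrite /l lrD lrM hq kum_coefD kum_coefM (tcoordD (kfunP eL)).
  by rewrite (tcoordM (kfunP eL)).
rewrite /l lr1 kum_coef1 -(lr1 (tkl eL (reg F))) (tcoord_l (kfunP eL)) kfun1.
exact: scale1r.
Qed.
End Main.

Theorem proposition1 (k : fieldType) (T G F : affine_group k)
  (i : group_hom T G) (q : group_hom G F) (n d : nat) (L : fieldExtType k)
  (hG : algebraic G)
  (hT : is_torus T)
  (hiq : short_exact i q)
  (hF : has_order F n) (hn : prime_to_char k n)
  (hL : \dim {:L} = d) (hd : prime_to_char k d)
  (hTL : split_over T L) :
  exists (N H : affine_group k) (a : group_hom N T) (j : group_hom H G)
    (i' : group_hom N H) (q' : group_hom H F),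
  [/\ torsion_subgroup (n * d)%N a,
      finite_group_scheme H /\ closed_subgroup j,
      short_exact i' q',
      forall (R : comAlgType k) (x : points N R),
        on_points j (on_points i' x) = on_points i (on_points a x)
    & forall (R : comAlgType k) (x : points H R),
        on_points q (on_points j x) = on_points q' x].
Proof.
have [eF] := has_order_kbasis hF.
have [eL] := fieldExt_kbasis L; rewrite hL in eL.
have [r [X]] := split_over_splitting hTL.
have [eB] := tensk_kbasis eF eL.
have Tcomm (R : comAlgType k) (x y : points T R) : x · y = y · x.
  exact: (split_comm X eL).
have [s qs] := torsor_section hiq eF eL X.
have [N [a [ca aP]]] := torsion_subgroup_exists (n * d) Tcomm.
have [H [j [cj jP]]] := crossed_kernel hiq eB qs Tcomm.
have [finH ffq] := kernel_finite_flat eF X cj jP.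
have [|i' i'E] := @hom_lift _ N H G j (hom_comp i a) cj.
  move=> R x; rewrite hom_compE; apply/jP; rewrite crossed_i //.
  by apply/aP; exists x.
exists N, H, a, j, i', (hom_comp q j); split=> //.
- split=> // [c|R y]; last first.
    rewrite hom_compE; split=> [qy|[x <-]]; last first.
      by rewrite i'E hom_compE (q_i hiq).
    have [t it] : exists t : points T R, on_points i t = on_points j y.
      by have [_ ker _] := hiq; apply/ker.
    have /aP [x ax] : pt_exp t (n * d) = pt_one T R.
      by rewrite -(crossed_i hiq eB Tcomm qs) it; apply/jP; exists y.
    exists x; apply: (closed_subgroup_inj cj).
    by rewrite i'E hom_compE ax.
  have [t <-] := ca c; have [ci _ _] := hiq; have [g <-] := ci t.
  exists (comorphism j g).
  by have := lr_congr (i'E _ (lr_id (reg N))) g.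
- by move=> R x; rewrite i'E hom_compE.
- by move=> R x; rewrite hom_compE.
Qed.
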